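(* Let $u_0,v_0$ be real-valued $2\pi$-periodic functions on $\mathbb{R}$ with $u_0,v_0\in H^1[0,2\pi]$. Assume that the support of $u_0$ (within the period $[0,2\pi]$) is contained in $(a,b)\subset(0,2\pi)$ with $b-a<\pi$. Let $\phi$ be a $2\pi$-periodic Lipschitz continuous function with $\phi(x)=x-a$ on $[a,b]$, and let $$C=4\int_a^b\phi(x)\,u_0(x)^2\,v_0(x)\,dx,\qquad I_\infty=\int_0^{+\infty}\frac{dy}{\sqrt{y^3+1}} .$$ If $C>0$, then the ($2\pi$-periodic in $x$) solution $(u,v)$ of the initial value problem $$u_t=2uv,\qquad v_t=H(u^2),\qquad u(\cdot,0)=u_0,\quad v(\cdot,0)=v_0,$$ must develop a finite time singularity in the $H^1$ norm no later than $$T^*=\left(\frac{4C\cos\left(\frac{b-a}{2}\right)}{3\pi(b-a)^2}\right)^{-1/3}I_\infty .$$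
   Context: $H$ denotes the Hilbert transform for $2\pi$-periodic functions: $(Hf)(x)=\frac{1}{2\pi}\,\mathrm{P.V.}\int_0^{2\pi}f(y)\cot\left(\frac{x-y}{2}\right)dy$; it acts in the spatial variable $x$. $H^1$ is the Sobolev space of $2\pi$-periodic functions, with norm taken over one period. A solution on $[0,T)$ means a pair $(u,v)$ of functions, $2\pi$-periodic in $x$, with $u,v\in C^1([0,T);H^1)$, satisfying the system and the initial conditions. For given periodic $u_0,v_0\in H^1$ there is a unique solution on a maximal time interval $[0,T_{\max})$, $0<T_{\max}\le\infty$. ''Develops a finite time singularity in the $H^1$ norm no later than $T^*$'' means that $T_{\max}\le T^*$ and that $\|u(t)\|_{H^1}+\|v(t)\|_{H^1}$ is unbounded on $[0,T_{\max})$. *)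

(* Defs.v *)
From HB Require Import structures.
From mathcomp Require Import all_boot all_order all_algebra.
From mathcomp Require Import all_classical all_reals all_analysis.

Set Implicit Arguments.
Unset Strict Implicit.
Unset Printing Implicit Defensive.

Import Order.TTheory GRing.Theory Num.Theory.
Import numFieldNormedType.Exports.

Local Open Scope classical_set_scope.
Local Open Scope ring_scope.

Notation leb := lebesgue_measure.

Definition period {R : realType} : set R := `[0, 2 * pi].

(* Square-integrability over one period. *)
Definition L2per {R : realType} (g : R -> R) : Prop :=
  measurable_fun period g /\
  leb.-integrable period (fun x => (g x ^+ 2)%:E).

Definition C1per {R : realType} (psi : R -> R) : Prop :=
  [/\ periodic psi (2 * pi), (forall x, derivable psi x 1)
    & continuous (derive1 psi)].

(* [g] is a weak derivative of the periodic function [f] in L^2.  Test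
   functions are periodic, so no boundary terms appear. *)
Definition weak_deriv {R : realType} (f g : R -> R) : Prop :=
  L2per g /\
  forall psi : R -> R, C1per psi ->
    \int[leb]_(x in period) (f x * derive1 psi x) =
    - \int[leb]_(x in period) (g x * psi x).

(* The space H^1 of 2pi-periodic functions.  As usual in dimension one, a class
   of a.e. equal functions is identified with its continuous representative. *)
Definition H1per {R : realType} (f : R -> R) : Prop :=
  [/\ periodic f (2 * pi), continuous f & exists g, weak_deriv f g].

(* A choice of weak derivative (unique up to a null set within the period). *)
Definition wderiv {R : realType} (f : R -> R) : R -> R :=
  xget (fun _ => 0) [set g | weak_deriv f g].

(* Meaningful when [H1per f]. *)
Definition H1norm {R : realType} (f : R -> R) : R :=
  Num.sqrt (\int[leb]_(x in period) (f x ^+ 2) +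
            \int[leb]_(x in period) (wderiv f x ^+ 2)).

(* One period with a symmetric [e]-neighbourhood of every singularity
   y = x - 2 pi k of cot ((x - y) / 2) removed; when x is an endpoint of the
   period, this excises a piece at both ends. *)
Definition pv_domain {R : realType} (x e : R) : set R :=
  period `&` [set y | forall k : int, e <= `|x - y - 2 * pi * k%:~R|].

Definition cot {R : realType} (x : R) : R := cos x / sin x.

Definition hilbert {R : realType} (f : R -> R) (x : R) : R :=
  (2 * pi)^-1 *
  lim ((\int[leb]_(y in pv_domain x e) (f y * cot ((x - y) / 2)))
         @[e --> 0^'+]).

(* The half-open interval [0, T), where T may be +oo. *)
Definition Ico0 {R : realType} (T : \bar R) : set R :=
  [set t | 0 <= t /\ (t%:E < T)%E].

(* [w] belongs to C^1([0, T); H^1) and has time derivative [w'] there: the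
   difference quotients converge in the H^1 norm (one-sidedly at t = 0), and
   [w'] is H^1-continuous. *)
Definition C1H1_deriv {R : realType} (T : \bar R) (w w' : R -> R -> R) : Prop :=
  [/\ forall t, Ico0 T t -> H1per (w t) /\ H1per (w' t),
      forall t, Ico0 T t ->
        H1norm ((s - t)^-1 *: (w s - w t) - w' t)
          @[s --> within (Ico0 T) t^'] --> (0 : R)
    & forall t, Ico0 T t ->
        H1norm (w' s - w' t) @[s --> within (Ico0 T) (nbhs t)] --> (0 : R)].

(* Values of [u t] and [v t] for t outside [0, T) are irrelevant. *)
Definition is_solution {R : realType} (u0 v0 : R -> R) (T : \bar R)
    (u v : R -> R -> R) : Prop :=
  [/\ (0 < T)%E, u 0 = u0, v 0 = v0
    & exists u' v' : R -> R -> R,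
      [/\ C1H1_deriv T u u', C1H1_deriv T v v'
        & forall t, Ico0 T t ->
            u' t = (fun x => 2 * u t x * v t x) /\
            v' t = hilbert (fun x => u t x ^+ 2)]].

(* [T] is the maximal existence time: the solution has no extension as a
   solution to a longer interval. *)
Definition is_maximal_solution {R : realType} (u0 v0 : R -> R) (T : \bar R)
    (u v : R -> R -> R) : Prop :=
  is_solution u0 v0 T u v /\
  forall (T' : \bar R) (u1 v1 : R -> R -> R),
    is_solution u0 v0 T' u1 v1 ->
    (forall t, Ico0 T t -> Ico0 T' t -> u1 t = u t /\ v1 t = v t) ->
    (T' <= T)%E.

Definition blows_up_by {R : realType} (Tstar : R) (T : \bar R)
    (u v : R -> R -> R) : Prop :=
  (T <= Tstar%:E)%E /\
  forall M : R, exists2 t, Ico0 T t & M < H1norm (u t) + H1norm (v t).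

Definition I_infty {R : realType} : R :=
  \int[leb]_(y in `[0, +oo[) (Num.sqrt (y ^+ 3 + 1))^-1.

(* Main.v *)
(* Write w = u^2 and J(t) for the integral of phi w over one period. Since u_t = 2uv, the solution
   u(t) vanishes wherever u_0 does, so w stays supported in (a, b). Then J' is 4 times the integral
   of phi u^2 v, with J'(0) = C, and J'' is at least 4 times the integral of phi w Hw. Symmetrizing
   the Hilbert kernel turns the latter integral into that of
   (phi(x) - phi(x - y)) w(x) w(x - y) cot(y/2) / (2 pi) over 0 < y < pi; on the support
   phi(x) - phi(x - y) = y <= b - a and y cot(y/2) >= 2 cos((b - a)/2), whence
   J'' >= k J^2 with k = 2 cos((b - a)/2) / (pi (b - a)^2). Integrating J'' >= k J^2 twice bounds
   the lifespan by T^*.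

   If the H^1 norm stayed bounded up to T_max, the power series in time started at a time close
   enough to T_max would converge in the algebra H^1 on an interval reaching beyond T_max (the
   Hilbert transform is a contraction of H^1), and by uniqueness it would extend the solution.

   The H^1 norm is handled through Fourier coefficients: Fejer approximation, Parseval and
   Riesz-Fischer identify H^1 with the continuous periodic f for which
   \sum_n (1 + n^2) (a_n^2 + b_n^2) is finite, which makes H^1-balls closed under uniform limits. *)
Require Import Defs.
From HB Require Import structures.
From mathcomp Require Import all_boot all_order all_algebra.
From mathcomp Require Import all_classical all_reals all_analysis.
From mathcomp Require Import measurable_realfun.
From mathcomp Require Import ring lra.
Import Order.TTheory GRing.Theory Num.Theory.
Import numFieldNormedType.Exports.
Local Open Scope classical_set_scope.
Local Open Scope ring_scope.

Set Implicit Arguments.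
Unset Strict Implicit.
Unset Printing Implicit Defensive.

(** The definitions offer only a pointwise limit for the Hilbert transform and an existential weak
    derivative, so H^1 estimates cannot be read off by calculus. Two devices get around this.
    Estimates are proved for trigonometric polynomials and carried to H^1 by Fejer means, which
    converge uniformly and do not increase the norm. Identities for the Hilbert transform are proved
    for the kernel cut off at distance e, where all integrands are continuous; the 1/2-Hoelder bound
    of H^1 functions makes the cut-off error O(sqrt e), uniformly in x. Derivatives in time, taken
    in H^1, become scalar ones through bounded linear functionals: point evaluation, the weighted
    integral J, and the truncated Sobolev form paired with a fixed function. After time 0 no
    information on v is used for the blow-up: it contributes the integral of 16 phi w v^2 to J'',
    which is nonnegative on the support and is dropped. The scale l in the Riccati comparison is
    fixed by (2/3) k l^3 = C^2. This gives l = C q^(-1/3), with q the base of the power in T^*, and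
    the bound (C / l) t <= I_infty becomes t <= T^*. *)

Section ContinuityCombinators.
Context {R : realType}.
Implicit Types f g h : R -> R.
Lemma cfD f g : continuous f -> continuous g -> continuous (fun x => f x + g x).
Proof. by move=> cf cg x; exact: continuousD (cf x) (cg x). Qed.
Lemma cfM f g : continuous f -> continuous g -> continuous (fun x => f x * g x).
Proof. by move=> cf cg x; exact: continuousM (cf x) (cg x). Qed.
Lemma cfN f : continuous f -> continuous (fun x => - f x).
Proof. by move=> cf x; exact: continuousN (cf x). Qed.
Lemma cfX f n : continuous f -> continuous (fun x => f x ^+ n).
Proof. move=> cf x; exact: (continuous_comp (cf x) (@exprn_continuous _ n _)). Qed.
Lemma cfcomp f g : continuous f -> continuous g -> continuous (fun x => g (f x)).
Proof. by move=> cf cg x; exact: continuous_comp (cf x) (cg _). Qed.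
Lemma cfabs f : continuous f -> continuous (fun x => `|f x|).
Proof. by move=> cf x; exact: continuous_comp (cf x) (@norm_continuous _ _ _). Qed.
Lemma cfmax f g : continuous f -> continuous g -> continuous (fun x => Num.max (f x) (g x)).
Proof. by move=> cf cg x; exact: continuous_max (cf x) (cg x). Qed.
Lemma cfV f : (forall x, f x != 0) -> continuous f -> continuous (fun x => (f x)^-1).
Proof. by move=> f0 cf x; exact: continuousV (f0 x) (cf x). Qed.
Lemma cfsum (I : Type) (r : seq I) (P : pred I) (F : I -> R -> R) :
  (forall i, P i -> continuous (F i)) -> continuous (fun x => \sum_(i <- r | P i) F i x).
Proof.
move=> cF; elim: r => [|i r IH].
  rewrite (_ : (fun _ => _) = cst 0); first exact: cst_continuous.
  by apply/funext => x; rewrite big_nil.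
case: (boolP (P i)) => Pi.
  rewrite (_ : (fun _ => _) = fun x => F i x + \sum_(j <- r | P j) F j x); last first.
    by apply/funext => x; rewrite big_cons Pi.
  by apply: cfD => //; exact: cF.
rewrite (_ : (fun _ => _) = fun x => \sum_(j <- r | P j) F j x)//.
by apply/funext => x; rewrite big_cons (negbTE Pi).
Qed.
Lemma cfid : continuous (fun x : R => x).
Proof. by move=> x; exact: cvg_id. Qed.
Lemma cfcst (c : R) : continuous (fun _ : R => c).
Proof. exact: cst_continuous. Qed.
End ContinuityCombinators.
Ltac cts_op :=
 match goal with
 | |- continuous (fun x => x) => exact (@cfid _)
 | |- continuous (fun x => ?c) => exact (@cfcst _ c)
 | |- continuous (fun x => @?f x + @?g x) => apply (@cfD _ f g)
 | |- continuous (fun x => - @?f x) => apply (@cfN _ f)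
 | |- continuous (fun x => @?f x * @?g x) => apply (@cfM _ f g)
 | |- continuous (fun x => @?f x ^+ ?n) => apply (@cfX _ f n)
 | |- continuous (fun x => `|@?f x|) => apply (@cfabs _ f)
 | |- continuous (fun x => Num.max (@?f x) (@?g x)) => apply (@cfmax _ f g)
 | |- continuous (fun x => \sum_(i <- ?r | @?P i) (@?F i x)) => apply (@cfsum _ _ r P (fun i x => F i x)) => ? ? 
 | |- continuous (fun x => cos (@?f x)) => apply (@cfcomp _ f cos); last exact (@continuous_cos _)
 | |- continuous (fun x => sin (@?f x)) => apply (@cfcomp _ f sin); last exact (@continuous_sin _)
 end.
Ltac cts_comp :=
 match goal with
 | |- continuous (fun x => ?F (@?g x)) => apply (@cfcomp _ g F)
 end.
Create HintDb cts.
Ltac cts_atom := first [eassumption | solve [trivial with cts nocore]].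
(* The second branch covers goals whose continuity is only known for a composite function. *)
Ltac cts :=
  cbv beta; first
    [ solve [repeat first [cts_op; cbv beta | cts_atom | cts_comp; cbv beta]]
    | repeat first [cts_atom | cts_op; cbv beta | cts_comp; cbv beta] ].

(** * Integrals of continuous functions: primitives, substitutions, periodicity *)

Section IntegralsOfContinuousFunctions.
Context {R : realType}.
Implicit Types (f g h F Phi phi : R -> R) (a b c s k x l : R).

Lemma cint f (a b : R) : continuous f -> leb.-integrable `[a, b] (EFin \o f).
Proof.
move=> cf; apply: continuous_compact_integrable; first exact: segment_compact.
by apply: continuous_subspaceT.
Qed.

Lemma intD f g a b : continuous f -> continuous g ->
  \int[leb]_(x in `[a, b]) (f x + g x) =
  \int[leb]_(x in `[a, b]) f x + \int[leb]_(x in `[a, b]) g x.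
Proof. by move=> cf cg; rewrite RintegralD//; exact: cint. Qed.

Lemma intB f g a b : continuous f -> continuous g ->
  \int[leb]_(x in `[a, b]) (f x - g x) =
  \int[leb]_(x in `[a, b]) f x - \int[leb]_(x in `[a, b]) g x.
Proof. by move=> cf cg; rewrite RintegralB//; exact: cint. Qed.

Lemma intZ k f a b : continuous f ->
  \int[leb]_(x in `[a, b]) (k * f x) = k * \int[leb]_(x in `[a, b]) f x.
Proof. by move=> cf; rewrite RintegralZl//; exact: cint. Qed.

Lemma int_le f g a b : continuous f -> continuous g ->
  (forall x, a <= x <= b -> f x <= g x) ->
  \int[leb]_(x in `[a, b]) f x <= \int[leb]_(x in `[a, b]) g x.
Proof.
move=> cf cg fg; apply: le_Rintegral; [by []|exact: cint|exact: cint|by move=> x; rewrite /= in_itv /=; exact: fg].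
Qed.

Lemma int_cst k a b : a <= b -> \int[leb]_(x in `[a, b]) k = k * (b - a).
Proof. by move=> ab; rewrite Rintegral_cst//= lebesgue_measure_itv/= lte_fin; move: ab; rewrite le_eqVlt => /orP[/eqP->|->//]; rewrite ltxx subrr. Qed.

Lemma int_abs_le f a b k : a <= b -> continuous f ->
  (forall x, a <= x <= b -> `|f x| <= k) ->
  `|\int[leb]_(x in `[a, b]) f x| <= k * (b - a).
Proof.
move=> ab cf fk; apply: le_trans (le_normr_Rintegral _ _) _ => //; first exact: cint.
rewrite -int_cst//; apply: int_le => //; cts.
Qed.

Lemma int_split f a b c : continuous f -> a <= c -> c <= b ->
  \int[leb]_(x in `[a, b]) f x =
  \int[leb]_(x in `[a, c]) f x + \int[leb]_(x in `[c, b]) f x.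
Proof.
move=> cf ac cb; apply/eqP; rewrite addrC -subr_eq; apply/eqP.
rewrite Rintegral_itvB ?bnd_simp//; last exact: cint.
by rewrite Rintegral_itv_obnd_cbnd//; apply: integrableS (@cint _ a b cf) => //; apply: subset_itvr; rewrite bnd_simp.
Qed.

(** Basing the primitive at a point [c] strictly to the left of the intervals in use makes it
    differentiable at their left endpoints too, and one [F] serves all of them. *)
Lemma prim f c : continuous f -> exists F : R -> R,
  (forall x, c < x -> is_derive x 1 F (f x)) /\
  (forall a b, c < a -> a <= b -> \int[leb]_(x in `[a, b]) f x = F b - F a).
Proof.
move=> cf; exists (fun x => \int[leb]_(t in `[c, x]) f t); split => [x cx|a b ca ab].
  have xx1 : x < x + 1 by rewrite ltrDl.
  have [d <-] := continuous_FTC1_closed xx1 (@cint _ c (x + 1) cf) cx (cf x).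
  by rewrite derive1E; apply: derivableP.
by rewrite (@int_split f c b a)// ?(ltW ca)// addrAC subrr add0r.
Qed.

Lemma is_derive_cont f x l : is_derive x 1 f l -> {for x, continuous f}.
Proof. by move=> d; apply/differentiable_continuous/derivable1_diffP; case: d. Qed.

(** The mean value theorem for [Phi] minus a primitive of [h]. Only [h] is integrated, so [phi] may
    be any derivative, continuous or not, and [Phi] is differentiated in the open interval only. *)
Lemma int_le_prim h Phi phi a b : a <= b -> continuous h ->
  (forall x, a < x < b -> is_derive x 1 Phi (phi x)) ->
  {within `[a, b], continuous Phi} ->
  (forall x, a < x < b -> h x <= phi x) ->
  \int[leb]_(x in `[a, b]) h x <= Phi b - Phi a.
Proof.
rewrite le_eqVlt => /orP[/eqP<- ch _ _ _|ab ch dPhi cPhi hphi].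
  by rewrite set_itv1 Rintegral_set1 subrr.
have a1 : a - 1 < a by rewrite ltrBlDr ltrDl.
have [F [dF ->]] := prim (a - 1) ch; rewrite ?(ltW ab)//.
have [x|z|z zab] := @MVT R (fun x => Phi x - F x) (fun x => phi x - h x) a b ab.
- rewrite in_itv /= => xab; apply: is_deriveB; first exact: dPhi.
  by apply: dF; case/andP: xab => ax _; rewrite (lt_trans a1).
- apply: (@continuousB _ _ _ (from_subspace `[a, b] Phi) (from_subspace `[a, b] F)); first exact: cPhi.
  move: z; apply: continuous_in_subspaceT => z; rewrite inE /= in_itv /= => /andP[az _].
  by apply: is_derive_cont; apply: dF; rewrite (lt_le_trans a1).
move: zab; rewrite in_itv /= => zab E.
have : 0 <= (phi z - h z) * (b - a) by rewrite mulr_ge0 ?subr_ge0 ?hphi// ltW.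
by rewrite -E; lra.
Qed.

Lemma int_prim h Phi a b : a <= b -> continuous h ->
  (forall x, is_derive x 1 Phi (h x)) ->
  \int[leb]_(x in `[a, b]) h x = Phi b - Phi a.
Proof.
move=> ab ch dPhi; have cPhi : continuous Phi by move=> x; exact: is_derive_cont.
apply/eqP; rewrite eq_le; apply/andP; split.
  by apply: (@int_le_prim h Phi h) => //; exact: continuous_subspaceT.
have cN : continuous (fun x => - h x) by cts.
rewrite -lerN2.
have -> : - (Phi b - Phi a) = - Phi b - - Phi a by ring.
have -> : - (\int[leb]_(x in `[a, b]) h x) = \int[leb]_(x in `[a, b]) (- h x).
  by rewrite -mulN1r -intZ//; apply: eq_Rintegral => x _; rewrite mulN1r.
apply: (@int_le_prim _ (fun x => - Phi x) (fun x => - h x)) => //.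
  by apply: continuous_subspaceT; cts.
Qed.

(** The shifted primitive of [f] is a primitive of the shifted function, but only to the right of a
    base point; hence two applications of [int_le_prim], to the function and to its opposite,
    instead of [int_prim]. *)
Lemma int_shift f a b s : a <= b -> continuous f ->
  \int[leb]_(x in `[a, b]) f (x + s) = \int[leb]_(x in `[a + s, b + s]) f x.
Proof.
move=> ab cf; have [F [dF FE]] := prim (a + s - 1) cf.
have as1 : a + s - 1 < a + s by rewrite ltrBlDr ltrDl.
rewrite FE ?lerD2r//.
have cs : continuous (fun x => f (x + s)) by cts.
have d x : a - 1 < x -> is_derive x 1 (fun y => F (y + s)) (f (x + s)).
  move=> ax; rewrite -[f _]mulr1; apply: (@is_derive1_comp _ F (fun y => y + s)).
    by apply: dF; lra.
  exact: is_derive_shift.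
have c : {within `[a, b], continuous (fun y => F (y + s))}.
  apply: continuous_in_subspaceT => z; rewrite inE /= in_itv /= => /andP[az _].
  by apply: (@is_derive_cont _ _ (f (z + s))); apply: d; lra.
apply/eqP; rewrite eq_le; apply/andP; split.
  apply: (@int_le_prim _ (fun y => F (y + s)) (fun y => f (y + s))) => // x /andP[ax _].
  by apply: d; lra.
rewrite -lerN2.
have -> : - (\int[leb]_(x in `[a, b]) f (x + s)) = \int[leb]_(x in `[a, b]) (- f (x + s)).
  by rewrite -mulN1r -intZ//; apply: eq_Rintegral => x _; rewrite mulN1r.
have -> : - (F (b + s) - F (a + s)) = - F (b + s) - - F (a + s) by ring.
apply: (@int_le_prim _ (fun y => - F (y + s)) (fun y => - f (y + s))) => //.
- by cts.
- by move=> x /andP[ax _]; apply: is_deriveN; apply: d; lra.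
- by move=> z; apply: (@continuousN _ _ _ (from_subspace `[a, b] (fun y => F (y + s)))); exact: c.
Qed.

Lemma int_opp f a b : a <= b -> continuous f ->
  \int[leb]_(x in `[a, b]) f (- x) = \int[leb]_(x in `[(- b), (- a)]) f x.
Proof.
move=> ab cf; rewrite /Rintegral integration_by_substitution_oppr//.
exact: continuous_subspaceT.
Qed.

(** The increment F(y + 2 pi) - F(y) of a primitive has derivative f(y + 2 pi) - f(y) = 0, so it is
    constant; its values at [c] and at 0 are the two integrals. *)
Lemma int_periodic f c : continuous f -> periodic f (2 * pi) ->
  \int[leb]_(x in `[c, c + 2 * pi]) f x = \int[leb]_(x in `[0, 2 * pi]) f x.
Proof.
move=> cf pf; have [F [dF FE]] := prim (Num.min 0 c - 1) cf.
have p0 : 0 <= 2 * pi :> R by rewrite mulr_ge0// pi_ge0.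
set m := Num.min 0 c - 1 in dF FE.
have m0 : m < 0 by rewrite ltrBlDr add0r gt_min ltr01.
have mc : m < c by rewrite ltrBlDr gt_min ltrDl ltr01 orbT.
rewrite !FE// ?lerDl//.
have d x : m < x -> is_derive x 1 (fun y => F (y + 2 * pi) - F y) 0.
  move=> mx; rewrite -(subrr (f x)); apply: is_deriveB; last exact: dF.
  rewrite -{1}pf -[f _]mulr1; apply: (@is_derive1_comp _ F (fun y => y + 2 * pi)).
    by apply: dF; lra.
  exact: is_derive_shift.
suff H x y : m < x -> x < y -> F (y + 2 * pi) - F y = F (x + 2 * pi) - F x.
  have [c0|c0|c0] := ltgtP c 0.
  - by rewrite -(H c 0)// add0r.
  - by rewrite (H 0 c)// add0r.
  - by rewrite c0 add0r.
move=> mx xy.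
have [z|z|z _] := @MVT R (fun x => F (x + 2 * pi) - F x) (fun _ => 0) x y xy.
- by rewrite in_itv /= => /andP[xz _]; apply: d; exact: lt_trans xz.
- move: z; apply: continuous_in_subspaceT => z; rewrite inE /= in_itv /= => /andP[xz _].
  by apply: (@is_derive_cont _ _ 0); apply: d; exact: lt_le_trans xz.
by rewrite mul0r => /eqP; rewrite subr_eq0 => /eqP.
Qed.

Lemma int_sum (n : nat) (F : nat -> R -> R) a b : (forall i, continuous (F i)) ->
  \int[leb]_(x in `[a, b]) (\sum_(i < n) F i x) = \sum_(i < n) \int[leb]_(x in `[a, b]) F i x.
Proof.
move=> cF; elim: n => [|n IH].
  under eq_Rintegral do rewrite big_ord0.
  rewrite big_ord0 -[RHS](mul0r (\int[leb]_(x in `[a, b]) 1)) -intZ; last by cts.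
  by apply: eq_Rintegral => x _; rewrite mul0r.
rewrite big_ord_recr /= -IH -intD//; last by cts.
by apply: eq_Rintegral => x _; rewrite big_ord_recr.
Qed.

End IntegralsOfContinuousFunctions.

(** * The Cauchy-Schwarz inequality for integrals *)

Section SquareIntegrals.
Context {R : realType} {d : measure_display} {T : measurableType d}.
Context (mu : {measure set T -> \bar R}) (D : set T) (mD : measurable D).
Implicit Types (f g : T -> R) (k : R).

Lemma igD f g : mu.-integrable D (fun x => (f x)%:E) ->
  mu.-integrable D (fun x => (g x)%:E) -> mu.-integrable D (fun x => (f x + g x)%:E).
Proof. by move=> If Ig; have := integrableD mD If Ig. Qed.

Lemma igZ k f : mu.-integrable D (fun x => (f x)%:E) ->
  mu.-integrable D (fun x => (k * f x)%:E).
Proof. by move=> If; have := integrableZl mD k If. Qed.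

Lemma int_CS f g :
  mu.-integrable D (fun x => (f x ^+ 2)%:E) ->
  mu.-integrable D (fun x => (g x ^+ 2)%:E) ->
  mu.-integrable D (fun x => (f x * g x)%:E) ->
  (\int[mu]_(x in D) (f x * g x)) ^+ 2 <=
  \int[mu]_(x in D) (f x ^+ 2) * \int[mu]_(x in D) (g x ^+ 2).
Proof.
move=> If Ig Ifg.
set A := \int[mu]_(x in D) (f x ^+ 2); set B := \int[mu]_(x in D) (f x * g x).
set C := \int[mu]_(x in D) (g x ^+ 2).
have H s : 0 <= A + 2 * s * B + s ^+ 2 * C.
  have -> : A + 2 * s * B + s ^+ 2 * C = \int[mu]_(x in D) ((f x + s * g x) ^+ 2).
    rewrite /A /B /C -!RintegralZl// -!RintegralD//; last 3 first.
    - by apply: igD => //; exact: igZ.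
    - exact: igZ.
    - exact: igZ.
    by apply: eq_Rintegral => x _; ring.
  by apply: Rintegral_ge0 => x _; exact: sqr_ge0.
have A0 : 0 <= A by apply: Rintegral_ge0 => x _; exact: sqr_ge0.
have C0 : 0 <= C by apply: Rintegral_ge0 => x _; exact: sqr_ge0.
have [C0'|Cn] := eqVneq C 0.
  have [->|Bn] := eqVneq B 0; first by rewrite C0' mulr0 expr0n.
  (* With C = 0 the quadratic is affine in s, and this s gives it the value -1. *)
  have := H (- (A + 1) / (2 * B)); rewrite C0' mulr0 addr0.
  have -> : 2 * (- (A + 1) / (2 * B)) * B = - (A + 1) by field.
  by lra.
(* The minimum of the quadratic, where it equals (A C - B^2) / C. *)
have := H (- B / C).
have -> : A + 2 * (- B / C) * B + (- B / C) ^+ 2 * C = (A * C - B ^+ 2) / C by field.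
by rewrite pmulr_lge0 ?subr_ge0// invr_gt0 lt_def Cn.
Qed.

End SquareIntegrals.

(** * Rules for computing derivatives *)

Section DerivativeCombinators.
Context {R : realType}.
Implicit Types (f g : R -> R) (x a b k : R).

Lemma dEq f x a b : is_derive x 1 f a -> a = b -> is_derive x 1 f b.
Proof. by move=> d <-. Qed.
Lemma dcst k x : is_derive x 1 (fun _ : R => k) 0.
Proof. exact: is_derive_cst. Qed.
Lemma did x : is_derive x 1 (fun y : R => y) 1.
Proof. exact: is_derive_id. Qed.
Lemma dD f g x a b : is_derive x 1 f a -> is_derive x 1 g b ->
  is_derive x 1 (fun y => f y + g y) (a + b).
Proof. by move=> df dg; exact: is_deriveD. Qed.
Lemma dN f x a : is_derive x 1 f a -> is_derive x 1 (fun y => - f y) (- a).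
Proof. by move=> df; exact: is_deriveN. Qed.
Lemma dM f g x a b : is_derive x 1 f a -> is_derive x 1 g b ->
  is_derive x 1 (fun y => f y * g y) (f x * b + g x * a).
Proof. by move=> df dg; exact: is_deriveM. Qed.
Lemma dX f n x a : is_derive x 1 f a ->
  is_derive x 1 (fun y => f y ^+ n) (n%:R * f x ^+ n.-1 * a).
Proof.
move=> df; have := is_deriveX n df; rewrite /GRing.scale /=.
by rewrite (_ : f ^+ n = fun y => f y ^+ n)//; apply/funext => y; rewrite exprfctE.
Qed.
Lemma dcomp f g x a b : is_derive (f x) 1 g b -> is_derive x 1 f a ->
  is_derive x 1 (fun y => g (f y)) (b * a).
Proof. by move=> dg df; exact: (@is_derive1_comp _ g f). Qed.
Lemma dcos f x a : is_derive x 1 f a -> is_derive x 1 (fun y => cos (f y)) (- sin (f x) * a).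
Proof. by move=> df; apply: (@dcomp f cos). Qed.
Lemma dsin f x a : is_derive x 1 f a -> is_derive x 1 (fun y => sin (f y)) (cos (f x) * a).
Proof. by move=> df; apply: (@dcomp f sin). Qed.
Lemma dsum n (F : nat -> R -> R) (dF : nat -> R) x :
  (forall i, is_derive x 1 (F i) (dF i)) ->
  is_derive x 1 (fun y => \sum_(i < n) F i y) (\sum_(i < n) dF i).
Proof.
move=> H; elim: n => [|n IH].
  rewrite big_ord0 (_ : (fun _ => _) = fun _ => 0); first exact: dcst.
  by apply/funext => y; rewrite big_ord0.
rewrite big_ord_recr /= (_ : (fun _ => _) = fun y => \sum_(i < n) F i y + F n y).
  exact: dD.
by apply/funext => y; rewrite big_ord_recr.
Qed.
End DerivativeCombinators.

Ltac drv_step :=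
  match goal with
  | |- is_derive _ _ (fun y => y) _ => exact: did
  | |- is_derive _ _ (fun y => ?c) _ => exact: dcst
  | |- is_derive ?x _ (fun y => @?f y + @?g y) _ => apply (@dD _ f g x)
  | |- is_derive ?x _ (fun y => - @?f y) _ => apply (@dN _ f x)
  | |- is_derive ?x _ (fun y => @?f y * @?g y) _ => apply (@dM _ f g x)
  | |- is_derive ?x _ (fun y => @?f y ^+ ?n) _ => apply (@dX _ f n x)
  | |- is_derive ?x _ (fun y => cos (@?f y)) _ => apply (@dcos _ f x)
  | |- is_derive ?x _ (fun y => sin (@?f y)) _ => apply (@dsin _ f x)
  end.
(** The value of the derivative is left to unification and built by the rules; what remains is the
    equation between that value and the expected one. *)
Ltac drv := eapply dEq; [cbv beta; repeat first [eassumption | drv_step; cbv beta] | ].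

(** * Orthogonality of the trigonometric system *)

Section TrigonometricIntegrals.
Context {R : realType}.
Implicit Types (f g : R -> R) (x : R) (n m : nat).

Definition cosn n x : R := cos (n%:R * x).
Definition sinn n x : R := sin (n%:R * x).

Lemma cosn_cont n : continuous (cosn n).
Proof. by rewrite /cosn; cts. Qed.
Lemma sinn_cont n : continuous (sinn n).
Proof. by rewrite /sinn; cts. Qed.

Lemma twopi_gt0 : 0 < 2 * pi :> R.
Proof. by rewrite mulr_gt0// pi_gt0. Qed.
Lemma twopi_ge0 : 0 <= 2 * pi :> R.
Proof. exact: ltW twopi_gt0. Qed.

Lemma cosn_periodic n : periodic (cosn n) (2 * pi).
Proof.
move=> x; rewrite /cosn mulrDr mulrA -(mulrC 2) -mulrA.
have -> : 2 * (n%:R * pi) = (pi *+ 2) *+ n :> R by rewrite -[RHS]mulr_natl -[pi *+ 2]mulr_natl mulrCA.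
by rewrite (periodicn (@cosD2pi R)).
Qed.
Lemma sinn_periodic n : periodic (sinn n) (2 * pi).
Proof.
move=> x; rewrite /sinn mulrDr mulrA -(mulrC 2) -mulrA.
have -> : 2 * (n%:R * pi) = (pi *+ 2) *+ n :> R by rewrite -[RHS]mulr_natl -[pi *+ 2]mulr_natl mulrCA.
by rewrite (periodicn (@sinD2pi R)).
Qed.

Lemma cosn_derive n x : is_derive x 1 (cosn n) (- (n%:R * sinn n x)).
Proof. by rewrite /cosn /sinn; drv; ring. Qed.
Lemma sinn_derive n x : is_derive x 1 (sinn n) (n%:R * cosn n x).
Proof. by rewrite /cosn /sinn; drv; ring. Qed.

Lemma cosn_le1 n x : `|cosn n x| <= 1.
Proof. exact: cos_max. Qed.
Lemma sinn_le1 n x : `|sinn n x| <= 1.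
Proof. exact: sin_max. Qed.
Lemma sinn0 n : sinn n 0 = 0. Proof. by rewrite /sinn mulr0 sin0. Qed.
Lemma cos0n x : cosn 0 x = 1. Proof. by rewrite /cosn mul0r cos0. Qed.
Lemma sin0n x : sinn 0 x = 0. Proof. by rewrite /sinn mul0r sin0. Qed.

Lemma int_cosn n : \int[leb]_(x in `[0, 2 * pi]) cosn n x =
  if n == 0%N then 2 * pi else 0.
Proof.
case: eqP => [->|/eqP n0].
  under eq_Rintegral do rewrite cos0n.
  by rewrite int_cst ?twopi_ge0// subr0 mul1r.
have n0' : n%:R != 0 :> R by rewrite pnatr_eq0.
have d x : is_derive x 1 (fun x => n%:R^-1 * sinn n x) (cosn n x).
  by have d := sinn_derive n x; drv; rewrite mulr0 addr0 mulrA mulVf ?mul1r.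
by rewrite (int_prim twopi_ge0 (@cosn_cont n) d) -[2 * pi]add0r sinn_periodic subrr.
Qed.

Lemma int_sinn n : \int[leb]_(x in `[0, 2 * pi]) sinn n x = 0.
Proof.
case: (eqVneq n 0%N) => [->|n0].
  under eq_Rintegral do rewrite sin0n.
  by rewrite int_cst ?twopi_ge0// mul0r.
have n0' : n%:R != 0 :> R by rewrite pnatr_eq0.
have d x : is_derive x 1 (fun x => - n%:R^-1 * cosn n x) (sinn n x).
  by have d := cosn_derive n x; drv; rewrite mulr0 addr0 mulrNN mulrA mulVf ?mul1r.
by rewrite (int_prim twopi_ge0 (@sinn_cont n) d) -[2 * pi]add0r cosn_periodic subrr.
Qed.

(* Normalization: the Fourier series of f is \sum_n kap n * (ca f n * cosn n + cb f n * sinn n). *)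
Definition kap n : R := if n == 0%N then (2 * pi)^-1 else pi^-1.
Lemma kap_gt0 n : 0 < kap n.
Proof. by rewrite /kap; case: eqP => _; rewrite invr_gt0 ?twopi_gt0 ?pi_gt0. Qed.
Lemma kap_ge0 n : 0 <= kap n. Proof. exact: ltW (kap_gt0 n). Qed.
Lemma kap_neq0 n : kap n != 0. Proof. exact: lt0r_neq0 (kap_gt0 n). Qed.

(** In this formula and the next three, [m <= n] makes the natural subtraction [n - m] exact; the
    integrals below reduce to this case by symmetry. *)
Lemma cosn_mul n m x : (m <= n)%N ->
  cosn n x * cosn m x = 2^-1 * (cosn (n + m) x + cosn (n - m) x).
Proof. by move=> mn; rewrite /cosn natrD natrB// mulrDl mulrBl cosD cosB; field. Qed.
Lemma sinn_mul n m x : (m <= n)%N ->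
  sinn n x * sinn m x = 2^-1 * (cosn (n - m) x - cosn (n + m) x).
Proof. by move=> mn; rewrite /cosn /sinn natrD natrB// mulrBl mulrDl cosB cosD; field. Qed.
Lemma sinn_cosn_mul n m x : (m <= n)%N ->
  sinn n x * cosn m x = 2^-1 * (sinn (n + m) x + sinn (n - m) x).
Proof. by move=> mn; rewrite /cosn /sinn natrD natrB// mulrDl mulrBl sinD sinB; field. Qed.
Lemma cosn_sinn_mul n m x : (m <= n)%N ->
  cosn n x * sinn m x = 2^-1 * (sinn (n + m) x - sinn (n - m) x).
Proof. by move=> mn; rewrite /cosn /sinn natrD natrB// mulrDl mulrBl sinD sinB; field. Qed.

Lemma int_cosn_cosn n m : \int[leb]_(x in `[0, 2 * pi]) (cosn n x * cosn m x) =
  if n == m then (kap n)^-1 else 0.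
Proof.
wlog mn : n m / (m <= n)%N.
  move=> H; case: (leqP m n) => [/H//|/ltnW mn].
  under eq_Rintegral do rewrite mulrC.
  by rewrite H// eq_sym; case: eqP => // ->.
have c k : continuous (cosn k) by exact: cosn_cont.
under eq_Rintegral do rewrite cosn_mul//.
rewrite (@intZ _ _ (fun x => cosn (n + m) x + cosn (n - m) x)); last by cts.
rewrite (@intD _ (cosn (n + m)) (cosn (n - m)))// !int_cosn.
rewrite addn_eq0 subn_eq0 (eqn_leq n m) mn andbT /kap.
case: (leqP n m) => nm; case: (eqVneq n 0%N) => n0 /=.
- by move: mn; rewrite n0 leqn0 => ->; rewrite invrK; field.
- by rewrite invrK add0r mulrA mulVf ?mul1r// pnatr_eq0.
- by move: nm; rewrite n0.
- by rewrite addr0 mulr0.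
Qed.

Lemma int_sinn_sinn n m : \int[leb]_(x in `[0, 2 * pi]) (sinn n x * sinn m x) =
  if (n == m) && (n != 0%N) then (kap n)^-1 else 0.
Proof.
wlog mn : n m / (m <= n)%N.
  move=> H; case: (leqP m n) => [/H//|/ltnW mn].
  under eq_Rintegral do rewrite mulrC.
  by rewrite H// eq_sym; case: eqP => //= ->.
have c k : continuous (cosn k) by exact: cosn_cont.
under eq_Rintegral do rewrite sinn_mul//.
rewrite (@intZ _ _ (fun x => cosn (n - m) x - cosn (n + m) x)); last by cts.
rewrite (@intB _ (cosn (n - m)) (cosn (n + m)))// !int_cosn.
rewrite addn_eq0 subn_eq0 (eqn_leq n m) mn andbT /kap.
case: (leqP n m) => nm; case: (eqVneq n 0%N) => n0 /=.
- by move: mn; rewrite n0 leqn0 => ->; rewrite subrr mulr0.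
- by rewrite invrK subr0 mulrA mulVf ?mul1r// pnatr_eq0.
- by move: nm; rewrite n0.
- by rewrite subr0 mulr0.
Qed.

Lemma int_cosn_sinn n m : \int[leb]_(x in `[0, 2 * pi]) (cosn n x * sinn m x) = 0.
Proof.
have c k : continuous (sinn k) by exact: sinn_cont.
case: (leqP m n) => [mn|/ltnW mn].
  under eq_Rintegral do rewrite cosn_sinn_mul//.
  rewrite (@intZ _ _ (fun x => sinn (n + m) x - sinn (n - m) x)); last by cts.
  by rewrite (@intB _ (sinn (n + m)) (sinn (n - m)))// !int_sinn subrr mulr0.
under eq_Rintegral do rewrite mulrC sinn_cosn_mul//.
rewrite (@intZ _ _ (fun x => sinn (m + n) x + sinn (m - n) x)); last by cts.
by rewrite (@intD _ (sinn (m + n)) (sinn (m - n)))// !int_sinn addr0 mulr0.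
Qed.

End TrigonometricIntegrals.
#[export] Hint Resolve cosn_cont sinn_cont : cts.

(** * The L^2 pairing over one period *)

Section SquareIntegrableFunctions.
Context {R : realType}.
Implicit Types (f g h : R -> R) (k x y : R).

Lemma mper : measurable (period : set (measurableTypeR R)).
Proof. exact: measurable_itv. Qed.

Lemma L2cont f : continuous f -> L2per f.
Proof.
move=> cf; split; last by apply: (@cint _ (fun x => f x ^+ 2)); cts.
by apply: measurable_funTS; exact: continuous_measurable_fun.
Qed.

Lemma L2mul f g : L2per f -> L2per g ->
  leb.-integrable period (fun x => (f x * g x)%:E).
Proof.
move=> [mf If] [mg Ig]; apply: (le_integrable mper _ _ (igD mper If Ig)).
  by apply/measurable_EFinP; exact: measurable_funM.
move=> x _; rewrite lee_fin [X in _ <= X]ger0_norm ?addr_ge0 ?sqr_ge0// normrM.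
rewrite -(real_normK (num_real (f x))) -(real_normK (num_real (g x))).
have := sqr_ge0 (`|f x| - `|g x|); have := normr_ge0 (f x); have := normr_ge0 (g x); nra.
Qed.

Lemma L2D f g : L2per f -> L2per g -> L2per (fun x => f x + g x).
Proof.
move=> Lf Lg; have [mf If] := Lf; have [mg Ig] := Lg; split.
  exact: measurable_funD.
have -> : (fun x => ((f x + g x) ^+ 2)%:E) =
    (fun x => (f x ^+ 2 + 2 * (f x * g x) + g x ^+ 2)%:E).
  by apply/funext => x; congr EFin; ring.
by apply: igD => //; [exact: mper|apply: igD => //; [exact: mper|apply: igZ; [exact: mper|exact: L2mul]]].
Qed.

Lemma L2Z k f : L2per f -> L2per (fun x => k * f x).
Proof.
move=> [mf If]; split; first exact: measurable_funM.
have -> : (fun x => ((k * f x) ^+ 2)%:E) = (fun x => (k ^+ 2 * (f x ^+ 2))%:E).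
  by apply/funext => x; rewrite exprMn.
by apply: igZ => //; exact: mper.
Qed.

Lemma L2N f : L2per f -> L2per (fun x => - f x).
Proof.
move=> /(L2Z (-1)); have -> // : (fun x => -1 * f x) = (fun x => - f x).
by apply/funext => x; rewrite mulN1r.
Qed.

Lemma L2B f g : L2per f -> L2per g -> L2per (fun x => f x - g x).
Proof. by move=> Lf Lg; apply: L2D => //; exact: L2N. Qed.

Definition ip f g : R := \int[leb]_(x in period) (f x * g x).

Lemma ipC f g : ip f g = ip g f.
Proof. by apply: eq_Rintegral => x _; rewrite mulrC. Qed.

Lemma ipDl f g h : L2per f -> L2per g -> L2per h ->
  ip (fun x => f x + g x) h = ip f h + ip g h.
Proof.
move=> Lf Lg Lh; rewrite /ip -RintegralD; [|exact: mper|exact: L2mul|exact: L2mul].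
by apply: eq_Rintegral => x _; rewrite mulrDl.
Qed.

Lemma ipZl k f h : L2per f -> L2per h -> ip (fun x => k * f x) h = k * ip f h.
Proof.
move=> Lf Lh; rewrite /ip -RintegralZl; [|exact: mper|exact: L2mul].
by apply: eq_Rintegral => x _; rewrite mulrA.
Qed.

Lemma ipNl f h : L2per f -> L2per h -> ip (fun x => - f x) h = - ip f h.
Proof.
move=> Lf Lh; rewrite -[RHS]mulN1r -ipZl//.
by apply: eq_Rintegral => x _; rewrite mulN1r.
Qed.

Lemma ipBl f g h : L2per f -> L2per g -> L2per h ->
  ip (fun x => f x - g x) h = ip f h - ip g h.
Proof. by move=> Lf Lg Lh; rewrite ipDl ?ipNl//; exact: L2N. Qed.

Lemma ipDr f g h : L2per f -> L2per g -> L2per h ->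
  ip h (fun x => f x + g x) = ip h f + ip h g.
Proof. by move=> *; rewrite ipC ipDl// !(ipC h). Qed.

Lemma ipBr f g h : L2per f -> L2per g -> L2per h ->
  ip h (fun x => f x - g x) = ip h f - ip h g.
Proof. by move=> *; rewrite ipC ipBl// !(ipC h). Qed.

Lemma ipZr k f h : L2per f -> L2per h -> ip h (fun x => k * f x) = k * ip h f.
Proof. by move=> *; rewrite ipC ipZl// !(ipC h). Qed.

Lemma ip_ge0 f : 0 <= ip f f.
Proof. by apply: Rintegral_ge0 => x _; rewrite -expr2 sqr_ge0. Qed.

Lemma ip_sqr f : \int[leb]_(x in period) (f x ^+ 2) = ip f f.
Proof. by apply: eq_Rintegral => x _; rewrite expr2. Qed.

Lemma ip_CS f g : L2per f -> L2per g -> ip f g ^+ 2 <= ip f f * ip g g.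
Proof.
move=> Lf Lg; have [_ If] := Lf; have [_ Ig] := Lg.
rewrite -!ip_sqr; apply: int_CS => //; [exact: mper|exact: L2mul].
Qed.

Lemma ip_le_sup f g k1 k2 : continuous f -> continuous g -> 0 <= k1 -> 0 <= k2 ->
  (forall x, `|f x| <= k1) -> (forall x, `|g x| <= k2) ->
  `|ip f g| <= k1 * k2 * (2 * pi).
Proof.
move=> cf cg k10 k20 fk gk; rewrite /ip -[X in _ * X]subr0.
apply: int_abs_le; [exact: twopi_ge0|by cts|move=> x _].
by rewrite normrM ler_pM.
Qed.

Lemma ip_sum f n (F : nat -> R -> R) : L2per f -> (forall i, continuous (F i)) ->
  ip f (fun x => \sum_(i < n) F i x) = \sum_(i < n) ip f (F i).
Proof.
move=> Lf cF; elim: n => [|n IH].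
  rewrite big_ord0 -[RHS](mul0r (ip f f)) -ipZr//.
  by apply: eq_Rintegral => x _; rewrite big_ord0 mul0r.
rewrite big_ord_recr /= -IH -ipDr//; [|by apply: L2cont; cts|exact: L2cont].
by apply: eq_Rintegral => x _; rewrite big_ord_recr.
Qed.

End SquareIntegrableFunctions.

(** * Trigonometric polynomials, Fourier coefficients, Bessel's inequality *)

Section TrigonometricPolynomials.
Context {R : realType}.
Implicit Types (f g h : R -> R) (k x y : R) (n m N : nat) (al be : nat -> R).

(** With the weights [kap n] built in, [ca] and [cb] give back [al] and [be] without any factor;
    only [be 0] is lost, since the sine mode of frequency 0 vanishes. *)
Definition tp N al be x : R :=
  \sum_(n < N) kap n * (al n * cosn n x + be n * sinn n x).

Lemma tp_cont N al be : continuous (tp N al be).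
Proof. by rewrite /tp; cts. Qed.

Lemma tp_periodic N al be : periodic (tp N al be) (2 * pi).
Proof. by move=> x; apply: eq_bigr => i _; rewrite cosn_periodic sinn_periodic. Qed.

Lemma tp_derive N al be x : is_derive x 1 (tp N al be)
  (tp N (fun n => n%:R * be n) (fun n => - (n%:R * al n)) x).
Proof.
rewrite /tp; apply: (@dsum _ N (fun n y => kap n * (al n * cosn n y + be n * sinn n y))
  (fun n => kap n * (n%:R * be n * cosn n x + - (n%:R * al n) * sinn n x))) => n.
have dc := cosn_derive n x; have ds := sinn_derive n x; drv; ring.
Qed.

Definition ca f n : R := ip f (cosn n).
Definition cb f n : R := ip f (sinn n).

Lemma cb0 f : cb f 0 = 0.
Proof.
rewrite /cb /ip; under eq_Rintegral do rewrite sin0n mulr0.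
by rewrite int_cst ?twopi_ge0// mul0r.
Qed.

Lemma ip_tp f N al be : L2per f ->
  ip f (tp N al be) = \sum_(n < N) kap n * (al n * ca f n + be n * cb f n).
Proof.
move=> Lf; rewrite /tp (@ip_sum _ f N (fun n x => kap n * (al n * cosn n x + be n * sinn n x)))//; last by move=> i; cts.
apply: eq_bigr => i _.
have c1 : continuous (cosn i : R -> R) by exact: cosn_cont.
have c2 : continuous (sinn i : R -> R) by exact: sinn_cont.
rewrite (@ipZr _ _ (fun x => al i * cosn i x + be i * sinn i x))//; last by apply: L2cont; cts.
rewrite (@ipDr _ (fun x => al i * cosn i x) (fun x => be i * sinn i x))//; [|by apply: L2cont; cts..].
by rewrite !ipZr//; exact: L2cont.
Qed.

Lemma sum_pick N (F : nat -> R) m : (forall n, n != m -> F n = 0) ->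
  \sum_(n < N) F n = if (m < N)%N then F m else 0.
Proof.
move=> H; case: ltnP => [mN|Nm].
  by rewrite (bigD1 (Ordinal mN))//= big1 ?addr0// => i /negP ni; apply: H; apply/negP => /eqP e; apply: ni; apply/eqP/val_inj.
by rewrite big1// => i _; apply: H; rewrite ltn_eqF// (leq_trans _ Nm).
Qed.

Lemma ca_tp N al be m : ca (tp N al be) m = if (m < N)%N then al m else 0.
Proof.
rewrite /ca ipC ip_tp; last exact/L2cont/cosn_cont.
rewrite (@sum_pick N (fun n => kap n * (al n * ca (cosn m) n + be n * cb (cosn m) n)) m) => [|n nm]; rewrite /ca /cb /ip /period.
  by rewrite int_cosn_cosn int_cosn_sinn eqxx mulr0 addr0 mulrCA mulfV ?kap_neq0// mulr1.
by rewrite int_cosn_cosn int_cosn_sinn eq_sym (negbTE nm) !mulr0 addr0 mulr0.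
Qed.

Lemma cb_tp N al be m : cb (tp N al be) m = if (m < N)%N && (m != 0%N) then be m else 0.
Proof.
rewrite /cb ipC ip_tp; last exact/L2cont/sinn_cont.
rewrite (@sum_pick N (fun n => kap n * (al n * ca (sinn m) n + be n * cb (sinn m) n)) m) => [|n nm]; rewrite /ca /cb /ip /period.
  rewrite int_sinn_sinn; under eq_Rintegral do rewrite mulrC.
  rewrite int_cosn_sinn eqxx mulr0 add0r /=; case: (_ < _)%N => //=.
  by case: eqP => _ /=; rewrite ?mulr0// mulrCA mulfV ?kap_neq0// mulr1.
rewrite int_sinn_sinn; under eq_Rintegral do rewrite mulrC.
by rewrite int_cosn_sinn eq_sym (negbTE nm) !mulr0 addr0 mulr0.
Qed.

(** The truncated right-hand side of Parseval's identity. *)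
Definition ql N f g : R := \sum_(n < N) kap n * (ca f n * ca g n + cb f n * cb g n).

(** The partial Fourier sum is the best approximation: the two sides differ by the sum of [kap n]
    times the squared differences of coefficients. So any good approximation, such as a Fejer mean,
    controls the Parseval defect. *)
Lemma bessel_gap f N al be : L2per f ->
  ip f f - ql N f f <= ip (fun x => f x - tp N al be x) (fun x => f x - tp N al be x).
Proof.
move=> Lf; have Lt := L2cont (@tp_cont N al be).
have Ld := L2B Lf Lt.
rewrite ipBl// !ipBr// (ipC _ f) ip_tp// ip_tp//.
rewrite opprB !addrA -addrA -subr_ge0.
set S1 := \sum_(n < N) _; set S2 := \sum_(n < N) _.
have -> : ip f f - S1 + (S2 - S1) - (ip f f - ql N f f) = ql N f f + S2 - S1 - S1 by ring.
rewrite /ql /S1 /S2 -big_split -!sumrB sumr_ge0// => i _ /=.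
rewrite ca_tp cb_tp ltn_ord /=; have := kap_ge0 i => k0.
case: eqP => [i0|_] /=.
  rewrite i0 cb0; rewrite -[X in _ <= X]/(_ - _).
  have -> : kap 0 * (ca f 0 * ca f 0 + 0 * 0) + kap 0 * (al 0%N * al 0%N + be 0%N * 0) -
    kap 0 * (al 0%N * ca f 0 + be 0%N * 0) - kap 0 * (al 0%N * ca f 0 + be 0%N * 0)
    = kap 0 * (ca f 0 - al 0%N) ^+ 2 by ring.
  by rewrite mulr_ge0 ?kap_ge0 ?sqr_ge0.
set k := kap i in k0 *; set A := ca f i; set B := cb f i; set a := al i; set b := be i.
have -> : k * (A * A + B * B) + k * (a * a + b * b) - k * (a * A + b * B) - k * (a * A + b * B) =
  k * ((A - a) ^+ 2 + (B - b) ^+ 2) by ring.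
by rewrite mulr_ge0 ?kap_ge0 ?addr_ge0 ?sqr_ge0.
Qed.

Lemma ql_ge0 N f : 0 <= ql N f f.
Proof. by apply: sumr_ge0 => i _; rewrite mulr_ge0 ?kap_ge0// addr_ge0// -expr2 sqr_ge0. Qed.

Lemma ip_partial_sum f N : L2per f -> ip f (tp N (ca f) (cb f)) = ql N f f.
Proof. by move=> Lf; rewrite ip_tp. Qed.

Lemma ip_tp_tp N al be : ip (tp N al be) (tp N al be) =
  ql N (tp N al be) (tp N al be).
Proof.
rewrite ip_tp; last exact/L2cont/tp_cont.
apply: eq_bigr => i _; rewrite ca_tp cb_tp ltn_ord /=.
by case: eqP => // _ /=; rewrite !mulr0.
Qed.

Lemma ql_partial_sum f N : 
  ql N (tp N (ca f) (cb f)) (tp N (ca f) (cb f)) = ql N f f.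
Proof.
apply: eq_bigr => i _; rewrite !ca_tp !cb_tp ltn_ord /=.
by case: eqP => // -> /=; rewrite cb0.
Qed.

Lemma bessel f N : L2per f -> ql N f f <= ip f f.
Proof.
move=> Lf; have := ip_ge0 (fun x => f x - tp N (ca f) (cb f) x).
have Lt := L2cont (@tp_cont N (ca f) (cb f)).
rewrite ipBl ?ipBr//; [|exact: L2B].
rewrite (ipC _ f) ip_tp_tp ip_partial_sum// ql_partial_sum; lra.
Qed.

End TrigonometricPolynomials.
#[export] Hint Resolve tp_cont : cts.

(** * Uniform continuity and reduction modulo the period *)

Section PeriodicContinuousFunctions.
Context {R : realType}.
Implicit Types (f g h : R -> R) (k x y e : R).

Lemma periodic_int f p (k : int) x : periodic f p -> f (x + p * k%:~R) = f x.
Proof.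
move=> pf; have H n y : f (y + p * n%:R) = f y.
  by rewrite mulr_natr; exact: periodicn pf n y.
case: k => n; first exact: H.
by rewrite NegzE mulrNz mulrN -(H n.+1) subrK.
Qed.

Lemma shift_into_period x c : exists k : int, c <= x + 2 * pi * k%:~R <= c + 2 * pi.
Proof.
have p0 := @twopi_gt0 R; set m := Num.floor ((x - c) / (2 * pi)).
exists (- m); have := floor_le ((x - c) / (2 * pi)); have := ltW (floorD1_gt ((x - c) / (2 * pi))).
rewrite -/m ler_pdivrMr// ler_pdivlMr// mulrNz intrD => H1 H2.
by apply/andP; split; lra.
Qed.

Lemma periodic_bounded f : continuous f -> periodic f (2 * pi) ->
  exists M, 0 <= M /\ forall x, `|f x| <= M.
Proof.
move=> cf pf.
have [c _ H] := @EVT_max R (fun x => `|f x|) 0 (2 * pi) (twopi_ge0) ltac:(by apply: continuous_subspaceT; cts).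
exists `|f c|; split => // x.
have [k] := shift_into_period x 0; rewrite add0r => kx.
by rewrite -(periodic_int k x pf); apply: H; rewrite in_itv.
Qed.

(** Only [x] is confined to the segment. The point [y] may lie outside, which is what reduction
    modulo the period requires, since the translate of [y] nearest to [x] may leave the period. *)
Lemma continuous_modulus f a b e : continuous f -> 0 < e ->
  exists d, 0 < d /\ forall x y, a <= x <= b -> `|x - y| < d -> `|f y - f x| <= e.
Proof.
move=> cf e0; have e20 : 0 < e / 2 by rewrite divr_gt0.
have := @segment_compact R a b; move/compact_near_coveringP => /(_ R (at_right 0)
   (fun d x => forall y, `|x - y| < d -> `|f y - f x| <= e) _).
case=> [x _|d /= d0 H].
  have /cvgr_dist_lt /(_ _ e20) [eta /= eta0 Heta] := cf x.
  near=> z d.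
  have dd : d < eta / 2 by near: d; apply: nbhs_right_lt; rewrite divr_gt0.
  have xz : `|x - z| < eta / 2.
    by near: z; exists (eta / 2) => //=; rewrite divr_gt0.
  move=> y zyd.
  have xy : `|x - y| < eta.
    rewrite -(subrKA z) (le_lt_trans (ler_normD _ _))// [ltRHS]splitr ltrD//.
    exact: lt_trans zyd dd.
  have h1 := Heta z ltac:(by rewrite /ball_ /= (lt_trans xz)// ltr_pdivrMr// ltr_pMr// ltr1n).
  have h2 := Heta y xy.
  rewrite -(subrKA (f x)) (le_trans (ler_normD _ _))// [leRHS]splitr lerD// ltW//.
  by rewrite distrC.
exists (d / 2); split; first by rewrite divr_gt0.
move=> x y xab xy; apply: (H (d / 2) _ _ x) => //=.
  by rewrite /= sub0r normrN gtr0_norm ?divr_gt0// ltr_pdivrMr// ltr_pMr// ltr1n.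
by rewrite divr_gt0.
Unshelve. all: by end_near. Qed.

Lemma cos_monotone x y : 0 <= x -> x <= y -> y <= pi -> cos y <= cos x.
Proof.
move=> x0; rewrite le_eqVlt => /orP[/eqP->//|xy] yp.
by apply/ltW; rewrite ltr_cos// in_itv/= ?x0 ?yp ?(le_trans x0 (ltW xy)) ?(le_trans (ltW xy)).
Qed.

Lemma cos_lt1 x : 0 < x -> x <= pi -> cos x < 1.
Proof.
by move=> x0 xp; rewrite -[ltRHS]cos0 ltr_cos// in_itv/= ?lexx ?pi_ge0// xp ltW.
Qed.

Lemma cos_2pi_int x (k : int) : cos (x + 2 * pi * k%:~R) = cos x :> R.
Proof. by apply: periodic_int => y; rewrite mulr_natl; exact: cosD2pi. Qed.

(* Reducing x - y modulo 2pi, either it is small or 1 - cos (x - y) is bounded below. *)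
Lemma periodic_modulus f e : continuous f -> periodic f (2 * pi) -> 0 < e ->
  exists K, 0 <= K /\ forall x y, `|f y - f x| <= e + K * (1 - cos (x - y)).
Proof.
move=> cf pf e0; have [M [M0 fM]] := periodic_bounded cf pf.
have [d [d0 H]] := @continuous_modulus f 0 (2 * pi) e cf e0.
(* Capping at pi keeps |x' - y'| in the range where cos decreases, so that distance at least [d']
   forces 1 - cos (x - y) to be at least 1 - cos d'. *)
set d' := Num.min d pi.
have d'0 : 0 < d' by rewrite /d' lt_min d0 pi_gt0.
have d'p : d' <= pi by rewrite /d' ge_min lexx orbT.
have c1 : 0 < 1 - cos d' by rewrite subr_gt0 cos_lt1.
exists (2 * M / (1 - cos d')); split.
  by rewrite divr_ge0 ?(ltW c1)// mulr_ge0.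
move=> x y.
have [k] := shift_into_period x 0; rewrite add0r => kx.
set x' := x + 2 * pi * k%:~R in kx.
have [l ly] := shift_into_period y (x' - pi).
set y' := y + 2 * pi * l%:~R in ly.
have -> : f x = f x' by rewrite periodic_int.
have -> : f y = f y' by rewrite periodic_int.
have -> : cos (x - y) = cos (x' - y').
  rewrite -(cos_2pi_int (x - y) (k - l)) /x' /y' intrD mulrNz; congr cos; ring.
have xy : `|x' - y'| <= pi.
  by rewrite ler_norml; apply/andP; split; lra.
have [xyd|xyd] := ltP `|x' - y'| d'.
  apply: le_trans (H x' y' kx _) _; first by rewrite (lt_le_trans xyd)// /d' ge_min lexx.
  by rewrite lerDl mulr_ge0 ?subr_ge0 ?cos_le1// divr_ge0 ?(ltW c1)// mulr_ge0.
apply: (@le_trans _ _ (2 * M)).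
  by rewrite (le_trans (ler_normB _ _))// mulr_natl mulr2n lerD.
rewrite -[leLHS]add0r lerD ?(ltW e0)// -mulrA ler_peMr ?mulr_ge0//.
rewrite ler_pdivlMl// mulr1 lerD2l lerN2 -(cos_norm (x' - y')).
by rewrite cos_monotone// ltW.
Qed.

End PeriodicContinuousFunctions.

(** * The Fejer kernel and uniform convergence of Fejer means *)

Section Fejer.
Context {R : realType}.
Implicit Types (f g h : R -> R) (k x y z e : R) (n m N : nat).

(** The Chebyshev recurrence. The conditional stands for cos ((n - 1) z), which is cos z at n = 0,
    where the natural predecessor would give cos 0. *)
Lemma cosnS n z : cosn n.+1 z + (if n == 0%N then cos z else cosn n.-1 z) = 2 * cos z * cosn n z.
Proof.
case: n => [|n] /=; first by rewrite /cosn mul1r mul0r cos0; ring.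
rewrite /cosn; set w := n.+1%:R * z.
have -> : n.+2%:R * z = w + z by rewrite -[n.+2%:R]natr1 mulrDl mul1r.
have -> : n%:R * z = w - z by rewrite /w -[n.+1%:R]natr1 mulrDl mul1r addrK.
by rewrite cosD cosB; ring.
Qed.

Definition fejer_weight N n : R := 1 - n%:R / N%:R.

Definition fejer N z : R := \sum_(n < N) kap n * (fejer_weight N n * cosn n z).

Let wt n : R := if n == 0%N then 1 else 2.

Let dirichlet_id N z : (1 - cos z) * (\sum_(n < N.+1) wt n * cosn n z) = cosn N z - cosn N.+1 z.
Proof.
elim: N => [|N IH].
  by rewrite big_ord_recr big_ord0 /= /wt/= /cosn !mul0r cos0 !mul1r; ring.
rewrite big_ord_recr /= mulrDr IH /wt /=.
have := cosnS N.+1 z; rewrite /= => H.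
have -> : cosn N.+2 z = 2 * cos z * cosn N.+1 z - cosn N z by rewrite -H addrK.
by ring.
Qed.

(** Raising N by one adds a Dirichlet sum to the Fejer sum, and by [dirichlet_id] these contribute
    telescoping differences of cosines. *)
Let fejer_sum_id N z : (1 - cos z) * (\sum_(n < N) wt n * ((N%:R - n%:R) * cosn n z)) = 1 - cosn N z.
Proof.
elim: N => [|N IH]; first by rewrite big_ord0 mulr0 cos0n subrr.
have -> : \sum_(n < N.+1) wt n * ((N.+1%:R - n%:R) * cosn n z) =
  \sum_(n < N) wt n * ((N%:R - n%:R) * cosn n z) + \sum_(n < N.+1) wt n * cosn n z.
  rewrite !big_ord_recr /= addrA -big_split /=; congr (_ + _).
    by apply: eq_bigr => i _; rewrite -natr1; ring.
  by rewrite -natr1 addrAC subrr add0r mul1r.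
by rewrite mulrDr IH dirichlet_id; ring.
Qed.

(** The closed form of the kernel, multiplied out so that z = 0 modulo 2 pi is no exception. The
    factor 1 - cos z is the one in [periodic_modulus]: their product is O(1/N) pointwise, and no
    integral has to be split near the singularity. *)
Lemma fejer_id N z : (0 < N)%N ->
  (1 - cos z) * fejer N z = (1 - cosn N z) / (2 * pi * N%:R).
Proof.
move=> N0; have N0' : N%:R != 0 :> R by rewrite pnatr_eq0 -lt0n.
have p0 : pi != 0 :> R by rewrite lt0r_neq0 ?pi_gt0.
rewrite -fejer_sum_id -mulrA; congr (_ * _); rewrite mulr_suml; apply: eq_bigr => n _.
rewrite /kap /wt /fejer_weight.
move: (pi : R) (N%:R : R) (n%:R : R) (cosn n z) p0 N0' => p M m c p0 M0.
by case: eqP => _; field; rewrite M0 p0.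
Qed.

Lemma fejer_weight_ge0 N n : (n < N)%N -> 0 <= fejer_weight N n.
Proof.
by move=> nN; rewrite subr_ge0 ler_pdivrMr ?mul1r ?ler_nat ?ltr0n ?(ltnW nN)// (leq_trans _ nN).
Qed.

Lemma fejer_weight_le1 N n : fejer_weight N n <= 1.
Proof. by rewrite lerBlDr lerDl divr_ge0. Qed.

Lemma fejer_ge0 N z : 0 <= fejer N z.
Proof.
case: (posnP N) => [->|N0]; first by rewrite /fejer big_ord0.
have [c1|c1] := eqVneq (cos z) 1.
  have s0 : sin z = 0 by apply/eqP; rewrite -sqrf_eq0 sin2cos2 c1 expr1n subrr.
  have H n : cosn n z = 1 /\ sinn n z = 0.
    elim: n => [|n [IH1 IH2]]; first by rewrite cos0n sin0n.
    rewrite /cosn /sinn -natr1 mulrDl mul1r cosD sinD -/(cosn n z) -/(sinn n z) IH1 IH2 c1 s0.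
    by split; ring.
  apply: sumr_ge0 => i _; rewrite (H i).1 mulr1 mulr_ge0 ?kap_ge0 ?fejer_weight_ge0//.
have c0 : 0 < 1 - cos z by rewrite subr_gt0 lt_neqAle c1 cos_le1.
rewrite -(pmulr_rge0 _ c0) fejer_id// divr_ge0 ?subr_ge0 ?cos_le1//.
by rewrite mulr_ge0 ?twopi_ge0.
Qed.

Definition sigma N f := tp N (fun n => fejer_weight N n * ca f n) (fun n => fejer_weight N n * cb f n).

Lemma fejerE N x : fejer N \o (fun y => x - y) =
  tp N (fun n => fejer_weight N n * cosn n x) (fun n => fejer_weight N n * sinn n x).
Proof.
apply/funext => y; rewrite /fejer /tp /=; apply: eq_bigr => n _; congr (_ * _).
by rewrite {1}/cosn mulrBr cosB -/(cosn n x) -/(cosn n y) -/(sinn n x) -/(sinn n y); ring.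
Qed.

Lemma sigmaE N f x : L2per f -> sigma N f x = ip f (fun y => fejer N (x - y)).
Proof.
move=> Lf; rewrite -[fun y => _]/(fejer N \o (fun y => x - y)) fejerE ip_tp//.
by apply: eq_bigr => n _; ring.
Qed.

Lemma fejer_cont N : continuous (fejer N).
Proof. by rewrite /fejer; cts. Qed.

Lemma ip1_fejer N x : (0 < N)%N -> ip (fun _ => 1) (fun y => fejer N (x - y)) = 1.
Proof.
move=> N0; have L1 : L2per (fun _ : R => 1 : R) by apply: L2cont; cts.
rewrite -[fun y => fejer _ _]/(fejer N \o (fun y => x - y)) fejerE ip_tp//.
rewrite (@sum_pick _ N (fun n => kap n * (fejer_weight N n * cosn n x * ca (fun=> 1) n +
   fejer_weight N n * sinn n x * cb (fun=> 1) n)) 0%N) => [|n n0].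
  rewrite N0 cos0n sin0n /fejer_weight mul0r subr0 mulr0 mul0r addr0 !mul1r.
  rewrite /ca /ip; under eq_Rintegral do rewrite cos0n mulr1.
  by rewrite int_cst ?twopi_ge0// subr0 mul1r /kap /= mulVf// lt0r_neq0 ?twopi_gt0.
have -> : ca (fun=> 1) n = 0 :> R.
  rewrite /ca /ip; under eq_Rintegral do rewrite mul1r.
  by rewrite int_cosn (negbTE n0).
have -> : cb (fun=> 1) n = 0 :> R.
  rewrite /cb /ip; under eq_Rintegral do rewrite mul1r.
  by rewrite int_sinn.
by rewrite !mulr0 addr0 mulr0.
Qed.

Lemma sigma_cvg f e : continuous f -> periodic f (2 * pi) -> 0 < e ->
  exists N0, forall N, (N0 <= N)%N -> forall x, `|sigma N f x - f x| <= e.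
Proof.
move=> cf pf e0; have e20 : 0 < e / 2 by rewrite divr_gt0.
have [K [K0 HK]] := periodic_modulus cf pf e20.
(* The error is at most e/2 plus the integral of K / (pi N) over the period, that is e/2 + 2 K /
   N. *)
exists (Num.truncn (4 * K / e)).+1 => N N0N x.
have N0 : (0 < N)%N by rewrite (leq_trans _ N0N).
have NK : 4 * K / e <= N%:R.
  by apply: le_trans (ltW (truncnS_gt _)) _; rewrite ler_nat.
have Lf := L2cont cf.
have cF : continuous (fun y => fejer N (x - y)).
  by apply: (@cfcomp _ (fun y => x - y) (fejer N)); [cts|exact: fejer_cont].
have L1 : L2per (fun _ : R => 1 : R) by apply: L2cont; cts.
have Lc : L2per (fun _ : R => f x) by apply: L2cont; cts.
have LF := L2cont cF.
have -> : sigma N f x - f x = ip (fun y => f y - f x) (fun y => fejer N (x - y)).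
  rewrite ipBl// sigmaE//; congr (_ - _).
  rewrite -[LHS]mulr1 -(ip1_fejer x N0) -ipZl//.
  by apply: eq_Rintegral => y _; rewrite mulr1.
have cfF : continuous (fun y => (f y - f x) * fejer N (x - y)) by cts.
apply: le_trans (le_normr_Rintegral _ _) _; [exact: mper|exact: cint|].
apply: (@le_trans _ _ (\int[leb]_(y in `[0, 2 * pi]) (e / 2 * fejer N (x - y) + K / (pi * N%:R)))).
  apply: int_le; [by cts|by cts|move=> y _].
  rewrite normrM (ger0_norm (fejer_ge0 _ _)).
  apply: le_trans (ler_wpM2r (fejer_ge0 _ _) (HK x y)) _.
  rewrite mulrDl lerD2l -mulrA fejer_id// -mulrA ler_wpM2l//.
  rewrite invfM mulrA ler_pdivrMr ?mulr_gt0 ?pi_gt0 ?ltr0n//.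
  have := cos_geN1 (N%:R * (x - y)); rewrite /cosn => c1.
  have pN : pi * N%:R != 0 :> R by rewrite mulf_neq0 ?lt0r_neq0 ?pi_gt0 ?ltr0n.
  by rewrite mulVf//; lra.
rewrite intD; [|by cts|by cts].
rewrite intZ; last by cts.
have -> : \int[leb]_(y in `[0, 2 * pi]) fejer N (x - y) = 1.
  by rewrite -[RHS](ip1_fejer x N0); apply: eq_Rintegral => y _; rewrite mul1r.
rewrite int_cst ?twopi_ge0// subr0 mulr1 [leRHS]splitr lerD2l.
have N0' : 0 < N%:R :> R by rewrite ltr0n.
have -> : K / (pi * N%:R) * (2 * pi) = 2 * K / N%:R.
  have p0 : pi != 0 :> R by rewrite lt0r_neq0 ?pi_gt0.
  move: (pi : R) (N%:R : R) p0 (lt0r_neq0 N0') => p M p0 M0.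
  by field; rewrite M0 p0.
rewrite ler_pdivrMr//; move: NK; rewrite ler_pdivrMr// => NK.
by rewrite mulrAC ler_pdivlMr//; lra.
Qed.

End Fejer.

(** * Parseval's identity and uniqueness of Fourier coefficients *)

Section FourierUniqueness.
Context {R : realType}.
Implicit Types (f g h psi k : R -> R) (x y e : R) (n m N : nat).

Lemma parseval_cont psi e : continuous psi -> periodic psi (2 * pi) -> 0 < e ->
  exists N0, forall N, (N0 <= N)%N -> ip psi psi - ql N psi psi <= e.
Proof.
(* The squared L^2 error is at most 2 pi d^2; as d <= 1, the bound d <= e / (2 pi) suffices. *)
move=> cf pf e0; pose d := Num.min 1 (e / (2 * pi)).
have d0 : 0 < d by rewrite lt_min ltr01 divr_gt0 ?twopi_gt0.
have [N0 H] := sigma_cvg cf pf d0; exists N0 => N /H {}H.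
apply: le_trans (bessel_gap N (fun n => fejer_weight N n * ca psi n)
  (fun n => fejer_weight N n * cb psi n) (L2cont cf)) _.
rewrite -/(sigma N psi); set q := sigma N psi; have cq : continuous q by exact: tp_cont.
have c1 : continuous (fun x => psi x - q x) by cts.
apply: le_trans (ler_norm _) _; apply: le_trans (ip_le_sup c1 c1 (ltW d0) (ltW d0) _ _) _.
- by move=> x; rewrite distrC.
- by move=> x; rewrite distrC.
rewrite -ler_pdivlMr ?twopi_gt0// -[leRHS]mul1r ler_pM ?(ltW d0)//.
  by rewrite ge_min lexx.
by rewrite ge_min lexx orbT.
Qed.

(** Cauchy-Schwarz between [k] and psi minus its partial sum. Uniform approximation is asked of
    [psi] alone, so [k] may be a weak derivative. *)
Lemma parseval k psi e : L2per k -> continuous psi -> periodic psi (2 * pi) -> 0 < e ->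
  exists N0, forall N, (N0 <= N)%N -> `|ip k psi - ql N k psi| <= e.
Proof.
move=> Lk cf pf e0; have Lf := L2cont cf.
have k0 : 0 < ip k k + 1 by rewrite ltr_wpDl ?ip_ge0.
have [N0 H] := parseval_cont cf pf (divr_gt0 (exprn_gt0 2 e0) k0); exists N0 => N /H {}H.
have Lt := L2cont (@tp_cont _ N (ca psi) (cb psi)).
have Ld := L2B Lf Lt.
have -> : ip k psi - ql N k psi = ip k (fun x => psi x - tp N (ca psi) (cb psi) x).
  rewrite ipBr// ip_tp//; congr (_ - _); apply: eq_bigr => i _.
  by rewrite [ca psi _ * _]mulrC [cb psi _ * _]mulrC.
have : ip k (fun x => psi x - tp N (ca psi) (cb psi) x) ^+ 2 <= e ^+ 2.
  apply: le_trans (ip_CS Lk Ld) _.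
  have -> : ip (fun x => psi x - tp N (ca psi) (cb psi) x) (fun x => psi x - tp N (ca psi) (cb psi) x) =
     ip psi psi - ql N psi psi.
    rewrite ipBl// !ipBr// (ipC _ psi) ip_tp_tp ip_partial_sum// ql_partial_sum; ring.
  apply: le_trans (ler_wpM2l (ip_ge0 k) H) _.
  by rewrite mulrA ler_pdivrMr// mulrC ler_wpM2l ?sqr_ge0// lerDl.
by rewrite -[X in X <= _]real_normK ?num_real// ler_pXn2r ?nnegrE ?(ltW e0).
Qed.

Lemma ip_eq0_of_coefs k psi : L2per k -> continuous psi -> periodic psi (2 * pi) ->
  (forall n, ca k n = 0) -> (forall n, cb k n = 0) -> ip k psi = 0.
Proof.
move=> Lk cf pf kc ks; apply/eqP; rewrite -normr_le0; apply/ler_addgt0Pl => e e0.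
have [N0 /(_ _ (leqnn _))] := parseval Lk cf pf e0.
have -> : ql N0 k psi = 0 by rewrite /ql big1// => i _; rewrite kc ks !mul0r addr0 mulr0.
by rewrite subr0 addr0.
Qed.

(** This is min(1, max(0, n (cos (y - c) - cos r))): continuous periodic functions increasing to the
    indicator of the arc of radius r around c. It is written with maxima alone, which the continuity
    tactic handles. *)
Definition arc_bump (n : nat) (c r y : R) : R :=
  1 - Num.max 0 (1 - Num.max 0 (n%:R * (cos (y - c) - cos r))).

Lemma arc_bump_cont n c r : continuous (arc_bump n c r).
Proof. by rewrite /arc_bump; cts. Qed.

Lemma arc_bump_periodic n c r : periodic (arc_bump n c r) (2 * pi).
Proof. by move=> y; rewrite /arc_bump addrAC [2 * pi]mulr_natl cosD2pi. Qed.

Lemma arc_bump_le1 n c r y : `|arc_bump n c r y| <= 1.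
Proof.
rewrite /arc_bump; set t := Num.max 0 (n%:R * _).
have t0 : 0 <= t by rewrite le_max lexx.
have h0 : 0 <= Num.max 0 (1 - t) by rewrite le_max lexx.
have h1 : Num.max 0 (1 - t) <= 1 by rewrite ge_max ler01 lerBlDr lerDl.
by rewrite ger0_norm; lra.
Qed.

Lemma arc_bump_cvg c r y :
  (arc_bump n c r y @[n --> \oo]) --> (if cos r < cos (y - c) then 1 else 0 : R).
Proof.
case: ifP => H; last first.
  apply: cvg_near_cst; near=> n; rewrite /arc_bump (@max_l _ _ 0 (n%:R * _)).
    by rewrite subr0 max_r ?subrr.
  by rewrite mulr_ge0_le0// subr_le0 leNgt H.
apply: cvg_near_cst; near=> n; rewrite /arc_bump [X in _ - X]max_l ?subr0//.
have d0 : 0 < cos (y - c) - cos r by rewrite subr_gt0.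
rewrite subr_le0 le_max -ler_pdivrMr// mul1r; apply/orP; right.
by near: n; exact: nbhs_infty_ger.
Unshelve. all: by end_near. Qed.

Lemma cos_arc c r y : 0 < r -> r <= pi -> 0 <= c - r -> c + r <= 2 * pi -> 0 <= y <= 2 * pi ->
  (cos r < cos (y - c)) = (c - r < y < c + r).
Proof.
move=> r0 rp cr cr2 y2; rewrite -(cos_norm (y - c)).
have -> : (c - r < y < c + r) = (`|y - c| < r).
  by rewrite ltr_norml; apply/idP/idP => /andP[h1 h2]; apply/andP; split; lra.
have z2 : `|y - c| <= 2 * pi - r by rewrite ler_norml; apply/andP; split; lra.
have := normr_ge0 (y - c); move: `|y - c| z2 => z z2 z0.
case: (ltP z r) => zr.
  by rewrite ltr_cos// in_itv/= ?z0 ?(ltW r0)// (le_trans (ltW zr)).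
apply/negbTE; rewrite -leNgt; have [zp|zp] := leP z pi.
  by rewrite cos_monotone// ltW.
have -> : cos z = cos (2 * pi - z) by rewrite -(cosN z) addrC [2 * pi]mulr_natl cosD2pi.
by rewrite cos_monotone ?(ltW r0)//; lra.
Qed.

(** [k] is orthogonal to every continuous periodic function, in particular to the bumps; dominated
    convergence replaces them by the indicator of the interval. *)
Lemma int_itv_eq0 k (al be : R) : L2per k -> (forall n, ca k n = 0) -> (forall n, cb k n = 0) ->
  0 <= al -> al < be -> be <= 2 * pi -> \int[leb]_(x in `]al, be[) k x = 0.
Proof.
move=> Lk kc ks al0 ab be2.
pose c := (al + be) / 2; pose r := (be - al) / 2.
have r0 : 0 < r by rewrite divr_gt0// subr_gt0.
have rp : r <= pi by rewrite /r; lra.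
have cr : c - r = al by rewrite /c /r; field.
have cr2 : c + r = be by rewrite /c /r; field.
pose L y : R := if cos r < cos (y - c) then 1 else 0.
have -> : \int[leb]_(x in `]al, be[) k x = \int[leb]_(x in period) (k x * L x).
  have -> : (`]al, be[%classic : set R) = period `&` `]al, be[%classic.
    rewrite setIidr// => x; rewrite /period /= !in_itv /= => /andP[h1 h2].
    by rewrite (le_trans al0 (ltW h1)) (le_trans (ltW h2)).
  rewrite Rintegral_mkcondr; apply: eq_Rintegral => x.
  rewrite inE /period /= in_itv /= => x2; rewrite patchE /L cos_arc// ?cr ?cr2//.
  have -> : (x \in `]al, be[%classic) = (al < x < be).
    by apply/idP/idP; rewrite inE /= in_itv.
  by case: ifP => _; rewrite ?mulr1 ?mulr0.
have mk := Lk.1.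
have L1 : L2per (fun _ : R => 1 : R) by apply: L2cont; cts.
have Ik : leb.-integrable period (fun x => (k x)%:E).
  by have := L2mul Lk L1; under eq_fun do rewrite mulr1.
have [|||||_ _] := @dominated_convergence _ _ R leb period mper
   (fun n x => (k x * arc_bump n c r x)%:E) (fun x => (k x * L x)%:E) (fun x => `|(k x)%:E|%E).
- move=> n; apply/measurable_EFinP; apply: measurable_funM => //.
  by apply: measurable_funTS; apply: continuous_measurable_fun; exact: arc_bump_cont.
- apply/measurable_EFinP; apply: measurable_funM => //.
  apply: (@measurable_fun_cvg _ _ _ _ (fun n x => arc_bump n c r x)).
    by move=> n; apply: measurable_funTS; apply: continuous_measurable_fun; exact: arc_bump_cont.
  by move=> x _; exact: arc_bump_cvg.
- apply: aeW => x _; apply: cvg_EFin; first by near=> n.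
  by apply: cvgM; [exact: cvg_cst|exact: arc_bump_cvg].
- exact: integrable_abse.
- by apply: aeW => x n _; rewrite lee_fin normrM -[leRHS]mulr1 ler_wpM2l// arc_bump_le1.
have -> : [sequence (\int[leb]_(x in period) (k x * arc_bump n c r x)%:E)%E]_n = fun=> 0%E.
  apply/funext => n /=; have Lb := L2cont (@arc_bump_cont n c r).
  rewrite -[LHS]fineK ?integrable_fin_num//; [|exact: mper|exact: L2mul].
  by congr EFin; apply: (ip_eq0_of_coefs Lk (@arc_bump_cont n c r)) => //; exact: arc_bump_periodic.
move=> H; have /= E0 := cvg_lim (@ereal_hausdorff R) H.
by rewrite /Rintegral -E0 lim_cst//; exact: ereal_hausdorff.
Unshelve. all: by end_near. Qed.

Lemma L2_integrable k : L2per k -> leb.-integrable period (fun x => (k x)%:E).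
Proof.
have L1 : L2per (fun _ : R => 1 : R) by apply: L2cont; cts.
by move=> Lk; have := L2mul Lk L1; under eq_fun do rewrite mulr1.
Qed.

(* By Lebesgue differentiation, a function with vanishing integrals over subintervals vanishes a.e. *)
Lemma L2_eq0_of_coefs k : L2per k -> (forall n, ca k n = 0) -> (forall n, cb k n = 0) ->
  ip k k = 0.
Proof.
move=> Lk kc ks; have Ik := L2_integrable Lk.
(* Extension by 0 makes [k] integrable on the line, where the primitive from -oo is differentiable
   a.e. with derivative [f]; the vanishing integrals make it constant inside the period. *)
pose f := k \_ period.
have If : leb.-integrable [set: R] (EFin \o f).
  by rewrite /f -restrict_EFin; apply/integrable_restrict => //; rewrite ?setTI//; exact: mper.
have Ify (y : itv_bound R) (z : itv_bound R) : leb.-integrable [set` Interval y z] (EFin \o f).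
  by apply: integrableS If.
have := FTC1Ny (fun y => Ify -oo%O (BRight y)) (integrable_locally_restrict mper Ik).
pose F x := \int[leb]_(t in `]-oo, x]) f t.
have Fcst x y : 0 < x -> x < y -> y < 2 * pi -> F y = F x.
  move=> x0 xy y2; apply/eqP; rewrite -subr_eq0 /F Rintegral_itvB ?bnd_simp ?(ltW xy)//.
  rewrite -Rintegral_itv_bndo_bndc//.
  rewrite -(int_itv_eq0 Lk kc ks (ltW x0) xy (ltW y2)); apply/eqP/eq_Rintegral => z.
  rewrite inE /= in_itv /= => /andP[xz zy]; rewrite /f patchE mem_set//.
  by rewrite /period /= in_itv /= (ltW (lt_trans x0 xz)) (ltW (lt_trans zy y2)).
move=> aeF.
have aek : \forall x \ae leb, 0 < x < 2 * pi -> k x = 0.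
  apply: (@filterS _ _ (ae_filter_ringOfSetsType _) _ _ _ aeF) => x [_ F'x] /andP[x0 x2].
  have <- : f x = k x by rewrite /f patchE mem_set// /period /= in_itv /= !ltW.
  rewrite -F'x -/F derive1E (@near_eq_derive _ _ _ _ (fun=> F x)) ?derive_cst//.
  near=> y; have y0 : 0 < y by near: y; exact: lt_nbhsr.
  have y2 : y < 2 * pi by near: y; exact: lt_nbhsl.
  by have [xy|xy|->//] := ltgtP x y; [apply: Fcst|apply/esym/Fcst].
rewrite /ip /Rintegral; have [mk _] := Lk.
have mkk (D : set R) : D `<=` period -> measurable D -> measurable_fun D (fun x => (k x * k x)%:E).
  move=> DP mD; apply: (measurable_funS mper DP).
  by apply/measurable_EFinP; exact: measurable_funM.
rewrite /period -integral_itv_bndo_bndc; last first.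
  by apply: mkk => // x /=; rewrite /period /= !in_itv /= => /andP[-> /ltW].
rewrite -integral_itv_obnd_cbnd; last first.
  by apply: mkk => // x /=; rewrite /period /= !in_itv /= => /andP[/ltW-> /ltW].
rewrite (@ae_eq_integral _ _ _ _ _ (cst 0%E)) ?integral0//.
- by apply: mkk => // x /=; rewrite /period /= !in_itv /= => /andP[/ltW-> /ltW].
- by apply: (@filterS _ _ (ae_filter_ringOfSetsType _) _ _ _ aek) => x H /=; rewrite in_itv /= => /H ->; rewrite mul0r.
Unshelve. all: by end_near. Qed.

(** The difference has all coefficients zero, hence is null and orthogonal to both functions. This
    will make [H1norm] independent of the weak derivative picked by [wderiv]. *)
Lemma L2_eq_ip k1 k2 : L2per k1 -> L2per k2 -> (forall n, ca k1 n = ca k2 n) ->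
  (forall n, cb k1 n = cb k2 n) -> ip k1 k1 = ip k2 k2.
Proof.
move=> L1 L2 hc hs; have Ld := L2B L1 L2.
have d0 : ip (fun x => k1 x - k2 x) (fun x => k1 x - k2 x) = 0.
  apply: L2_eq0_of_coefs => // n.
    by rewrite /ca ipBl//; [rewrite [X in X - _]hc subrr|exact/L2cont/cosn_cont].
  by rewrite /cb ipBl//; [rewrite [X in X - _]hs subrr|exact/L2cont/sinn_cont].
have H h : L2per h -> ip (fun x => k1 x - k2 x) h = 0.
  move=> Lh; apply/eqP; rewrite -sqrf_eq0 eq_le sqr_ge0 andbT.
  by apply: le_trans (ip_CS Ld Lh) _; rewrite d0 mul0r.
have := H _ L1; have := H _ L2; rewrite !ipBl// (ipC k2 k1); lra.
Qed.

End FourierUniqueness.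

(** * Vanishing under geometric bounds; lower limits for Fatou's lemma *)

Section LowerLimits.
Context {R : realType}.

Lemma half_pow_le (m : nat) : (2^-1 : R) ^+ m <= m.+1%:R^-1.
Proof.
rewrite exprVn lef_pV2 ?posrE ?ltr0n ?exprn_gt0// -natrX ler_nat.
exact: ltn_expl.
Qed.

Lemma half_pow_small (c e : R) : 0 < e ->
  exists m0, forall m, (m0 <= m)%N -> c * (2^-1) ^+ m <= e.
Proof.
move=> e0; exists (Num.truncn (`|c| / e)) => m m0m.
apply: le_trans (ler_wpM2r (exprn_ge0 _ _) (ler_norm c)) _; first by rewrite invr_ge0.
apply: le_trans (ler_wpM2l (normr_ge0 c) (half_pow_le m)) _.
rewrite ler_pdivrMr// -ler_pdivrMl// mulrC ltW//.
by apply: lt_le_trans (truncnS_gt _) _; rewrite ler_nat ltnS.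
Qed.

Lemma half_pow_le0 (X c : R) (k : nat) :
  (forall m, (k <= m)%N -> X <= c * (2^-1) ^+ m) -> X <= 0.
Proof.
move=> H; apply/ler_addgt0Pl => e e0; rewrite addr0.
have [m0 H0] := half_pow_small c e0.
by apply: le_trans (H (maxn k m0) _) (H0 _ _); rewrite ?leq_maxl ?leq_maxr.
Qed.

Lemma limn_einf_le (u : nat -> \bar R) (c : \bar R) :
  (forall n, u n <= c)%E -> (limn_einf u <= c)%E.
Proof.
move=> uc; rewrite limn_einf_lim; apply: lime_le; first exact: is_cvg_einfs.
near=> n; apply: le_trans (uc n); apply: ereal_inf_lbound; exists n => //=.
Unshelve. all: by end_near. Qed.

Lemma limn_einf_ge0 (u : nat -> \bar R) : (forall n, 0 <= u n)%E -> (0 <= limn_einf u)%E.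
Proof.
move=> u0; rewrite limn_einf_lim; apply: lime_ge; first exact: is_cvg_einfs.
by near=> n; apply: le_ereal_inf_tmp => _ [j _ <-].
Unshelve. all: by end_near. Qed.

Lemma measurable_limn_einf d (T : measurableType d) (D : set T) (f : nat -> T -> \bar R) :
  (forall n, measurable_fun D (f n)) -> measurable_fun D (fun x => limn_einf (f^~ x)).
Proof.
move=> mf; have -> : (fun x => limn_einf (f^~ x)) =
    (fun x => - limn_esup (fun n => - f n x))%E.
  apply/funext => x; rewrite -limn_einfN; congr limn_einf.
  by apply/funext => n /=; rewrite oppeK.
apply: measurableT_comp => //; apply: measurable_fun_limn_esup => n.
exact: measurableT_comp.
Qed.

End LowerLimits.

(** * The Riesz-Fischer theorem *)

Section RieszFischer.
Context {R : realType}.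
Implicit Types (f g h psi : R -> R) (x y e B : R) (n m N j : nat).
Context (al be : nat -> R) (be0 : be 0%N = 0) (B : R).

Let s N := \sum_(n < N) kap n * (al n ^+ 2 + be n ^+ 2).
Context (sB : forall N, s N <= B).
Let p N := tp N al be.

Let s_mono m N : (m <= N)%N -> s m <= s N.
Proof.
move=> /subnKC <-; elim: (N - m)%N => [|k IH]; first by rewrite addn0.
rewrite addnS; apply: le_trans IH _; rewrite /s [leRHS]big_ord_recr /= lerDl.
by rewrite mulr_ge0 ?kap_ge0// addr_ge0 ?sqr_ge0.
Qed.

Let t := sup (range s).
Let s_sup : has_sup (range s).
Proof. by split; [exists (s 0%N), 0%N|exists B => _ [N _ <-]; exact: sB]. Qed.

Let s_le_t N : s N <= t.
Proof. by apply: ub_le_sup; [exact: s_sup.2|exists N]. Qed.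

(** The rate 4^-j for the tail of squares is a rate 2^-j for L^2 distances, which is summable. *)
Let N_exists j : exists N, (j <= N)%N /\ t - s N <= (2^-1) ^+ j.*2.
Proof.
have e0 : 0 < (2^-1 : R) ^+ j.*2 by rewrite exprn_gt0// invr_gt0.
have [_ [N _ <-]] := sup_adherent e0 s_sup; rewrite -/t => tN.
exists (maxn j N); rewrite leq_maxl; split => //.
have := @s_mono N (maxn j N) (leq_maxr _ _); lra.
Qed.

Let ip_p_p m N : (m <= N)%N -> ip (p N) (p m) = s m.
Proof.
move=> mN; rewrite /p ip_tp; last exact/L2cont/tp_cont.
apply: eq_bigr => i _; rewrite ca_tp cb_tp (leq_trans (ltn_ord i) mN) /=.
by case: eqP => [->|_] /=; rewrite ?be0; ring.
Qed.

Let ip_diff m N : ip (fun x => p N x - p m x) (fun x => p N x - p m x) = `|s N - s m|.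
Proof.
have Lp k : L2per (p k) by exact/L2cont/tp_cont.
have H a b : (a <= b)%N -> ip (fun x => p b x - p a x) (fun x => p b x - p a x) = s b - s a.
  move=> ab; rewrite ipBl// ?ipBr//; last exact: L2B.
  by rewrite (ipC (p a)) !ip_p_p//; ring.
have [mN|/ltnW Nm] := leqP m N; first by rewrite H// ger0_norm// subr_ge0 s_mono.
rewrite distrC ger0_norm ?subr_ge0 ?s_mono// -H//.
by apply: eq_Rintegral => x _; ring.
Qed.

(** Partial sums along a fast subsequence have summable L^2 increments, so the series of absolute
    increments is integrable and they converge a.e. Fatou's lemma turns the Cauchy bounds into
    bounds on the distance to the limit, through which coefficients and norm pass. *)
Lemma riesz_fischer : exists g, [/\ L2per g, (forall n, ca g n = al n),
  (forall n, cb g n = be n) & ip g g <= B].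
Proof.
have [K HK] := choice N_exists.
pose P j := p (K j).
have cP j : continuous (P j) by exact: tp_cont.
have LP j : L2per (P j) by exact: L2cont.
have ipP i j : (i <= j)%N -> ip (fun x => P j x - P i x) (fun x => P j x - P i x) <= (2^-1) ^+ i.*2.
  move=> ij; rewrite ip_diff.
  have [_ h1] := HK i; have [_ h2] := HK j.
  have : (2^-1 : R) ^+ j.*2 <= (2^-1) ^+ i.*2.
    by rewrite ler_wiXn2l ?leq_double// ?invr_ge0// invf_le1// ler1n.
  by have := s_le_t (K i); have := s_le_t (K j); rewrite ler_norml => ? ? ?; apply/andP; split; lra.
pose D j x : R := `|P j.+1 x - P j x|.
have D0 j x : 0 <= D j x by exact: normr_ge0.
have cD j : continuous (D j) by rewrite /D; cts.
(* Cauchy-Schwarz against 1 costs a factor sqrt (2 pi), and 2 pi <= C^2 avoids the root. *)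
pose C : R := 2 * pi + 1.
have C0 : 0 <= C by rewrite addr_ge0// twopi_ge0.
have ID j : \int[leb]_(x in period) D j x <= C * (2^-1) ^+ j.
  have L1 : L2per (fun _ : R => 1 : R) by apply: L2cont; cts.
  have -> : \int[leb]_(x in period) D j x = ip (D j) (fun=> 1).
    by apply: eq_Rintegral => x _; rewrite mulr1.
  rewrite -(@ler_pXn2r _ 2) ?nnegrE//; last 2 first.
  - by apply: Rintegral_ge0 => x _; rewrite mulr1 D0.
  - by rewrite mulr_ge0// exprn_ge0// invr_ge0.
  apply: le_trans (ip_CS (L2cont (cD j)) L1) _.
  have -> : ip (D j) (D j) = ip (fun x => P j.+1 x - P j x) (fun x => P j.+1 x - P j x).
    by apply: eq_Rintegral => x _; rewrite -!expr2 real_normK ?num_real.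
  have -> : ip (fun=> 1) (fun=> 1) = 2 * pi :> R.
    rewrite /ip; under eq_Rintegral do rewrite mulr1.
    by rewrite int_cst ?twopi_ge0// mul1r subr0.
  rewrite exprMn mulrC ler_pM ?ip_ge0 ?twopi_ge0//.
    by rewrite /C; have := @twopi_ge0 R; nra.
  by rewrite -exprM muln2; apply: ipP.
pose h x := (\sum_(0 <= j <oo) (D j x)%:E)%E.
have mD j : measurable_fun period (fun x => (D j x)%:E).
  by apply/measurable_EFinP; have [] := L2cont (cD j).
have Ih : leb.-integrable period h.
  apply/integrableP; split.
    have := @ge0_emeasurable_sum _ _ R period (fun j x => (D j x)%:E) xpredT.
    move=> H0; apply: H0 => [j x _ _|j _]; [by rewrite lee_fin D0|exact: mD].
  under eq_integral => x _.
    rewrite gee0_abs; last by apply: nneseries_ge0 => j _ _; rewrite lee_fin D0.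
    over.
  have E := @integral_nneseries _ _ _ leb period mper (fun j x => (D j x)%:E) mD.
  rewrite E; last by move=> j x _; rewrite lee_fin D0.
  (* C 2^-j rewritten as 2 C / 2^(j+1), the shape summed by [epsilon_trick0]. *)
  apply: (@le_lt_trans _ _ (\sum_(0 <= j <oo) ((2 * C) / (2 ^ j.+1)%:R)%:E)%E); last first.
    by apply: le_lt_trans (epsilon_trick0 _ _) _; rewrite ?mulr_ge0// ltry.
  apply: lee_nneseries => [j _ _|j _]; first by apply: integral_ge0 => x _; rewrite lee_fin D0.
  rewrite -[leLHS]fineK; last by apply: integrable_fin_num; [exact: mper|exact: cint].
  rewrite lee_fin; apply: le_trans (ID j) _.
  by rewrite natrX exprS exprVn invfM mulrACA divff// mul1r.
have aecv : \forall x \ae leb, period x -> cvgn (fun j => P j x).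
  have := integrable_ae mper Ih.
  apply: (@filterS _ _ (ae_filter_ringOfSetsType _)) => x H /H {H} hx.
  have : cvgn (series (telescope (fun j => P j x))).
    apply: normed_cvg; apply: nondecreasing_is_cvgn.
      by apply: nondecreasing_series => j _ _; exact: normr_ge0.
    exists (fine (h x)) => _ [j _ <-].
    rewrite -lee_fin fineK// /series /= -sumEFin.
    by apply: (nneseries_lim_ge j) => i _ _; rewrite lee_fin D0.
  move=> cv; have -> : (fun j => P j x) = (fun j => P 0%N x + series (telescope (fun j => P j x)) j).
    by apply/funext => j; exact: eq_sum_telescope.
  by apply: is_cvgD => //; exact: is_cvg_cst.
(* An upper limit exists everywhere and is measurable, while convergence is known only almost
   everywhere. *)
pose g x := fine (limn_esup (fun j => (P j x)%:E)).
have aeg : \forall x \ae leb, period x -> P j x @[j --> \oo] --> g x.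
  move: aecv; apply: (@filterS _ _ (ae_filter_ringOfSetsType _)) => x H /H {}H.
  have H' : (P j x)%:E @[j --> \oo] --> (limn (fun j => P j x))%:E.
    by apply: cvg_EFin => //; near=> j.
  by rewrite /g (cvg_limn_einf_sup H').2.
have mg : measurable_fun period g.
  apply: measurableT_comp => //.
  apply: measurable_fun_limn_esup => j.
  by apply/measurable_EFinP; have [] := LP j.
have mgP m : measurable_fun period (fun x => (g x - P m x) ^+ 2).
  apply: measurable_funX; apply: measurable_funB => //.
  by have [] := LP m.
have fatou_g m : (\int[leb]_(x in period) ((g x - P m x) ^+ 2)%:E <= ((2^-1) ^+ m.*2)%:E)%E.
  pose F j x := ((P (j + m)%N x - P m x) ^+ 2)%:E.
  have mF j : measurable_fun period (F j).
    by apply/measurable_EFinP/measurable_funX; have [] := L2B (LP (j + m)%N) (LP m).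
  have F0 j x : (0 <= F j x)%E by rewrite lee_fin sqr_ge0.
  have -> : (\int[leb]_(x in period) ((g x - P m x) ^+ 2)%:E =
             \int[leb]_(x in period) limn_einf (F^~ x))%E.
    apply: ge0_ae_eq_integral.
    - exact: mper.
    - by apply/measurable_EFinP; exact: mgP.
    - exact: measurable_limn_einf.
    - by move=> x _; rewrite lee_fin sqr_ge0.
    - by move=> x _; apply: limn_einf_ge0.
    - move: aeg; apply: (@filterS _ _ (ae_filter_ringOfSetsType _)) => x H /H {}H.
      symmetry; apply: (cvg_limn_einf_sup _).1; apply: cvg_EFin; first by near=> j.
      have H2 : P (j + m)%N x - P m x @[j --> \oo] --> g x - P m x.
        apply: cvgB; last exact: cvg_cst.
        by rewrite (@cvg_shiftn m _ (fun j => P j x)).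
      by rewrite expr2; exact: (cvgM H2 H2).
  apply: le_trans (fatou leb mper mF _) _ => //.
  apply: limn_einf_le => j.
  rewrite -[leLHS]fineK; last first.
    by apply: integrable_fin_num; [exact: mper|apply: (L2B (LP _) (LP _)).2].
  rewrite lee_fin -[leLHS]/(\int[leb]_(x in period) ((P (j + m)%N x - P m x) ^+ 2)) ip_sqr.
  by apply: ipP; rewrite leq_addl.
have Lg m : L2per (fun x => g x - P m x).
  split; first by apply: measurable_funB => //; have [] := LP m.
  apply/integrableP; split; first by apply/measurable_EFinP; exact: mgP.
  under eq_integral do rewrite gee0_abs ?lee_fin ?sqr_ge0//.
  exact: le_lt_trans (fatou_g m) (ltry _).
have L2g : L2per g.
  have := L2D (Lg 0%N) (LP 0%N); congr L2per; apply/funext => x; exact: subrK.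
have dist m : ip (fun x => g x - P m x) (fun x => g x - P m x) <= (2^-1) ^+ m.*2.
  rewrite -ip_sqr -lee_fin -[leLHS]fineK//=; last first.
  rewrite /Rintegral fineK; last by apply: integrable_fin_num; [exact: mper|exact: (Lg m).2].
  exact: fatou_g.
have dist' m f : L2per f -> ip (fun x => g x - P m x) f ^+ 2 <= ip f f * (2^-1) ^+ m.
  move=> Lf; apply: le_trans (ip_CS (Lg m) Lf) _; rewrite mulrC ler_wpM2l ?ip_ge0//.
  apply: le_trans (dist m) _.
  by rewrite ler_wiXn2l ?invr_ge0 ?invf_le1 ?ler1n// -addnn leq_addl.
exists g; split => //.
- move=> n; apply/eqP; rewrite -subr_eq0 -sqrf_eq0 eq_le sqr_ge0 andbT.
  (* For m > n the polynomial [P m] already has the exact coefficient [al n], so only its distance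
     to [g] remains. *)
  apply: (@half_pow_le0 _ _ (ip (cosn n) (cosn n)) n.+1) => m nm.
  have Lc := L2cont (@cosn_cont R n).
  have nK : (n < K m)%N by rewrite (leq_trans nm)// (HK m).1.
  have <- : ca (P m) n = al n by rewrite ca_tp nK.
  by rewrite /ca -ipBl//; exact: dist'.
- move=> n; apply/eqP; rewrite -subr_eq0 -sqrf_eq0 eq_le sqr_ge0 andbT.
  apply: (@half_pow_le0 _ _ (ip (sinn n) (sinn n)) n.+1) => m nm.
  have Lc := L2cont (@sinn_cont R n).
  have nK : (n < K m)%N by rewrite (leq_trans nm)// (HK m).1.
  have <- : cb (P m) n = be n by rewrite cb_tp nK; case: eqP => // ->.
  by rewrite /cb -ipBl//; exact: dist'.
- have B0 : 0 <= B by apply: le_trans (sB 0%N); rewrite /s big_ord0.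
  (* With q = 2^-m <= 1, expanding [g] around [P m] gives at most q^2 + 2 q (B + 1) + B. *)
  rewrite -subr_le0; apply: (@half_pow_le0 _ _ (1 + 2 * (B + 1)) 0%N) => m _.
  have PB : ip (P m) (P m) <= B by rewrite ip_p_p.
  have -> : ip g g = ip (fun x => g x - P m x) (fun x => g x - P m x) +
      2 * ip (fun x => g x - P m x) (P m) + ip (P m) (P m).
    by rewrite !ipBl// !ipBr// (ipC (P m) g); ring.
  set q : R := (2^-1) ^+ m.
  have q0 : 0 <= q by rewrite exprn_ge0// invr_ge0.
  have q1 : q <= 1 by rewrite exprn_ile1// ?invr_ge0// invf_le1// ler1n.
  have d1 : ip (fun x => g x - P m x) (fun x => g x - P m x) <= q ^+ 2 by rewrite -exprM muln2.
  have d2 : ip (fun x => g x - P m x) (P m) <= q * (B + 1).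
    apply: le_trans (ler_norm _) _; rewrite -(@ler_pXn2r _ 2) ?nnegrE// ?mulr_ge0 ?addr_ge0//.
    rewrite real_normK ?num_real//; apply: le_trans (ip_CS (Lg m) (LP m)) _.
    rewrite exprMn ler_pM ?ip_ge0//; apply: le_trans PB _; nra.
  by nra.
Unshelve. all: by end_near. Qed.

End RieszFischer.

(** * The H^1 norm through Fourier coefficients *)

Section SobolevNorm.
Context {R : realType}.
Implicit Types (f g h psi p : R -> R) (x y e k M : R) (n m N : nat).

Lemma quadratic_discriminant (a b c : R) :
  (forall s, 0 <= a + 2 * s * b + s ^+ 2 * c) -> 0 <= c -> b ^+ 2 <= a * c.
Proof.
move=> H c0; have [C0'|Cn] := eqVneq c 0.
  have [->|Bn] := eqVneq b 0; first by rewrite C0' mulr0 expr0n.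
  have := H (- (a + 1) / (2 * b)); rewrite C0' mulr0 addr0.
  have -> : 2 * (- (a + 1) / (2 * b)) * b = - (a + 1) by field.
  by lra.
have := H (- b / c).
have -> : a + 2 * (- b / c) * b + (- b / c) ^+ 2 * c = (a * c - b ^+ 2) / c by field.
by rewrite pmulr_lge0 ?subr_ge0// invr_gt0 lt_def Cn.
Qed.

Lemma ip_by_parts f f' g g' : (forall x, is_derive x 1 f (f' x)) ->
  (forall x, is_derive x 1 g (g' x)) -> continuous f' -> continuous g' ->
  periodic f (2 * pi) -> periodic g (2 * pi) -> ip f' g = - ip f g'.
Proof.
move=> df dg cf' cg' pf pg.
have cf : continuous f by move=> x; exact: is_derive_cont (df x).
have cg : continuous g by move=> x; exact: is_derive_cont (dg x).
apply/eqP; rewrite -subr_eq0 opprK /ip -intD; [|by cts|by cts].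
have d x : is_derive x 1 (fun y => f y * g y) (f' x * g x + f x * g' x).
  by have a := df x; have b := dg x; drv; ring.
rewrite (int_prim twopi_ge0 _ d); last by cts.
by rewrite -[2 * pi]add0r pf pg subrr.
Qed.

Lemma C1perP psi : C1per psi -> forall x, is_derive x 1 psi (derive1 psi x).
Proof. by move=> [_ d _] x; rewrite derive1E; exact: derivableP. Qed.

Lemma C1per_cont psi : C1per psi -> continuous psi.
Proof. by move=> c x; exact: is_derive_cont (C1perP c x). Qed.

Lemma is_derive_derive1 f f' : (forall x, is_derive x 1 f (f' x)) -> derive1 f = f'.
Proof. by move=> d; apply/funext => x; rewrite derive1E; exact: derive_val. Qed.

Lemma C1per_of f f' : (forall x, is_derive x 1 f (f' x)) -> continuous f' ->
  periodic f (2 * pi) -> C1per f.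
Proof.
move=> d c p; by split => //; rewrite (is_derive_derive1 d).
Qed.

Lemma C1per_cosn n : C1per (cosn n : R -> R).
Proof. by apply: (C1per_of (@cosn_derive R n)); [cts|exact: cosn_periodic]. Qed.
Lemma C1per_sinn n : C1per (sinn n : R -> R).
Proof. by apply: (C1per_of (@sinn_derive R n)); [cts|exact: sinn_periodic]. Qed.

Lemma weak_deriv_ca f g n : continuous f -> weak_deriv f g -> ca g n = n%:R * cb f n.
Proof.
move=> cf [Lg H]; have := H _ (C1per_cosn n); rewrite (is_derive_derive1 (@cosn_derive R n)).
rewrite -/(ip g (cosn n)) -/(ca g n) => /eqP; rewrite -eqr_oppLR => /eqP <-.
have -> : \int[leb]_(x in period) (f x * - (n%:R * sinn n x)) = - (n%:R * cb f n).
  rewrite -mulNr /cb -ipZr; [|exact/L2cont/sinn_cont|exact: L2cont].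
  by apply: eq_Rintegral => x _; rewrite mulNr.
by rewrite opprK.
Qed.

Lemma weak_deriv_cb f g n : continuous f -> weak_deriv f g -> cb g n = - (n%:R * ca f n).
Proof.
move=> cf [Lg H]; have := H _ (C1per_sinn n); rewrite (is_derive_derive1 (@sinn_derive R n)).
rewrite -/(ip g (sinn n)) -/(cb g n) => /eqP; rewrite -eqr_oppLR => /eqP <-.
congr (- _); rewrite /ca -ipZr; [by []|exact/L2cont/cosn_cont|exact: L2cont].
Qed.

Lemma weak_deriv_C1 f f' : (forall x, is_derive x 1 f (f' x)) -> continuous f' ->
  periodic f (2 * pi) -> weak_deriv f f'.
Proof.
move=> d c p; split; first exact: L2cont.
move=> psi cpsi; rewrite -/(ip f _) -/(ip f' psi); case: (cpsi) => ppsi _ cpsi'.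
by rewrite (ip_by_parts d (C1perP cpsi))// opprK.
Qed.

Lemma H1per_C1 f f' : (forall x, is_derive x 1 f (f' x)) -> continuous f' ->
  periodic f (2 * pi) -> H1per f.
Proof.
move=> d c p; split => //; first by move=> x; exact: is_derive_cont (d x).
by exists f'; exact: weak_deriv_C1.
Qed.

(* Locking keeps unification from unfolding the Lebesgue integrals. *)
Definition nrm f : R := locked (@H1norm R) f.

Lemma nrmE f : nrm f = H1norm f. Proof. by rewrite /nrm -lock. Qed.

Lemma nrm_ge0 f : 0 <= nrm f. Proof. by rewrite nrmE; exact: sqrtr_ge0. Qed.

(** Testing against sines and cosines determines the Fourier coefficients of any weak derivative of
    [f], so the one chosen by [wderiv] and [g] have the same L^2 norm. *)
Lemma nrm_sqr f g : continuous f -> weak_deriv f g -> nrm f ^+ 2 = ip f f + ip g g.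
Proof.
move=> cf wg; rewrite nrmE /H1norm sqr_sqrtr; last first.
  by rewrite !ip_sqr addr_ge0// ip_ge0.
rewrite !ip_sqr; congr (_ + _).
have w : weak_deriv f (wderiv f) by rewrite /wderiv; apply: (xgetPex _ (ex_intro _ g wg)).
apply: L2_eq_ip => [||n|n]; [by case: w|by case: wg| |].
  by rewrite (weak_deriv_ca _ cf w) (weak_deriv_ca _ cf wg).
by rewrite (weak_deriv_cb _ cf w) (weak_deriv_cb _ cf wg).
Qed.

Lemma nrm_C1 f f' : (forall x, is_derive x 1 f (f' x)) -> continuous f' ->
  periodic f (2 * pi) -> nrm f ^+ 2 = ip f f + ip f' f'.
Proof.
move=> d c p; apply: nrm_sqr; last exact: weak_deriv_C1.
by move=> x; exact: is_derive_cont (d x).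
Qed.

(* Fourier-side truncation of the H^1 inner product: bilinear by construction, so that the
   triangle inequality and the closedness of H^1-balls for the norm follow by letting N grow. *)
Definition b1_def N f g : R :=
  \sum_(n < N) kap n * (1 + n%:R ^+ 2) * (ca f n * ca g n + cb f n * cb g n).
Definition b1 N f g : R := locked b1_def N f g.

Lemma b1E N f g : b1 N f g =
  \sum_(n < N) kap n * (1 + n%:R ^+ 2) * (ca f n * ca g n + cb f n * cb g n).
Proof. by rewrite /b1 -lock. Qed.

Lemma b1_le N f : H1per f -> b1 N f f <= nrm f ^+ 2.
Proof.
move=> [_ cf [g wg]]; rewrite (nrm_sqr cf wg).
apply: le_trans (lerD (bessel N (L2cont cf)) (bessel N wg.1)).
rewrite b1E /ql -big_split /= ler_sum// => i _.
rewrite (weak_deriv_ca _ cf wg) (weak_deriv_cb _ cf wg).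
by rewrite le_eqVlt; apply/orP; left; apply/eqP; ring.
Qed.

(** Bounded truncated norms make the formally differentiated coefficients square summable.
    Riesz-Fischer realizes them by an L^2 function, and Parseval, for [f] against psi' and for that
    function against psi, shows it to be a weak derivative. *)
Lemma H1_of_b1 f M : continuous f -> periodic f (2 * pi) -> 0 <= M ->
  (forall N, b1 N f f <= M ^+ 2) -> H1per f /\ nrm f <= M.
Proof.
move=> cf pf M0 H.
pose al n := n%:R * cb f n; pose be n := - (n%:R * ca f n).
have be0 : be 0%N = 0 by rewrite /be mul0r oppr0.
have b1q N : b1 N f f = ql N f f + \sum_(n < N) kap n * (al n ^+ 2 + be n ^+ 2).
  by rewrite b1E /ql -big_split /=; apply: eq_bigr => i _; rewrite /al /be; ring.
have mono m N : (m <= N)%N -> \sum_(n < m) kap n * (al n ^+ 2 + be n ^+ 2) <=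
    \sum_(n < N) kap n * (al n ^+ 2 + be n ^+ 2).
  move=> /subnKC <-; elim: (N - m)%N => [|k IH]; first by rewrite addn0.
  rewrite addnS; apply: le_trans IH _; rewrite [leRHS]big_ord_recr /= lerDl.
  by rewrite mulr_ge0 ?kap_ge0// addr_ge0 ?sqr_ge0.
have weak g : L2per g -> (forall n, ca g n = al n) -> (forall n, cb g n = be n) -> weak_deriv f g.
  move=> Lg gc gs; split => // psi cpsi; case: (cpsi) => ppsi _ cpsi'.
  rewrite -/(ip f _) -/(ip g psi).
  have cc := C1per_cont cpsi.
  have pp' : periodic (derive1 psi) (2 * pi).
    move=> x; have d1 := C1perP cpsi x.
    have d2 : is_derive x 1 psi (derive1 psi (x + 2 * pi)).
      have -> : psi = (fun y => psi (y + 2 * pi)) by apply/funext => y; rewrite ppsi.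
      rewrite -[X in is_derive _ _ _ X]mulr1; apply: (@dcomp _ (fun y => y + 2 * pi)); last exact: is_derive_shift.
      have -> : (fun y => psi (y + 2 * pi)) = psi by apply/funext => y; rewrite ppsi.
      exact: C1perP.
    by rewrite -(@derive_val _ _ _ _ _ _ _ d2) (@derive_val _ _ _ _ _ _ _ d1).
  have ql_eq N : ql N f (derive1 psi) = - ql N g psi.
    rewrite /ql -sumrN; apply: eq_bigr => i _.
    have wp := weak_deriv_C1 (C1perP cpsi) cpsi' ppsi.
    by rewrite gc gs (weak_deriv_ca _ cc wp) (weak_deriv_cb _ cc wp) /al /be; ring.
  apply/eqP; rewrite -subr_eq0 -normr_le0; apply/ler_addgt0Pl => e e0; rewrite addr0.
  have e20 : 0 < e / 2 by rewrite divr_gt0.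
  have [N1 H1] := parseval (L2cont cf) cpsi' pp' e20.
  have [N2 H2] := parseval Lg cc ppsi e20.
  have := H1 (maxn N1 N2) (leq_maxl _ _); have := H2 (maxn N1 N2) (leq_maxr _ _).
  rewrite ql_eq !ler_norml => /andP[a1 a2] /andP[a3 a4].
  by apply/andP; split; lra.
have sumM N : \sum_(n < N) kap n * (al n ^+ 2 + be n ^+ 2) <= M ^+ 2.
  by apply: le_trans (H N); rewrite b1q lerDr ql_ge0.
have [g0 [Lg0 gc0 gs0 _]] := riesz_fischer be0 sumM.
have w0 := weak g0 Lg0 gc0 gs0.
split; first by split => //; exists g0.
rewrite -(@ler_pXn2r _ 2) ?nnegrE ?nrm_ge0// (nrm_sqr cf w0).
apply/ler_addgt0Pl => e e0.
have [N0 HN0] := parseval_cont cf pf e0.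
(* The norm needs the sharper bound M^2 - ip f f on the derivative part. Parseval for [f] supplies
   it up to e, and a second Riesz-Fischer function with the same coefficients has the corresponding
   norm. *)
have sumM' N : \sum_(n < N) kap n * (al n ^+ 2 + be n ^+ 2) <= M ^+ 2 + e - ip f f.
  have := H (maxn N N0); rewrite b1q; have := HN0 _ (leq_maxr N N0).
  have := mono _ _ (leq_maxl N N0); lra.
have [g1 [Lg1 gc1 gs1 Bg1]] := riesz_fischer be0 sumM'.
rewrite (@L2_eq_ip _ g0 g1) => //; last 2 first.
- by move=> n; rewrite gc0 gc1.
- by move=> n; rewrite gs0 gs1.
lra.
Qed.

Lemma caD f g n : L2per f -> L2per g -> ca (fun x => f x + g x) n = ca f n + ca g n.
Proof. by move=> Lf Lg; rewrite /ca ipDl//; exact/L2cont/cosn_cont. Qed.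
Lemma cbD f g n : L2per f -> L2per g -> cb (fun x => f x + g x) n = cb f n + cb g n.
Proof. by move=> Lf Lg; rewrite /cb ipDl//; exact/L2cont/sinn_cont. Qed.
Lemma caZ k f n : L2per f -> ca (fun x => k * f x) n = k * ca f n.
Proof. by move=> Lf; rewrite /ca ipZl//; exact/L2cont/cosn_cont. Qed.
Lemma cbZ k f n : L2per f -> cb (fun x => k * f x) n = k * cb f n.
Proof. by move=> Lf; rewrite /cb ipZl//; exact/L2cont/sinn_cont. Qed.

Lemma b1C N f g : b1 N f g = b1 N g f.
Proof. by rewrite !b1E; apply: eq_bigr => i _; ring. Qed.
Lemma b1Dl N f g h : L2per f -> L2per g -> b1 N (fun x => f x + g x) h = b1 N f h + b1 N g h.
Proof. by move=> Lf Lg; rewrite !b1E -big_split /=; apply: eq_bigr => i _; rewrite caD// cbD//; ring. Qed.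
Lemma b1Zl N k f h : L2per f -> b1 N (fun x => k * f x) h = k * b1 N f h.
Proof. by move=> Lf; rewrite !b1E mulr_sumr; apply: eq_bigr => i _; rewrite caZ// cbZ//; ring. Qed.
Lemma b1_ge0 N f : 0 <= b1 N f f.
Proof. by rewrite b1E; apply: sumr_ge0 => i _; rewrite !mulr_ge0 ?kap_ge0// -!expr2 addr_ge0 ?sqr_ge0. Qed.

Lemma b1_CS N f g : L2per f -> L2per g -> b1 N f g ^+ 2 <= b1 N f f * b1 N g g.
Proof.
move=> Lf Lg; apply: quadratic_discriminant (b1_ge0 _ _) => s.
have Ls := L2Z s Lg; have -> : b1 N f f + 2 * s * b1 N f g + s ^+ 2 * b1 N g g =
   b1 N (fun x => f x + s * g x) (fun x => f x + s * g x).
  rewrite b1Dl// b1Zl// !(b1C _ _ (fun x => f x + s * g x)) !b1Dl// !b1Zl// (b1C _ g f); ring.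
exact: b1_ge0.
Qed.

Lemma H1per_cont f : H1per f -> continuous f. Proof. by case. Qed.
Lemma H1per_periodic f : H1per f -> periodic f (2 * pi). Proof. by case. Qed.
Lemma H1per_L2 f : H1per f -> L2per f. Proof. by case=> _ c _; exact: L2cont. Qed.

Lemma b1_bound N f g : H1per f -> H1per g -> `|b1 N f g| <= nrm f * nrm g.
Proof.
move=> Hf Hg; rewrite -(@ler_pXn2r _ 2) ?nnegrE ?mulr_ge0 ?nrm_ge0//.
rewrite real_normK ?num_real// (le_trans (b1_CS N (H1per_L2 Hf) (H1per_L2 Hg)))//.
by rewrite exprMn ler_pM ?b1_ge0 ?b1_le.
Qed.

(** The chosen weak derivative of a sum need not be the sum of the chosen ones, so the triangle
    inequality is proved for the bilinear forms [b1 N], uniformly in N. *)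
Lemma H1_add f g : H1per f -> H1per g ->
  H1per (fun x => f x + g x) /\ nrm (fun x => f x + g x) <= nrm f + nrm g.
Proof.
move=> Hf Hg; have cf := H1per_cont Hf; have cg := H1per_cont Hg.
have pf := H1per_periodic Hf; have pg := H1per_periodic Hg.
apply: H1_of_b1; [by cts|by move=> x; rewrite pf pg|by rewrite addr_ge0 ?nrm_ge0|move=> N].
have Lf := H1per_L2 Hf; have Lg := H1per_L2 Hg.
rewrite b1Dl// !(b1C _ _ (fun x => _ + _)) !b1Dl// (b1C _ g f).
have := b1_bound N Hf Hg; rewrite ler_norml => /andP[_ h].
by have := b1_le N Hf; have := b1_le N Hg; rewrite sqrrD; lra.
Qed.

Lemma H1_scale k f : H1per f ->
  H1per (fun x => k * f x) /\ nrm (fun x => k * f x) <= `|k| * nrm f.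
Proof.
move=> Hf; have cf := H1per_cont Hf; have Lf := H1per_L2 Hf.
apply: H1_of_b1; [by cts|by move=> x; rewrite (H1per_periodic Hf)|by rewrite mulr_ge0 ?nrm_ge0|move=> N].
rewrite b1Zl// b1C b1Zl// mulrA -expr2 exprMn real_normK ?num_real//.
by rewrite ler_wpM2l ?sqr_ge0// b1_le.
Qed.

Lemma H1_sub f g : H1per f -> H1per g ->
  H1per (fun x => f x - g x) /\ nrm (fun x => f x - g x) <= nrm f + nrm g.
Proof.
move=> Hf Hg; have [Hk Nk] := H1_scale (-1) Hg; have [H N] := H1_add Hf Hk.
have E : (fun x => f x + -1 * g x) = (fun x => f x - g x) by apply/funext => x; rewrite mulN1r.
rewrite E in H N; split => //; apply: le_trans N _; rewrite lerD2l.
by apply: le_trans Nk _; rewrite normrN1 mul1r.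
Qed.

Lemma cvg_big_ord n (u : nat -> nat -> R) (l : nat -> R) :
  (forall i, u j i @[j --> \oo] --> l i) ->
  \sum_(i < n) u j i @[j --> \oo] --> \sum_(i < n) l i.
Proof.
move=> H; elim: n => [|n IH].
  by rewrite big_ord0; under eq_fun do rewrite big_ord0; exact: cvg_cst.
by rewrite big_ord_recr /=; under eq_fun do rewrite big_ord_recr /=; exact: cvgD.
Qed.

(** Each [b1 N] involves finitely many coefficients, and these pass to uniform limits. This stands
    in for completeness of H^1 throughout. *)
Lemma H1_closed f M : 0 <= M ->
  (forall e, 0 < e -> exists h, [/\ H1per h, nrm h <= M & forall x, `|f x - h x| <= e]) ->
  H1per f /\ nrm f <= M.
Proof.
move=> M0 H.
have [h Hh] := choice (fun j : nat => H (j.+1%:R^-1) ltac:(by rewrite invr_gt0)).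
have cf : continuous f.
  move=> x; apply/cvgrPdist_le => e e0.
  have e30 : 0 < e / 3 by rewrite divr_gt0.
  have [g [Hg _ fg]] := H _ e30.
  have /cvgrPdist_le /(_ _ e30) := H1per_cont Hg (x:=x).
  apply: filterS => y; rewrite !ler_norml => /andP[a1 a2].
  have := fg x; have := fg y; rewrite !ler_norml => /andP[b1 b2] /andP[c1 c2].
  by apply/andP; split; lra.
have pf : periodic f (2 * pi).
  move=> x; apply/eqP; rewrite -subr_eq0 -normr_le0; apply/ler_addgt0Pl => e e0; rewrite addr0.
  have e20 : 0 < e / 2 by rewrite divr_gt0.
  have [g [Hg _ fg]] := H _ e20; have := fg x; have := fg (x + 2 * pi).
  rewrite (H1per_periodic Hg) !ler_norml => /andP[b1 b2] /andP[c1 c2].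
  by apply/andP; split; lra.
apply: H1_of_b1 => // N.
have cvg_ip (c : R -> R) : continuous c -> (forall x, `|c x| <= 1) ->
    ip (h j) c @[j --> \oo] --> ip f c.
  move=> cc c1; apply/cvgrPdist_le => e e0.
  near=> j.
  have [Hhj _ fh] := Hh j; have ch := H1per_cont Hhj.
  rewrite -ipBl; [|exact: L2cont..].
  have cd : continuous (fun x => f x - h j x) by cts.
  have j0 : 0 <= j.+1%:R^-1 :> R by rewrite invr_ge0.
  apply: le_trans (ip_le_sup cd cc j0 ler01 fh c1) _.
  rewrite mulr1 mulrC ler_pdivrMr// -ler_pdivrMl// mulrC.
  apply: (@le_trans _ _ j%:R); last by rewrite ler_nat.
  by near: j; exact: nbhs_infty_ger.
have cvg_b1 : b1 N (h j) (h j) @[j --> \oo] --> b1 N f f.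
  rewrite b1E; under eq_fun do rewrite b1E.
  apply: (@cvg_big_ord N (fun j n => kap n * (1 + n%:R ^+ 2) *
      (ca (h j) n * ca (h j) n + cb (h j) n * cb (h j) n))
    (fun n => kap n * (1 + n%:R ^+ 2) * (ca f n * ca f n + cb f n * cb f n))) => i.
  apply: cvgM; first exact: cvg_cst.
  have c1 := cvg_ip _ (@cosn_cont R i) (@cosn_le1 R i).
  have c2 := cvg_ip _ (@sinn_cont R i) (@sinn_le1 R i).
  by apply: cvgD; apply: cvgM.
apply: (cvgr_to_le cvg_b1); near=> j.
have [Hhj hM _] := Hh j.
by apply: le_trans (b1_le N Hhj) _; rewrite ler_pXn2r ?nnegrE ?nrm_ge0.
Unshelve. all: by end_near. Qed.

End SobolevNorm.

(** * Sobolev embedding and the algebra property of H^1 *)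

Section SobolevEmbedding.
Context {R : realType}.
Implicit Types (f g h psi p : R -> R) (x y e k M : R) (n m N : nat).

Lemma interval_CS f x y : x <= y -> continuous f ->
  (\int[leb]_(t in `[x, y]) f t) ^+ 2 <= (y - x) * \int[leb]_(t in `[x, y]) (f t ^+ 2).
Proof.
move=> xy cf.
have c1 : continuous (fun _ : R => 1 : R) by cts.
have := @int_CS R _ _ leb `[x, y]%classic (measurable_itv _) f (fun=> 1).
move=> /(_ _ _ _) H.
have := H (@cint _ (fun t => f t ^+ 2) x y ltac:(by cts))
  (@cint _ (fun t => 1 ^+ 2) x y ltac:(by cts)) (@cint _ (fun t => f t * 1) x y ltac:(by cts)).
under eq_Rintegral do rewrite mulr1.
have -> : \int[leb]_(x0 in `[x, y]) (1 ^+ 2) = y - x.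
  by rewrite int_cst// expr1n mul1r.
by rewrite mulrC.
Qed.

Lemma increment_C1 f f' x y : (forall x, is_derive x 1 f (f' x)) -> continuous f' ->
  periodic f' (2 * pi) -> x <= y -> y <= x + 2 * pi ->
  (f y - f x) ^+ 2 <= (y - x) * ip f' f'.
Proof.
move=> d cf' pf' xy y2; rewrite -(int_prim xy cf' d).
apply: le_trans (interval_CS xy cf') _; rewrite ler_wpM2l ?subr_ge0// -ip_sqr.
rewrite -(@int_periodic _ (fun t => f' t ^+ 2) x); last 2 first.
- by cts.
- by move=> z; rewrite pf'.
rewrite (@int_split _ (fun t => f' t ^+ 2) x (x + 2 * pi) y)//; last by cts.
by rewrite lerDl Rintegral_ge0// => z _; exact: sqr_ge0.
Qed.

Lemma pi_le4 : pi <= 4 :> R. Proof. by have := @pihalf_lt2 R; lra. Qed.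

Lemma ip_le_nrm_C1 f f' : (forall x, is_derive x 1 f (f' x)) -> continuous f' ->
  periodic f (2 * pi) -> ip f f <= nrm f ^+ 2 /\ ip f' f' <= nrm f ^+ 2.
Proof.
move=> d cf' pf; rewrite (nrm_C1 d cf' pf); have := ip_ge0 f; have := ip_ge0 f'.
move: (ip f f) (ip f' f') => a b; lra.
Qed.

Lemma periodic_derive f f' : (forall x, is_derive x 1 f (f' x)) -> periodic f (2 * pi) ->
  periodic f' (2 * pi).
Proof.
move=> d p x; have d1 := d x.
have d2 : is_derive x 1 f (f' (x + 2 * pi)).
  have -> : f = (fun y => f (y + 2 * pi)) by apply/funext => y; rewrite p.
  rewrite -[X in is_derive _ _ _ X]mulr1; apply: (@dcomp _ (fun y => y + 2 * pi)); last exact: is_derive_shift.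
by rewrite -(@derive_val _ _ _ _ _ _ _ d2) (@derive_val _ _ _ _ _ _ _ d1).
Qed.

(** Average f(x)^2 <= 2 f(y)^2 + 2 (f(y) - f(x))^2 over y in a period: f(x)^2 <= (1/pi + 4 pi)
    [nrm f]^2, and 2 <= pi <= 4 brings the factor below 25. *)
Lemma sup_C1 f f' x : (forall x, is_derive x 1 f (f' x)) -> continuous f' ->
  periodic f (2 * pi) -> `|f x| <= 5 * nrm f.
Proof.
move=> d cf' pf; have pf' := periodic_derive d pf.
have cf : continuous f by move=> z; exact: is_derive_cont (d z).
have [n1 n2] := ip_le_nrm_C1 d cf' pf.
set A := nrm f in n1 n2 *; have A0 : 0 <= A by exact: nrm_ge0.
have p0 := @twopi_gt0 R; have p1 := @pi_ge2 R.
set D := ip f' f' in n2; have D0 : 0 <= D by exact: ip_ge0.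
have H : \int[leb]_(y in `[x, x + 2 * pi]) (f x ^+ 2) <=
    \int[leb]_(y in `[x, x + 2 * pi]) (2 * f y ^+ 2 + 4 * pi * D).
  apply: int_le; [by cts|by cts|move=> y /andP[xy y2]].
  have := increment_C1 d cf' pf' xy y2; rewrite -/D.
  have : (y - x) * D <= 2 * pi * D by rewrite ler_wpM2r// lerBlDl.
  have := sqr_ge0 (f y + (f y - f x)).
  move: (f x) (f y) (pi * D) ((y - x) * D) => fx fy pD yD.
  rewrite -[2 * pi * D]mulrA -[4 * pi * D]mulrA; nra.
move: H; rewrite int_cst ?lerDl ?(ltW p0)// intD; [|by cts|by cts].
rewrite int_cst ?lerDl ?(ltW p0)// intZ; last by cts.
rewrite (@int_periodic _ (fun y => f y ^+ 2)); last 2 first.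
- by cts.
- by move=> z; rewrite pf.
rewrite -/period ip_sqr [x + _ - x]addrAC subrr add0r => H.
have p4 := pi_le4.
rewrite -(@ler_pXn2r _ 2) ?nnegrE ?mulr_ge0// real_normK ?num_real//.
have {H} : f x ^+ 2 * (2 * pi) <= 2 * A ^+ 2 + 4 * pi * A ^+ 2 * (2 * pi).
  apply: le_trans H _; rewrite lerD ?ler_wpM2l// ler_wpM2r ?(ltW p0)// ler_wpM2l// mulr_ge0// ltW//.
  exact: pi_gt0.
rewrite exprMn; move: (f x ^+ 2) (A ^+ 2) (sqr_ge0 A) p0 p1 p4 => F A2 A20.
move: (pi : R) => P P0 P2 P4 H.
suff : F * P <= 25 * A2 * P.
  by rewrite ler_pM2r; [rewrite -natrX|lra].
have : 0 <= A2 * P * (4 - P) by rewrite !mulr_ge0 ?subr_ge0//; lra.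
have : 0 <= A2 * (P - 2) by rewrite mulr_ge0// subr_ge0.
lra.
Qed.

Lemma tp_C1 N (al be : nat -> R) : exists f', [/\ forall x, is_derive x 1 (tp N al be) (f' x),
  continuous f' & periodic f' (2 * pi)].
Proof.
exists (tp N (fun n => n%:R * be n) (fun n => - (n%:R * al n))); split.
- by move=> x; exact: tp_derive.
- exact: tp_cont.
- exact: tp_periodic.
Qed.

Lemma H1per_tp N (al be : nat -> R) : H1per (tp N al be).
Proof.
have [f' [d c _]] := tp_C1 N al be.
by apply: (H1per_C1 d c); exact: tp_periodic.
Qed.

Lemma nrm_of_b1 f M : H1per f -> 0 <= M -> (forall N, b1 N f f <= M ^+ 2) -> nrm f <= M.
Proof. by move=> [p c _] M0 H; have [] := H1_of_b1 c p M0 H. Qed.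

Lemma b1_le_coef f g N : (forall n, ca f n ^+ 2 + cb f n ^+ 2 <= ca g n ^+ 2 + cb g n ^+ 2) ->
  b1 N f f <= b1 N g g.
Proof.
move=> H; rewrite !b1E ler_sum// => i _.
by rewrite -!expr2 ler_wpM2l// mulr_ge0 ?kap_ge0// addr_ge0.
Qed.

Lemma nrm_sigma N f : H1per f -> nrm (sigma N f) <= nrm f.
Proof.
move=> Hf; apply: nrm_of_b1 => [||m]; [exact: H1per_tp|exact: nrm_ge0|].
apply: le_trans (b1_le m Hf); apply: b1_le_coef => n.
have w (a : R) : (n < N)%N -> (fejer_weight N n * a) ^+ 2 <= a ^+ 2.
  move=> nN; rewrite exprMn ler_piMl ?sqr_ge0// expr_le1// ?fejer_weight_ge0//.
  exact: fejer_weight_le1.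
rewrite ca_tp cb_tp; case: ifP => nN /=; last by rewrite expr0n addr0 addr_ge0 ?sqr_ge0.
by case: ifP => _; rewrite lerD ?w// expr0n sqr_ge0.
Qed.

(** Density without convergence in H^1: uniform closeness and a norm that does not grow are enough,
    because [H1_closed] asks for no more. *)
Lemma trig_approx f e : H1per f -> 0 < e ->
  exists N, nrm (sigma N f) <= nrm f /\ forall x, `|f x - sigma N f x| <= e.
Proof.
move=> Hf e0; have [p c _] := Hf; have [N0 H] := sigma_cvg c p e0.
exists N0; split; first exact: nrm_sigma.
by move=> x; rewrite distrC; exact: H.
Qed.

Lemma sup_nrm f x : H1per f -> `|f x| <= 5 * nrm f.
Proof.
move=> Hf; apply/ler_addgt0Pl => e e0.
have [N [nN fN]] := trig_approx Hf e0.
have [f' [d c _]] := tp_C1 N (fun n => fejer_weight N n * ca f n) (fun n => fejer_weight N n * cb f n).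
have := sup_C1 x d c (@tp_periodic _ _ _ _); rewrite -/(sigma N f) => sN.
rewrite -[f x](subrK (sigma N f x)) (le_trans (ler_normD _ _))// lerD//.
by apply: le_trans sN _; rewrite ler_wpM2l.
Qed.

(** The exponent 1/2 makes the singular integral of the Hilbert transform converge, with a tail of
    order sqrt e. *)
Lemma hoelder_nrm f x y : H1per f -> x <= y -> y <= x + 2 * pi ->
  `|f y - f x| <= Num.sqrt (y - x) * nrm f.
Proof.
move=> Hf xy y2; apply/ler_addgt0Pl => e e0.
have e20 : 0 < e / 2 by rewrite divr_gt0.
have [N [nN fN]] := trig_approx Hf e20.
have [f' [d c pf']] := tp_C1 N (fun n => fejer_weight N n * ca f n) (fun n => fejer_weight N n * cb f n).
rewrite -/(sigma N f) in d.
have h : `|sigma N f y - sigma N f x| <= Num.sqrt (y - x) * nrm f.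
  rewrite -(@ler_pXn2r _ 2) ?nnegrE ?mulr_ge0 ?sqrtr_ge0 ?nrm_ge0//.
  rewrite real_normK ?num_real// exprMn sqr_sqrtr ?subr_ge0//.
  apply: le_trans (increment_C1 d c pf' xy y2) _; rewrite ler_wpM2l ?subr_ge0//.
  have [_ h2] := ip_le_nrm_C1 d c (@tp_periodic _ _ _ _).
  by apply: le_trans h2 _; rewrite ler_pXn2r ?nnegrE ?nrm_ge0.
have := fN x; have := fN y; move: h; rewrite !ler_norml.
by move=> /andP[a1 a2] /andP[b1 b2] /andP[c1 c2]; apply/andP; split; lra.
Qed.

(** Write a, b and u, v for the squared L^2 norms of f, f' and g, g'. The sup bounds give 25 (u + v)
    a + 50 (a + b) v + 50 (u + v) b, at most 100 (a + b) (u + v); the term b v attains the 100. *)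
Lemma H1_mul_C1 f f' g g' : (forall x, is_derive x 1 f (f' x)) -> continuous f' ->
  periodic f (2 * pi) -> (forall x, is_derive x 1 g (g' x)) -> continuous g' ->
  periodic g (2 * pi) ->
  H1per (fun x => f x * g x) /\ nrm (fun x => f x * g x) <= 10 * nrm f * nrm g.
Proof.
move=> df cf' pf dg cg' pg.
have cf : continuous f by move=> z; exact: is_derive_cont (df z).
have cg : continuous g by move=> z; exact: is_derive_cont (dg z).
have d x : is_derive x 1 (fun y => f y * g y) (f x * g' x + g x * f' x).
  by have a := df x; have b := dg x; drv.
have c : continuous (fun x => f x * g' x + g x * f' x) by cts.
have p : periodic (fun x => f x * g x) (2 * pi) by move=> x; rewrite pf pg.
split; first exact: H1per_C1 d c p.
have sf x := sup_C1 x df cf' pf; have sg x := sup_C1 x dg cg' pg.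
rewrite -(@ler_pXn2r _ 2) ?nnegrE ?mulr_ge0 ?nrm_ge0// (nrm_C1 d c p).
have Ef := nrm_C1 df cf' pf; have Eg := nrm_C1 dg cg' pg.
have sq (h : R -> R) (K : R) x : `|h x| <= K -> h x ^+ 2 <= K ^+ 2.
  move=> hK; rewrite -(real_normK (num_real (h x))) ler_pXn2r ?nnegrE//.
  exact: le_trans hK.
set F := nrm f in sf Ef *; set G := nrm g in sg Eg *.
have h1 : ip (fun x => f x * g x) (fun x => f x * g x) <= (5 * G) ^+ 2 * ip f f.
  rewrite -ip_sqr -[ip f f]ip_sqr /period -intZ; last by cts.
  apply: int_le; [by cts|by cts|move=> x _].
  by rewrite exprMn mulrC ler_wpM2r ?sqr_ge0// sq.
have h2 : ip (fun x => f x * g' x + g x * f' x) (fun x => f x * g' x + g x * f' x) <=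
    2 * (5 * F) ^+ 2 * ip g' g' + 2 * (5 * G) ^+ 2 * ip f' f'.
  rewrite -!ip_sqr /period -!intZ -?intD; [|by cts..].
  apply: int_le; [by cts|by cts|move=> x _].
  have a := sq f _ x (sf x); have b := sq g _ x (sg x).
  have a' : f x ^+ 2 * g' x ^+ 2 <= (5 * F) ^+ 2 * g' x ^+ 2 by rewrite ler_wpM2r ?sqr_ge0.
  have b' : g x ^+ 2 * f' x ^+ 2 <= (5 * G) ^+ 2 * f' x ^+ 2 by rewrite ler_wpM2r ?sqr_ge0.
  have := sqr_ge0 (f x * g' x - g x * f' x).
  move: (f x) (g' x) (g x) (f' x) ((5 * F) ^+ 2) ((5 * G) ^+ 2) a' b' => s1 s2 s3 s4 s5 s6.
  rewrite sqrrB sqrrD !exprMn; lra.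
apply: le_trans (lerD h1 h2) _; rewrite !exprMn Ef Eg.
have := ip_ge0 f; have := ip_ge0 f'; have := ip_ge0 g; have := ip_ge0 g'.
move: (ip f f) (ip f' f') (ip g g) (ip g' g') => a b u v v0 u0 b0 a0.
have : 0 <= a * u by rewrite mulr_ge0.
have : 0 <= a * v by rewrite mulr_ge0.
have : 0 <= b * u by rewrite mulr_ge0.
have : 0 <= b * v by rewrite mulr_ge0.
by rewrite -!natrX; lra.
Qed.

Lemma H1_mul f g : H1per f -> H1per g ->
  H1per (fun x => f x * g x) /\ nrm (fun x => f x * g x) <= 10 * nrm f * nrm g.
Proof.
move=> Hf Hg; have f0 := nrm_ge0 f; have g0 := nrm_ge0 g.
apply: H1_closed => [|e e0]; first by rewrite !mulr_ge0.
(* Replacing one factor at a time by its Fejer mean costs (5 nrm f + 5 nrm g) e / K; the 1 keeps K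
   positive. *)
pose K := 5 * nrm f + 5 * nrm g + 1; have K0 : 0 < K by rewrite /K ltr_wpDl// addr_ge0 ?mulr_ge0.
have eK : 0 < e / K by rewrite divr_gt0.
have [N [nN fN]] := trig_approx Hf eK; have [M [nM gM]] := trig_approx Hg eK.
have [f' [df cf _]] := tp_C1 N (fun n => fejer_weight N n * ca f n) (fun n => fejer_weight N n * cb f n).
have [g' [dg cg _]] := tp_C1 M (fun n => fejer_weight M n * ca g n) (fun n => fejer_weight M n * cb g n).
have [H nH] := H1_mul_C1 df cf (@tp_periodic _ _ _ _) dg cg (@tp_periodic _ _ _ _).
exists (fun x => sigma N f x * sigma M g x); split => //.
  apply: le_trans nH _; rewrite ler_pM ?mulr_ge0 ?nrm_ge0// ler_wpM2l//.
move=> x; have -> : f x * g x - sigma N f x * sigma M g x =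
  f x * (g x - sigma M g x) + (f x - sigma N f x) * sigma M g x by ring.
have sM : `|sigma M g x| <= 5 * nrm g.
  by apply: le_trans (sup_nrm x (H1per_tp _ _ _)) _; rewrite ler_wpM2l.
have t1 : `|f x * (g x - sigma M g x)| <= 5 * nrm f * (e / K).
  by rewrite normrM ler_pM// sup_nrm.
have t2 : `|(f x - sigma N f x) * sigma M g x| <= e / K * (5 * nrm g).
  by rewrite normrM ler_pM.
have eE : e = K * (e / K) by rewrite mulrC divfK ?gt_eqF.
rewrite (le_trans (ler_normD _ _))// (le_trans (lerD t1 t2))// [leRHS]eE.
move: (e / K) eK; rewrite /K => d d0; move: (nrm f) (nrm g) => F G; lra.
Qed.

End SobolevEmbedding.

(** * The Hilbert transform on H^1 *)

Section HilbertTransform.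
Context {R : realType}.
Implicit Types (f g h : R -> R) (x y z e d t : R) (n m N : nat).

Lemma mono_of_derive f f' a b : a <= b -> (forall x, a < x < b -> is_derive x 1 f (f' x)) ->
  {within `[a, b], continuous f} -> (forall x, a < x < b -> 0 <= f' x) -> f a <= f b.
Proof.
move=> ab d c f0; have c0 : continuous (fun _ : R => 0 : R) by cts.
have := int_le_prim ab c0 d c f0; rewrite int_cst// mul0r; lra.
Qed.

Lemma sin_le_id z : 0 <= z -> sin z <= z.
Proof.
move=> z0; have d y : is_derive y 1 (fun y => y - sin y) (1 - cos y) by drv; ring.
have := @mono_of_derive (fun y => y - sin y) (fun y => 1 - cos y) 0 z z0 (fun y _ => d y).
rewrite sin0 subr0 => H; rewrite -subr_ge0; apply: H => [|y _]; last by rewrite subr_ge0 cos_le1.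
by apply: continuous_subspaceT; cts.
Qed.

Lemma zcos_le_sin z : 0 <= z -> z <= pi -> z * cos z <= sin z.
Proof.
move=> z0 zp; have d y : is_derive y 1 (fun y => sin y - y * cos y) (y * sin y) by drv; ring.
have := @mono_of_derive (fun y => sin y - y * cos y) (fun y => y * sin y) 0 z z0 (fun y _ => d y).
rewrite sin0 mul0r subr0 => H; rewrite -subr_ge0; apply: H => [|y /andP[y0 yz]].
  by apply: continuous_subspaceT; cts.
by rewrite mulr_ge0 ?(ltW y0)// sin_ge0_pi// (ltW y0) (le_trans (ltW yz)).
Qed.

(** This is cot (t / 2), in a form whose 2 pi-periodicity is visible. *)
Definition hk t : R := sin t / (1 - cos t).

Lemma cos_half t : 1 - cos t = 2 * sin (t / 2) ^+ 2.
Proof.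
have -> : cos t = cos (t / 2 + t / 2) by congr cos; field.
have := cos2Dsin2 (t / 2); rewrite cosD; lra.
Qed.

Lemma sin_half t : sin t = 2 * sin (t / 2) * cos (t / 2).
Proof. have -> : sin t = sin (t / 2 + t / 2) by congr sin; field.
by rewrite sinD; ring.
Qed.

Lemma cot_half t : cot (t / 2) = hk t.
Proof.
rewrite /cot /hk cos_half (sin_half t).
have [->|s0] := eqVneq (sin (t / 2)) 0; first by rewrite mulr0 !mul0r invr0 mulr0.
by field.
Qed.

Lemma hk_ge0 t : 0 <= t -> t <= pi -> 0 <= hk t.
Proof. by move=> t0 tp; rewrite divr_ge0 ?subr_ge0 ?cos_le1// sin_ge0_pi// t0. Qed.

Lemma hk_le t : 0 < t -> t <= pi -> hk t <= 2 / t.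
Proof.
move=> t0 tp; have p0 := @pi_gt0 R.
have z0 : 0 < t / 2 by rewrite divr_gt0.
have s0 : 0 < sin (t / 2) by rewrite sin_gt0_pi// z0 /=; lra.
rewrite -cot_half /cot ler_pdivrMr// mulrAC ler_pdivlMr//.
by have := zcos_le_sin (ltW z0) ltac:(lra); lra.
Qed.

(** From sin z <= z at z = t / 2, t cot (t / 2) >= 2 cos (t / 2), and cos decreases. This is where
    the factor cos ((b - a) / 2) of T^* comes from. *)
Lemma hk_ge t d : 0 < t -> t <= d -> d <= pi -> 2 * cos (d / 2) <= t * hk t.
Proof.
move=> t0 td dp; have p0 := @pi_gt0 R.
have z0 : 0 < t / 2 by rewrite divr_gt0.
have s0 : 0 < sin (t / 2) by rewrite sin_gt0_pi// z0 /=; lra.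
have c0 : 0 <= cos (t / 2) by apply: cos_ge0_pihalf; apply/andP; split; lra.
have cc : cos (d / 2) <= cos (t / 2) by apply: cos_monotone; lra.
rewrite -cot_half /cot mulrA ler_pdivlMr//.
have s1 := sin_le_id (ltW z0).
apply: (@le_trans _ _ (2 * cos (t / 2) * sin (t / 2))).
  by rewrite ler_wpM2r ?(ltW s0)// ler_wpM2l.
by move: (sin _) (cos _) s1 c0 => s c s1 c0; nra.
Qed.

(** Freezing the denominator near the singularity gives a kernel that is continuous, periodic and
    odd on the whole line and unchanged at distance at least e from the multiples of 2 pi. *)
Definition hke e t : R := sin t / Num.max (1 - cos t) (1 - cos e).

Lemma hke_cont e : 0 < e -> e <= pi -> continuous (hke e).
Proof.
move=> e0 ep; apply: (@cfM _ sin (fun t => (Num.max (1 - cos t) (1 - cos e))^-1)); first exact: continuous_sin.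
apply: cfV; last by cts.
by move=> x; rewrite gt_eqF// lt_max [X in _ || X]subr_gt0 cos_lt1// orbT.
Qed.

Lemma hkeE e t : cos t <= cos e -> hke e t = hk t.
Proof. by move=> H; rewrite /hke /hk max_l// lerD2l lerN2. Qed.

Lemma hkeE_itv e t : 0 <= e -> e <= t -> t <= pi -> hke e t = hk t.
Proof. by move=> e0 et tp; rewrite hkeE// cos_monotone. Qed.

Lemma hke_periodic e : periodic (hke e) (2 * pi).
Proof. by move=> x; rewrite /hke [2 * pi]mulr_natl sinD2pi cosD2pi. Qed.

Lemma hkeN e t : hke e (- t) = - hke e t.
Proof. by rewrite /hke sinN cosN mulNr. Qed.

(* The Hilbert transform with the singularity cut off at distance e, folded onto [e, pi];
   on this interval [hke e] coincides with cot (y / 2). *)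
Definition HI e f x : R := \int[leb]_(y in `[e, pi]) ((f (x - y) - f (x + y)) * hke e y).

Lemma HI_cont_integrand e f x : 0 < e -> e <= pi -> continuous f ->
  continuous (fun y => (f (x - y) - f (x + y)) * hke e y).
Proof. by move=> e0 ep cf; have c := hke_cont e0 ep; cts. Qed.

(** The period starting at x has its singularities at the two ends only. Its halves around x + pi
    become [e, pi] by a translation and a reflection, and oddness of the kernel produces the
    difference f(x - y) - f(x + y). *)
Lemma window_HI e f x : 0 < e -> e <= pi -> continuous f -> periodic f (2 * pi) ->
  \int[leb]_(y in `[x + e, x + 2 * pi - e]) (f y * hke e (x - y)) = HI e f x.
Proof.
move=> e0 ep cf pf; have ck := hke_cont e0 ep; have p0 := @pi_gt0 R.
pose G y := f y * hke e (x - y).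
have cG : continuous G by rewrite /G; cts.
have pG : periodic G (2 * pi).
  by move=> y; rewrite /G pf opprD addrA -[hke e (x - y - _)]hke_periodic subrK.
rewrite -/(G _) (@int_split _ G _ _ (x + pi))//; [|lra|lra].
have -> : \int[leb]_(y in `[x + e, x + pi]) G y = \int[leb]_(y in `[e, pi]) (- (f (x + y) * hke e y)).
  rewrite [x + e]addrC [x + pi]addrC -int_shift//; apply: eq_Rintegral => y _.
  by rewrite /G opprD addrCA subrr addr0 hkeN mulrN addrC.
have -> : \int[leb]_(y in `[x + pi, x + 2 * pi - e]) G y = \int[leb]_(y in `[e, pi]) (f (x - y) * hke e y).
  have -> : x + pi = - pi + (x + 2 * pi) by lra.
  have -> : x + 2 * pi - e = - e + (x + 2 * pi) by lra.
  rewrite -(@int_shift _ G) ?lerN2//.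
  rewrite -(@int_opp _ (fun y => G (y + (x + 2 * pi))))//; last by cts.
  apply: eq_Rintegral => y _; rewrite addrA pG /G addrC.
  by congr (_ * hke e _); ring.
rewrite /HI -intD; [|by cts|by cts].
by apply: eq_Rintegral => y _; ring.
Qed.

Lemma pv_domain_shift x e (k : int) : pv_domain (x + 2 * pi * k%:~R) e = pv_domain x e.
Proof.
apply/seteqP; split => y [py H]; split => // l.
  have := H (l + k); rewrite intrD; congr (_ <= `| _ |); ring.
have := H (l - k); rewrite intrD mulrNz; congr (_ <= `| _ |); ring.
Qed.

Lemma int_ge1 (k : int) : 0 < k -> 1 <= k%:~R :> R.
Proof. by move=> k0; rewrite -[1]/(1%:~R) ler_int. Qed.

Lemma pv_domain0 e : 0 < e -> e <= pi -> pv_domain 0 e = `[e, 2 * pi - e]%classic.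
Proof.
move=> e0 ep; have p0 := @twopi_gt0 R; apply/seteqP; split => y; rewrite /pv_domain /period /= !in_itv /=.
  move=> [/andP[y0 y2] H]; have := H 0; have := H (-1).
  have -> : 0 - y - 2 * pi * (-1)%:~R = 2 * pi - y by rewrite mulrNz; ring.
  have -> : 0 - y - 2 * pi * 0%:~R = - y by ring.
  by rewrite normrN !ger0_norm ?subr_ge0// => *; apply/andP; split; lra.
move=> /andP[ey ye]; split; first by apply/andP; split; lra.
move=> k; have [k0|k0|->] := ltgtP k 0.
- have : 0 < - k by rewrite oppr_gt0.
  move=> /int_ge1; rewrite mulrNz => H; rewrite ler_normr; apply/orP; left; nra.
- have := int_ge1 k0 => H; rewrite ler_normr; apply/orP; right; nra.
- by rewrite ler_normr; apply/orP; right; lra.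
Qed.

Lemma pv_domain_mid x e : 0 < e -> e <= x -> x + e <= 2 * pi ->
  pv_domain x e = `[0, x - e]%classic `|` `[x + e, 2 * pi]%classic.
Proof.
move=> e0 ex xe; have p0 := @twopi_gt0 R; apply/seteqP; split => y; rewrite /pv_domain /period /= !in_itv /=.
  move=> [/andP[y0 y2] H]; have := H 0; rewrite mulr0 subr0 ler_normr => /orP[h|h].
    by left; apply/andP; split; lra.
  by right; apply/andP; split; lra.
have H (k : int) : 0 <= y <= 2 * pi -> (y <= x - e) || (x + e <= y) -> e <= `|x - y - 2 * pi * k%:~R|.
  move=> /andP[y0 y2] xy; have [k0|k0|->] := ltgtP k 0.
  - have : 0 < - k by rewrite oppr_gt0.
    move=> /int_ge1; rewrite mulrNz => h; rewrite ler_normr; apply/orP; left; nra.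
  - have := int_ge1 k0 => h; rewrite ler_normr; apply/orP; right; nra.
  - by rewrite mulr0 subr0 ler_normr; case/orP: xy => h; apply/orP; [left|right]; lra.
move=> [] /andP[h1 h2]; (split; [by apply/andP; split; lra|move=> k; apply: H; first by apply/andP; split; lra]).
  by rewrite h2.
by rewrite h1 orbT.
Qed.

Lemma cos_dist_le e t : 0 < e -> e <= pi -> e <= `|t| -> `|t| <= 2 * pi - e -> cos t <= cos e.
Proof.
move=> e0 ep; rewrite -(cos_norm t); have := normr_ge0 t; move: `|t| => z z0 ez z2.
have [zp|zp] := leP z pi; first by rewrite cos_monotone// ltW.
have -> : cos z = cos (2 * pi - z) by rewrite -(cosN z) addrC [2 * pi]mulr_natl cosD2pi.
by rewrite cos_monotone ?(ltW e0)//; lra.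
Qed.

(** At x = 0 the excised period is already such a window. For x inside, the piece left of x is
    translated by 2 pi and joins the piece right of x; [e0] keeps the excised interval inside the
    period. *)
Lemma pv_int_base f x : continuous f -> periodic f (2 * pi) -> 0 <= x -> x < 2 * pi ->
  exists e0, 0 < e0 /\ forall e, 0 < e -> e <= e0 ->
  \int[leb]_(y in pv_domain x e) (f y * cot ((x - y) / 2)) = HI e f x.
Proof.
move=> cf pf x0 x2; have p0 := @pi_gt0 R.
move: x0; rewrite le_eqVlt => /orP[/eqP <-|x0].
  exists pi; split => // e e0 ep; rewrite pv_domain0// -window_HI// add0r add0r.
  apply: eq_Rintegral => y; rewrite inE /= in_itv /= => /andP[y1 y2].
  rewrite cot_half hkeE// cos_dist_le// sub0r normrN ger0_norm//; lra.
exists (Num.min pi (Num.min x (2 * pi - x))); split.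
  by rewrite !lt_min p0 x0 subr_gt0.
move=> e e0; rewrite !le_min => /and3P[ep ex xe].
have xe' : x + e <= 2 * pi by lra.
have ck := hke_cont e0 ep.
rewrite pv_domain_mid// -window_HI//.
pose G y := f y * hke e (x - y).
have cG : continuous G by rewrite /G; cts.
have pG : periodic G (2 * pi).
  by move=> y; rewrite /G pf opprD addrA -[hke e (x - y - _)]hke_periodic subrK.
transitivity (\int[leb]_(y in `[0, x - e]%classic `|` `[x + e, 2 * pi]%classic) G y).
  apply: eq_Rintegral => y; rewrite inE /= !in_itv /= => H.
  rewrite /G cot_half hkeE// cos_dist_le//.
    by rewrite ler_normr; case: H => /andP[h1 h2]; apply/orP; [left|right]; lra.
  by rewrite ler_norml; case: H => /andP[h1 h2]; apply/andP; split; lra.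
rewrite Rintegral_setU//; last 2 first.
- apply: (@integrableS _ _ _ leb `[0, 2 * pi]%classic) (cint 0 (2 * pi) cG) => //; first exact: measurableU.
  by move=> y; rewrite /= !in_itv /= => -[] /andP[h1 h2]; apply/andP; split; lra.
- apply/disj_setPS => y /=; rewrite !in_itv /= => -[/andP[h1 h2] /andP[h3 h4]]; lra.
rewrite -/(G _) (@int_split _ G (x + e) (x + 2 * pi - e) (2 * pi))//; [|lra].
rewrite addrC; congr (_ + _).
have := @int_shift _ G 0 (x - e) (2 * pi) ltac:(lra) cG; rewrite add0r.
have -> : x - e + 2 * pi = x + 2 * pi - e by ring.
by move=> <-; apply: eq_Rintegral => y _; rewrite pG.
Qed.

Lemma pv_int f x : continuous f -> periodic f (2 * pi) ->
  exists e0, 0 < e0 /\ forall e, 0 < e -> e <= e0 ->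
  \int[leb]_(y in pv_domain x e) (f y * cot ((x - y) / 2)) = HI e f x.
Proof.
move=> cf pf; have [k /andP[k1 k2]] := shift_into_period x 0; rewrite add0r in k2.
(* The reduction may land on 2 pi itself; one more period moves it to 0. *)
have [l [l1 l2]] : exists l : int, 0 <= x + 2 * pi * l%:~R /\ x + 2 * pi * l%:~R < 2 * pi.
  move: k2; rewrite le_eqVlt => /orP[/eqP k2|k2]; last by exists k.
  exists (k - 1); rewrite intrD mulrDr mulrNz mulrN1 addrA k2 subrr; split => //.
  exact: twopi_gt0.
have [e0 [e00 H]] := pv_int_base cf pf l1 l2.
exists e0; split => // e ep ee; have := H e ep ee; rewrite pv_domain_shift.
have -> : HI e f (x + 2 * pi * l%:~R) = HI e f x.
  apply: eq_Rintegral => y _; congr ((_ - _) * _).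
    by rewrite addrAC periodic_int.
  by rewrite addrAC periodic_int.
move=> <-; apply: eq_Rintegral => y _; congr (_ * _); rewrite !cot_half.
have -> : x + 2 * pi * l%:~R - y = x - y + 2 * pi * l%:~R by ring.
by rewrite (@periodic_int _ hk)// => z; rewrite /hk [2 * pi]mulr_natl sinD2pi cosD2pi.
Qed.


(** Hoelder continuity and [hk_le] bound the integrand by sqrt (2 y) nrm f * 2 / y. As sqrt 2 <= 3/2
    this is at most 3 nrm f / sqrt y, the derivative of 6 nrm f sqrt y. *)
Lemma HI_tail f x e d : H1per f -> 0 < e -> e <= d -> d <= pi ->
  `|HI e f x - HI d f x| <= 6 * nrm f * (Num.sqrt d - Num.sqrt e).
Proof.
move=> Hf e0 ed dp; have cf := H1per_cont Hf; have ep := le_trans ed dp.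
have d0 : 0 < d by exact: lt_le_trans ed.
have n0 := nrm_ge0 f.
have cI := @HI_cont_integrand e f x e0 ep cf.
have -> : HI e f x - HI d f x = \int[leb]_(y in `[e, d]) ((f (x - y) - f (x + y)) * hke e y).
  rewrite /HI (@int_split _ _ e pi d)//.
  have -> : \int[leb]_(y in `[d, pi]) ((f (x - y) - f (x + y)) * hke d y) =
     \int[leb]_(y in `[d, pi]) ((f (x - y) - f (x + y)) * hke e y).
    apply: eq_Rintegral => y; rewrite inE /= in_itv /= => /andP[y1 y2].
    by rewrite !hkeE_itv// ?(ltW d0) ?(ltW e0)// (le_trans ed).
  by rewrite addrK.
apply: le_trans (le_normr_Rintegral _ _) _; [exact: measurable_itv|exact: cint|].
rewrite mulrBr.
apply: (@int_le_prim R (fun t => `|(f (x - t) - f (x + t)) * hke e t|)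
  (fun y => 6 * nrm f * Num.sqrt y) (fun y => 6 * nrm f * (2 * Num.sqrt y)^-1) e d ed).
- by cts.
- move=> y /andP[ey _]; have y0 : 0 < y by exact: lt_trans ey.
  by have ds := is_derive1_sqrt y0; drv; ring.
- apply: continuous_subspaceT; apply: cfM; first by cts.
  exact: sqrt_continuous.
move=> y /andP[ey yd]; have y0 : 0 < y by exact: lt_trans ey.
have yp : y <= pi by rewrite (le_trans (ltW yd)).
rewrite normrM hkeE_itv ?(ltW e0) ?(ltW ey)// (ger0_norm (hk_ge0 (ltW y0) yp)) distrC.
have h1 : `|f (x + y) - f (x - y)| <= Num.sqrt (2 * y) * nrm f.
  have := @hoelder_nrm _ f (x - y) (x + y) Hf.
  have -> : x + y - (x - y) = 2 * y by ring.
  by apply; lra.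
apply: le_trans (ler_pM _ _ h1 (hk_le y0 yp)) _ => //; first exact: hk_ge0 (ltW y0) yp.
have s0 : 0 < Num.sqrt y by rewrite sqrtr_gt0.
rewrite sqrtrM// -[X in 2 / X](sqr_sqrtr (ltW y0)).
have s2 : Num.sqrt 2 <= 3 / 2 :> R.
  rewrite -(@ler_pXn2r _ 2) ?nnegrE ?sqrtr_ge0// sqr_sqrtr//; lra.
move: (Num.sqrt y) s0 (Num.sqrt 2) s2 => s s0 r r2.
have -> : r * s * nrm f * (2 / s ^+ 2) = 2 * r * (nrm f / s) by field; rewrite gt_eqF.
have -> : 6 * nrm f * (2 * s)^-1 = 3 * (nrm f / s) by field; rewrite gt_eqF.
by rewrite ler_wpM2r ?divr_ge0 ?(ltW s0)//; lra.
Qed.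

(** The intervals around [HI e f x] of radius 6 nrm f sqrt e are nested, so the infimum of their
    upper ends lies in all of them. *)
Lemma HI_limit f x : H1per f -> exists L, forall e, 0 < e -> e <= pi ->
  `|HI e f x - L| <= 6 * nrm f * Num.sqrt e.
Proof.
move=> Hf; pose S := [set t | exists e, [/\ 0 < e, e <= pi & t = HI e f x + 6 * nrm f * Num.sqrt e]].
have p0 := @pi_gt0 R; have n0 : 0 <= 6 * nrm f by rewrite mulr_ge0 ?nrm_ge0.
have lb e : 0 < e -> e <= pi -> lbound S (HI e f x - 6 * nrm f * Num.sqrt e).
  move=> e0 ep t [d [d0 dp ->]].
  have se : 0 <= 6 * nrm f * Num.sqrt e by rewrite mulr_ge0 ?sqrtr_ge0.
  have sd : 0 <= 6 * nrm f * Num.sqrt d by rewrite mulr_ge0 ?sqrtr_ge0.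
  have [ed|/ltW de] := leP e d.
    have := HI_tail x Hf e0 ed dp; rewrite ler_norml mulrBr => /andP[h1 h2]; lra.
  have := HI_tail x Hf d0 de ep; rewrite ler_norml mulrBr => /andP[h1 h2]; lra.
exists (inf S) => e e0 ep; have Se : S (HI e f x + 6 * nrm f * Num.sqrt e) by exists e.
have hl : has_lbound S by exists (HI e f x - 6 * nrm f * Num.sqrt e); exact: lb.
have h1 := ge_inf hl Se.
have h2 : HI e f x - 6 * nrm f * Num.sqrt e <= inf S.
  by apply: lb_le_inf; [exists (HI e f x + 6 * nrm f * Num.sqrt e)|exact: lb].
by rewrite ler_norml; apply/andP; split; lra.
Qed.

Lemma sqrt_small (c e : R) : 0 <= c -> 0 < e ->
  exists d, [/\ 0 < d, d <= pi & forall s, 0 < s -> s <= d -> c * Num.sqrt s <= e].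
Proof.
move=> c0 e0; have c1 : 0 < c + 1 by rewrite ltr_wpDl.
exists (Num.min pi ((e / (c + 1)) ^+ 2)); split.
- by rewrite lt_min pi_gt0 exprn_gt0// divr_gt0.
- by rewrite ge_min lexx.
move=> s s0; rewrite le_min => /andP[_ h].
have : Num.sqrt s <= e / (c + 1).
  by rewrite -(@ler_pXn2r _ 2) ?nnegrE ?sqrtr_ge0 ?divr_ge0 ?(ltW e0) ?(ltW c1)// sqr_sqrtr ?(ltW s0).
rewrite ler_pdivlMr// mulrDr mulr1 mulrC => H.
by have := sqrtr_ge0 s; lra.
Qed.

(** Turns identities for the cut-off transform, with errors O(sqrt e), into identities for [hil]. *)
Lemma zero_of_sqrt_bound (X c : R) : 0 <= c ->
  (forall e, 0 < e -> e <= pi -> `|X| <= c * Num.sqrt e) -> X = 0.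
Proof.
move=> c0 H; apply/eqP; rewrite -normr_le0; apply/ler_addgt0Pl => e e0; rewrite addr0.
have [d [d0 dp Hd]] := sqrt_small c0 e0.
exact: le_trans (H d d0 dp) (Hd d d0 (lexx _)).
Qed.

Definition hil f : R -> R := locked (@hilbert R) f.
Lemma hilE f : hil f = hilbert f. Proof. by rewrite /hil -lock. Qed.

(** The constant is 6 / (2 pi) rounded up to 2. The bound is uniform in x, so it may be
    integrated. *)
Lemma hil_rate f x e : H1per f -> 0 < e -> e <= pi ->
  `|hil f x - (2 * pi)^-1 * HI e f x| <= 2 * nrm f * Num.sqrt e.
Proof.
move=> Hf e0 ep; have [L HL] := HI_limit x Hf.
have [e1 [e10 He1]] := pv_int x (H1per_cont Hf) (H1per_periodic Hf).
have n0 : 0 <= 6 * nrm f by rewrite mulr_ge0 ?nrm_ge0.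
have -> : hil f x = (2 * pi)^-1 * L.
  rewrite hilE /hilbert; congr (_ * _); apply: cvg_lim; first exact: Rhausdorff.
  apply/cvgrPdist_le => eps eps0.
  have [d [d0 dp Hd]] := sqrt_small n0 eps0.
  near=> s.
  have s0 : 0 < s by near: s; exact: nbhs_right_gt.
  have s1 : s <= e1 by near: s; exact: nbhs_right_le.
  have sd : s <= d by near: s; exact: nbhs_right_le.
  by rewrite He1// distrC (le_trans (HL s s0 (le_trans sd dp)))// Hd.
have p2 := @pi_ge2 R; have p0 := @twopi_gt0 R.
rewrite -mulrBr normrM distrC ger0_norm ?invr_ge0 ?(ltW p0)// ler_pdivrMl//.
apply: le_trans (HL e e0 ep) _.
have := mulr_ge0 (nrm_ge0 f) (sqrtr_ge0 e); move: (nrm f) (Num.sqrt e) => a b ab; nra.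
Unshelve. all: by end_near. Qed.

Lemma HI_D e f g x : 0 < e -> e <= pi -> continuous f -> continuous g ->
  HI e (fun y => f y + g y) x = HI e f x + HI e g x.
Proof.
move=> e0 ep cf cg; rewrite /HI -intD; [|exact: HI_cont_integrand..].
by apply: eq_Rintegral => y _; ring.
Qed.

Lemma HI_Z e k f x : 0 < e -> e <= pi -> continuous f ->
  HI e (fun y => k * f y) x = k * HI e f x.
Proof.
move=> e0 ep cf; rewrite /HI -intZ; last exact: HI_cont_integrand.
by apply: eq_Rintegral => y _; ring.
Qed.

Lemma hil_D f g x : H1per f -> H1per g -> hil (fun y => f y + g y) x = hil f x + hil g x.
Proof.
move=> Hf Hg; have [Hs _] := H1_add Hf Hg.
have c0 : 0 <= 2 * nrm (fun y => f y + g y) + 2 * nrm f + 2 * nrm g.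
  by rewrite !addr_ge0// mulr_ge0// nrm_ge0.
apply/eqP; rewrite -subr_eq0; apply/eqP; apply: (zero_of_sqrt_bound c0) => e e0 ep.
have := hil_rate x Hs e0 ep; have := hil_rate x Hf e0 ep; have := hil_rate x Hg e0 ep.
rewrite HI_D//; [|exact: H1per_cont..].
rewrite !ler_norml !mulrDl !mulrDr; move=> /andP[a1 a2] /andP[b1 b2] /andP[c1 c2].
by apply/andP; split; lra.
Qed.

Lemma hil_Z k f x : H1per f -> hil (fun y => k * f y) x = k * hil f x.
Proof.
move=> Hf; have [Hs _] := H1_scale k Hf.
have c0 : 0 <= 2 * nrm (fun y => k * f y) + `|k| * (2 * nrm f).
  by rewrite !addr_ge0// !mulr_ge0// nrm_ge0.
apply/eqP; rewrite -subr_eq0; apply/eqP; apply: (zero_of_sqrt_bound c0) => e e0 ep.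
have h1 := hil_rate x Hs e0 ep; have h2 := hil_rate x Hf e0 ep.
rewrite HI_Z// in h1; last exact: H1per_cont.
have -> : hil (fun y => k * f y) x - k * hil f x =
  (hil (fun y => k * f y) x - (2 * pi)^-1 * (k * HI e f x)) - k * (hil f x - (2 * pi)^-1 * HI e f x) by ring.
apply: le_trans (ler_normB _ _) _; rewrite [leRHS]mulrDl lerD// normrM -mulrA ler_wpM2l//.
Qed.

Lemma hil_B f g x : H1per f -> H1per g -> hil (fun y => f y - g y) x = hil f x - hil g x.
Proof.
move=> Hf Hg; have [Hk _] := H1_scale (-1) Hg.
have -> : (fun y => f y - g y) = (fun y => f y + -1 * g y).
  by apply/funext => y; rewrite mulN1r.
by rewrite hil_D// hil_Z// mulN1r.
Qed.

Definition dir_sum n t : R := \sum_(k < n) (cosn k.+1 t + cosn k t).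

Lemma dir_sum_cont n : continuous (dir_sum n).
Proof. by rewrite /dir_sum; cts. Qed.

(* sin(nt) cot(t/2) = 1 + 2 cos t + ... + 2 cos((n-1)t) + cos(nt) *)
Lemma sinn_hk n t : 0 < t -> t <= pi -> sinn n t * hk t = dir_sum n t.
Proof.
move=> t0 tp; have c1 : 1 - cos t != 0 by rewrite gt_eqF// subr_gt0 cos_lt1.
elim: n => [|n IH]; first by rewrite /dir_sum big_ord0 sin0n mul0r.
rewrite /dir_sum big_ord_recr /= -/(dir_sum n t) -IH.
suff : (sinn n.+1 t - sinn n t) * hk t = cosn n.+1 t + cosn n t by rewrite mulrBl; lra.
rewrite /sinn /cosn; have -> : n.+1%:R * t = n%:R * t + t by rewrite -natr1 mulrDl mul1r.
rewrite sinD cosD /hk.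
have := cos2Dsin2 t; move: (sin (n%:R * t)) (cos (n%:R * t)) (sin t) (cos t) c1 => S C s c c1 cs.
rewrite mulrA; apply: (mulIf c1); rewrite divfK//.
have -> : (S * c + C * s - S) * s = S * c * s + C * s ^+ 2 - S * s by ring.
have -> : s ^+ 2 = 1 - c ^+ 2 by rewrite -cs addrAC subrr add0r.
by ring.
Qed.

Lemma int_cosn_half n : \int[leb]_(t in `[0, pi]) cosn n t = if n == 0%N then pi else 0 :> R.
Proof.
have p0 := @pi_ge0 R; case: eqP => [->|/eqP n0].
  under eq_Rintegral do rewrite cos0n.
  by rewrite int_cst// subr0 mul1r.
have n0' : n%:R != 0 :> R by rewrite pnatr_eq0.
have d x : is_derive x 1 (fun x => n%:R^-1 * sinn n x) (cosn n x).
  by have d := sinn_derive n x; drv; rewrite mulr0 addr0 mulrA mulVf ?mul1r.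
rewrite (int_prim p0 (@cosn_cont R n) d) sinn0.
have -> : sinn n pi = 0 :> R; last by rewrite mulr0 subrr.
rewrite /sinn mulrC mulr_natr; elim: n {n0 n0' d} => [|n IH]; first by rewrite mulr0n sin0.
by rewrite mulrSr sinDpi IH oppr0.
Qed.

Lemma int_dir_sum n : \int[leb]_(t in `[0, pi]) dir_sum n t = if n == 0%N then 0 else pi :> R.
Proof.
rewrite /dir_sum (@int_sum _ n (fun k t => cosn k.+1 t + cosn k t)); last by move=> k; cts.
case: n => [|n]; first by rewrite big_ord0.
rewrite big_ord_recl /= big1 ?addr0 => [|k _].
  by rewrite intD ?int_cosn_half ?add0r//; cts.
by rewrite intD ?int_cosn_half ?add0r//; cts.
Qed.

(** If the odd part of f around x is a pure sine, its product with the kernel is a sum of cosines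
    whose integral over [0, pi] is pi for n > 0. The missing part [0, e] is O(e), hence O(sqrt e)
    because e <= pi <= 4. *)
Lemma hil_basis n (a : R) f x : H1per f ->
  (forall y, f (x - y) - f (x + y) = 2 * a * sinn n y) ->
  hil f x = if n == 0%N then 0 else a.
Proof.
move=> Hf fE; have cd := @dir_sum_cont n; have p0 := @pi_gt0 R.
set J := if n == 0%N then 0 else pi : R.
have -> : (if n == 0%N then 0 else a) = (2 * pi)^-1 * (2 * a * J).
  rewrite /J; case: eqP => _; first by rewrite !mulr0.
  by move: (pi : R) p0 => p p0; field; rewrite gt_eqF.
have c0 : 0 <= 2 * nrm f + `|a| * (2 * n%:R) * 2.
  by rewrite addr_ge0 ?mulr_ge0 ?nrm_ge0 ?ler0n.
apply/eqP; rewrite -subr_eq0; apply/eqP; apply: (zero_of_sqrt_bound c0) => e e0 ep.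
have HIE : HI e f x = 2 * a * (J - \int[leb]_(t in `[0, e]) dir_sum n t).
  rewrite /J -int_dir_sum (@int_split _ _ 0 pi e) ?(ltW e0)// addrAC subrr add0r -intZ//.
  apply: eq_Rintegral => y; rewrite inE /= in_itv /= => /andP[ey yp].
  by rewrite fE -mulrA hkeE_itv ?(ltW e0)// sinn_hk// (lt_le_trans e0).
have bd : `|\int[leb]_(t in `[0, e]) dir_sum n t| <= 2 * n%:R * e.
  rewrite -[X in _ * X]subr0; apply: int_abs_le => //; first exact: ltW.
  move=> t _; rewrite /dir_sum; apply: le_trans (ler_norm_sum _ _ _) _.
  apply: (@le_trans _ _ (\sum_(k < n) 2)); last by rewrite sumr_const card_ord mulr_natr.
  apply: ler_sum => k _; apply: le_trans (ler_normD _ _) _.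
  by rewrite -[2]/(1 + 1) lerD// cosn_le1.
have := hil_rate x Hf e0 ep; rewrite HIE.
set I := \int[leb]_(t in `[0, e]) _ in bd *.
have -> : hil f x - (2 * pi)^-1 * (2 * a * (J - I)) =
  (hil f x - (2 * pi)^-1 * (2 * a * J)) + (2 * pi)^-1 * (2 * a * I) by ring.
set X := hil f x - _ => HX.
have : `|(2 * pi)^-1 * (2 * a * I)| <= `|a| * (2 * n%:R) * e.
  have p2 : (2 * pi)^-1 * 2 <= 1 :> R.
    by rewrite mulrC ler_pdivrMr ?twopi_gt0// mul1r; have := @pi_ge2 R; lra.
  have -> : (2 * pi)^-1 * (2 * a * I) = ((2 * pi)^-1 * 2) * (a * I) by ring.
  have aI : `|a * I| <= `|a| * (2 * n%:R) * e by rewrite normrM -mulrA ler_wpM2l.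
  have pI : `|(2 * pi)^-1 * 2 : R| <= 1 by rewrite ger0_norm// mulr_ge0// invr_ge0 twopi_ge0.
  by rewrite normrM -[leRHS]mul1r ler_pM.
set Y := (2 * pi)^-1 * _ => HY.
have e2 : e <= 2 * Num.sqrt e.
  rewrite -{1}(sqr_sqrtr (ltW e0)) expr2 ler_wpM2r ?sqrtr_ge0//.
  rewrite -(@ler_pXn2r _ 2) ?nnegrE ?sqrtr_ge0// sqr_sqrtr ?(ltW e0)//.
  by rewrite (le_trans ep)// (le_trans pi_le4)//; lra.
have -> : X = (X + Y) - Y by ring.
apply: le_trans (ler_normB _ _) _; rewrite [leRHS]mulrDl lerD//.
by apply: le_trans HY _; rewrite -[leRHS]mulrA ler_wpM2l// mulr_ge0// mulr_ge0.
Qed.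

Lemma hil_tp N (al be : nat -> R) x : be 0%N = 0 ->
  hil (tp N al be) x = tp N (fun n => - be n) al x.
Proof.
move=> be0; elim: N => [|N IH].
  (* The empty sum is written as a multiple of an H^1 function so that homogeneity gives its
     transform. *)
  have E : tp 0 al be = (fun y => 0 * tp 0 al be y) by apply/funext => y; rewrite mul0r /tp big_ord0.
  by rewrite E hil_Z ?mul0r; [rewrite /tp big_ord0|exact: H1per_tp].
pose t y := kap N * (al N * cosn N y + be N * sinn N y).
have E : tp N.+1 al be = (fun y => tp N al be y + t y).
  by apply/funext => y; rewrite /tp big_ord_recr.
have Ht : H1per t.
  have -> : t = (fun y => tp N.+1 al be y - tp N al be y) by apply/funext => y; rewrite E addrAC subrr add0r.
  by have [] := H1_sub (@H1per_tp _ N.+1 al be) (@H1per_tp _ N al be).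
rewrite E hil_D//; [|exact: H1per_tp].
rewrite IH [RHS]/tp big_ord_recr /= -/(tp _ _ _ _); congr (_ + _).
rewrite (@hil_basis N (kap N * (- be N * cosn N x + al N * sinn N x)))//.
  by case: eqP => // ->; rewrite be0 sin0n; ring.
move=> y; rewrite /t /cosn /sinn (mulrBr N%:R) (mulrDr N%:R) !cosB !sinB !cosD !sinD.
by ring.
Qed.

(** The transform is not bounded in the sup norm. With H^1 norms under control one fixes [e] first,
    for the singular part, and then takes [d] small, the kernel being at most 2 / e beyond the
    cut-off. *)
Lemma hil_uniform f g d e x : H1per f -> H1per g -> 0 < e -> e <= pi ->
  (forall y, `|f y - g y| <= d) ->
  `|hil f x - hil g x| <= 2 * (nrm f + nrm g) * Num.sqrt e + 4 / e * d.
Proof.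
move=> Hf Hg e0 ep fg; have [Hd nd] := H1_sub Hf Hg.
have cf := H1per_cont Hf; have cg := H1per_cont Hg.
rewrite -hil_B//.
have := hil_rate x Hd e0 ep; set X := hil _ x; set Y := (2 * pi)^-1 * _ => XY.
have HY : `|Y| <= 4 / e * d.
  have p0 := @twopi_gt0 R.
  rewrite /Y normrM ger0_norm ?invr_ge0 ?(ltW p0)// ler_pdivrMl//.
  apply: (@le_trans _ _ (2 * d * (2 / e) * (pi - e))).
    apply: int_abs_le => //; first by apply: (@HI_cont_integrand e (fun y => f y - g y)) => //; cts.
    move=> y /andP[ey yp]; have y0 := lt_le_trans e0 ey.
    rewrite normrM ler_pM//.
      by apply: le_trans (ler_normB _ _) _; rewrite mulr_natl mulr2n lerD.
    rewrite hkeE_itv ?(ltW e0)// ger0_norm ?hk_ge0 ?(ltW y0)//.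
    by apply: le_trans (hk_le y0 yp) _; rewrite ler_wpM2l// lef_pV2 ?posrE.
  have d0 : 0 <= d by apply: le_trans (fg 0).
  have ie : 0 <= e^-1 by rewrite invr_ge0 ltW.
  have := mulr_ge0 d0 ie; move: (e^-1) (pi : R) p0 ep => i p p0 ep di.
  have -> : 2 * d * (2 * i) * (p - e) = 4 * (d * i) * (p - e) by ring.
  have -> : 2 * p * (4 * i * d) = 4 * (d * i) * (2 * p) by ring.
  by apply: ler_wpM2l; [exact: mulr_ge0|lra].
have -> : X = (X - Y) + Y by ring.
apply: le_trans (ler_normD _ _) _; rewrite lerD//.
by apply: le_trans XY _; rewrite ler_wpM2r ?sqrtr_ge0// ler_wpM2l.
Qed.

Lemma nrm_hil_sigma f N : H1per f ->
  H1per (hil (sigma N f)) /\ nrm (hil (sigma N f)) <= nrm f.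
Proof.
move=> Hf.
have -> : hil (sigma N f) = tp N (fun n => - (fejer_weight N n * cb f n)) (fun n => fejer_weight N n * ca f n).
  by apply/funext => x; rewrite /sigma hil_tp// cb0 mulr0.
split; first exact: H1per_tp.
apply: nrm_of_b1 => [||m]; [exact: H1per_tp|exact: nrm_ge0|].
apply: le_trans (b1_le m Hf); apply: b1_le_coef => n.
have w (a : R) : (n < N)%N -> (fejer_weight N n * a) ^+ 2 <= a ^+ 2.
  move=> nN; rewrite exprMn ler_piMl ?sqr_ge0// expr_le1// ?fejer_weight_ge0//.
  exact: fejer_weight_le1.
rewrite ca_tp cb_tp; case: ifP => nN /=; last by rewrite expr0n addr0 addr_ge0 ?sqr_ge0.
by rewrite sqrrN addrC; case: ifP => _; rewrite lerD ?w// expr0n sqr_ge0.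
Qed.

(** On Fejer means the transform only exchanges sine and cosine coefficients up to sign and kills
    the mean; [hil_uniform] and closedness of balls extend the bound to H^1. *)
Lemma hil_H1 f : H1per f -> H1per (hil f) /\ nrm (hil f) <= nrm f.
Proof.
move=> Hf; apply: H1_closed => [|eps eps0]; first exact: nrm_ge0.
have n0 := nrm_ge0 f.
have e20 : 0 < eps / 2 by rewrite divr_gt0.
have c0 : 0 <= 2 * (nrm f + nrm f) by rewrite mulr_ge0// addr_ge0.
have [e [e0 ep He]] := sqrt_small c0 e20.
have d0 : 0 < e * eps / 8 by rewrite divr_gt0// mulr_gt0.
have [N [nN fN]] := trig_approx Hf d0.
have [H1 H2] := nrm_hil_sigma N Hf.
exists (hil (sigma N f)); split => // x.
have Hs : H1per (sigma N f) by exact: H1per_tp.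
apply: le_trans (hil_uniform x Hf Hs e0 ep fN) _.
have -> : 4 / e * (e * eps / 8) = eps / 2 by field; rewrite gt_eqF.
rewrite [leRHS]splitr lerD2r; apply: le_trans (He e e0 (lexx _)).
by rewrite ler_wpM2r ?sqrtr_ge0// ler_wpM2l// lerD2l.
Qed.

End HilbertTransform.

(** * Continuously differentiable curves in H^1 *)

Section SobolevCurves.
Context {R : realType}.
Implicit Types (f g h : R -> R) (x s t e d k : R) (D : set R) (w : R -> R -> R).

Lemma is_derive_eps (f : R -> R) t l :
  (forall e, 0 < e -> exists d, 0 < d /\ forall s, `|s - t| < d -> `|f s - f t - (s - t) * l| <= e * `|s - t|) ->
  is_derive t 1 f l.
Proof.
move=> H.
have Hc : (fun h : R => h^-1 *: ((f \o shift t) (h *: (1 : R)) - f t)) @ 0^' --> l.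
  apply/cvgrPdist_le => e e0; have [d [d0 Hd]] := H e e0.
  exists d => //= h; rewrite /ball_ /= sub0r normrN => hd h0.
  have := Hd (h + t); rewrite addrK => /(_ hd) /= h1.
  have -> : h *: (1 : R) = h by rewrite /GRing.scale /= mulr1.
  rewrite /GRing.scale /= distrC -(ler_pM2r (_ : 0 < `|h|)) ?normr_gt0//.
  by rewrite -normrM mulrBl mulrAC mulVf// mul1r [l * h]mulrC.
by apply: DeriveDef; [exact: cvgP Hc|exact: cvg_lim Hc].
Qed.

(** The epsilon-delta form of [C1H1_deriv] on an arbitrary set of times, with the quotient
    multiplied out so that s = t is no exception. *)
Definition curve D w (w' : R -> R -> R) : Prop :=
  [/\ forall t, D t -> H1per (w t) /\ H1per (w' t),
      forall t e, D t -> 0 < e -> exists d, 0 < d /\ forall s, D s -> `|s - t| < d ->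
        nrm (fun x => w s x - w t x - (s - t) * w' t x) <= e * `|s - t|
    & forall t e, D t -> 0 < e -> exists d, 0 < d /\ forall s, D s -> `|s - t| < d ->
        nrm (fun x => w' s x - w' t x) <= e].

Lemma nrm_Zeq k f : H1per f -> nrm (fun x => k * f x) = `|k| * nrm f.
Proof.
move=> Hf; apply/eqP; rewrite eq_le; have [Hk ->] := H1_scale k Hf.
have [->|k0] := eqVneq k 0; first by rewrite normr0 mul0r nrm_ge0.
have [_] := H1_scale k^-1 Hk.
have -> : (fun x => k^-1 * (k * f x)) = f by apply/funext => x; rewrite mulKf.
by rewrite normfV -ler_pdivrMl ?invr_gt0 ?normr_gt0// invrK.
Qed.

Lemma nrm0 : nrm (fun _ : R => 0 : R) = 0.
Proof.
have H1 : H1per (fun _ : R => 1 : R).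
  have [] // := @H1per_C1 R (fun _ => 1) (fun _ => 0) (fun x => dcst 1 x).
  by cts.
by have := nrm_Zeq 0 H1; rewrite normr0 !mul0r.
Qed.

Lemma curveP (T : \bar R) w w' : C1H1_deriv T w w' <-> curve (Ico0 T) w w'.
Proof.
have Hq s t : H1per (w s) -> H1per (w t) -> H1per (w' t) ->
    H1per (fun x => w s x - w t x - (s - t) * w' t x).
  move=> h1 h2 h3; have [a _] := H1_sub h1 h2; have [b _] := H1_scale (s - t) h3.
  by have [] := H1_sub a b.
have E s t : s != t -> H1per (w s) -> H1per (w t) -> H1per (w' t) ->
   H1norm ((s - t)^-1 *: (w s - w t) - w' t) =
   `|s - t|^-1 * nrm (fun x => w s x - w t x - (s - t) * w' t x).
  move=> st h1 h2 h3; rewrite -normfV -nrm_Zeq; last exact: Hq.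
  rewrite nrmE; congr H1norm; apply/funext => x /=.
  rewrite [LHS]/(_ - _) /GRing.scale /= mulrBr mulKf ?subr_eq0//.
split=> -[H1 H2 H3]; split.
- exact: H1.
- move=> t e Dt e0; have /cvgrPdist_le /(_ e e0) [d /= d0 Hd] := H2 t Dt.
  exists d; split => // s Ds st; have [->|sne] := eqVneq s t.
    rewrite subrr normr0 mulr0; have -> : (fun x => w t x - w t x - 0 * w' t x) = (fun=> 0).
      by apply/funext => x; rewrite subrr mul0r subrr.
    by rewrite nrm0.
  have [h1 _] := H1 s Ds; have [h2 h3] := H1 t Dt.
  have := Hd s; rewrite /ball_ /= distrC => /(_ st sne Ds).
  rewrite sub0r normrN ger0_norm ?sqrtr_ge0// E//.
  by rewrite ler_pdivrMl ?normr_gt0 ?subr_eq0// mulrC.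
- move=> t e Dt e0; have /cvgrPdist_le /(_ e e0) [d /= d0 Hd] := H3 t Dt.
  exists d; split => // s Ds st; have := Hd s; rewrite /ball_ /= distrC => /(_ st Ds).
  by rewrite sub0r normrN ger0_norm ?sqrtr_ge0// nrmE.
- exact: H1.
- move=> t Dt; apply/cvgrPdist_le => e e0; have [d [d0 Hd]] := H2 t e Dt e0.
  exists d => //= s; rewrite /ball_ /= distrC => st sne Ds.
  have [h1 _] := H1 s Ds; have [h2 h3] := H1 t Dt.
  rewrite sub0r normrN ger0_norm ?sqrtr_ge0// E//.
  by rewrite ler_pdivrMl ?normr_gt0 ?subr_eq0// mulrC; exact: Hd.
- move=> t Dt; apply/cvgrPdist_le => e e0; have [d [d0 Hd]] := H3 t e Dt e0.
  exists d => //= s; rewrite /ball_ /= distrC => st Ds.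
  by rewrite sub0r normrN ger0_norm ?sqrtr_ge0// -nrmE; exact: Hd.
Qed.

Lemma curve_lipschitz D w w' t : curve D w w' -> D t ->
  exists K d, [/\ 0 <= K, 0 < d & forall s, D s -> `|s - t| < d ->
    nrm (fun x => w s x - w t x) <= K * `|s - t|].
Proof.
move=> [H1 H2 _] Dt; have [d [d0 Hd]] := H2 t 1 Dt ltr01.
have [h2 h3] := H1 t Dt.
exists (1 + nrm (w' t)), d; split => //; first by rewrite addr_ge0 ?nrm_ge0.
move=> s Ds st; have [h1 _] := H1 s Ds.
have [a _] := H1_sub h1 h2; have [b _] := H1_scale (s - t) h3; have [c _] := H1_sub a b.
have [_] := H1_add c b.
have -> : (fun x => w s x - w t x - (s - t) * w' t x + (s - t) * w' t x) = (fun x => w s x - w t x).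
  by apply/funext => x; rewrite subrK.
move=> h; apply: le_trans h _; rewrite mulrDl lerD ?Hd// mulrC.
by rewrite nrm_Zeq.
Qed.

Lemma curve_continuous D w w' t e : curve D w w' -> D t -> 0 < e ->
  exists d, 0 < d /\ forall s, D s -> `|s - t| < d -> nrm (fun x => w s x - w t x) <= e.
Proof.
move=> cw Dt e0; have [K [d [K0 d0 H]]] := curve_lipschitz cw Dt.
have K1 : 0 < K + 1 by rewrite ltr_wpDl.
exists (Num.min d (e / (K + 1))); split; first by rewrite lt_min d0 divr_gt0.
move=> s Ds; rewrite lt_min => /andP[s1 s2]; apply: le_trans (H s Ds s1) _.
move: s2; rewrite ltr_pdivlMr// mulrDr mulr1 mulrC => s2; have := normr_ge0 (s - t); lra.
Qed.

Lemma nrm_add3 f g h : H1per f -> H1per g -> H1per h ->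
  H1per (fun x => f x + g x + h x) /\ nrm (fun x => f x + g x + h x) <= nrm f + nrm g + nrm h.
Proof.
move=> Hf Hg Hh; have [a na] := H1_add Hf Hg; have [b nb] := H1_add a Hh.
by split => //; apply: le_trans nb _; rewrite lerD2r.
Qed.

Lemma curve_mul D u u' v v' : curve D u u' -> curve D v v' ->
  curve D (fun t x => u t x * v t x) (fun t x => u' t x * v t x + u t x * v' t x).
Proof.
move=> cu cv; have [U1 U2 U3] := cu; have [V1 V2 V3] := cv; split.
- move=> t Dt; have [a1 a2] := U1 t Dt; have [b1 b2] := V1 t Dt.
  split; first by have [] := H1_mul a1 b1.
  by have [p _] := H1_mul a2 b1; have [q _] := H1_mul a1 b2; have [] := H1_add p q.
- move=> t e Dt e0; have [a1 a2] := U1 t Dt; have [b1 b2] := V1 t Dt.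
  set A := nrm (u t); set A' := nrm (u' t); set B := nrm (v t); set B' := nrm (v' t).
  have A0 : 0 <= A by exact: nrm_ge0. have A'0 : 0 <= A' by exact: nrm_ge0.
  have B0 : 0 <= B by exact: nrm_ge0.
  (* One summand for each term of the Leibniz decomposition below, estimated by [H1_mul]; B + 1
     bounds v(s) near t. *)
  pose C := 10 * (B + 1) + 10 * A + 10 * A' + 1.
  have C0 : 0 < C by rewrite /C; lra.
  have eC : 0 < e / C by rewrite divr_gt0.
  have [d1 [d10 H1]] := U2 t _ Dt eC; have [d2 [d20 H2]] := V2 t _ Dt eC.
  have [d3 [d30 H3]] := curve_continuous cv Dt eC.
  have [d4 [d40 H4]] := curve_continuous cv Dt ltr01.
  exists (Num.min (Num.min d1 d2) (Num.min d3 d4)); split; first by rewrite !lt_min d10 d20 d30 d40.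
  move=> s Ds; rewrite !lt_min => /andP[/andP[s1 s2] /andP[s3 s4]].
  have [c1 _] := U1 s Ds; have [e1 _] := V1 s Ds.
  have {}H1 := H1 s Ds s1; have {}H2 := H2 s Ds s2; have {}H3 := H3 s Ds s3; have {}H4 := H4 s Ds s4.
  have [P1 _] := H1_sub c1 a1; have [P2 _] := H1_scale (s - t) a2; have [P _] := H1_sub P1 P2.
  have [Q1 _] := H1_sub e1 b1; have [Q2 _] := H1_scale (s - t) b2; have [Q _] := H1_sub Q1 Q2.
  have nv : nrm (v s) <= B + 1.
    have [_] := H1_add Q1 b1; have -> : (fun x => v s x - v t x + v t x) = v s by apply/funext => x; rewrite subrK.
    by move=> h; apply: le_trans h _; rewrite addrC lerD2l.
  have [M1 N1] := H1_mul P e1; have [M2 N2] := H1_mul a1 Q; have [M3' N3] := H1_mul a2 Q1.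
  have [M3 _] := H1_scale (s - t) M3'.
  have [_ nN] := nrm_add3 M1 M2 M3.
  have -> : (fun x => u s x * v s x - u t x * v t x - (s - t) * (u' t x * v t x + u t x * v' t x)) =
    (fun x => (u s x - u t x - (s - t) * u' t x) * v s x +
       u t x * (v s x - v t x - (s - t) * v' t x) + (s - t) * (u' t x * (v s x - v t x))).
    by apply/funext => x; ring.
  apply: le_trans nN _; rewrite nrm_Zeq//.
  set r := `|s - t| in H1 H2 *; have r0 : 0 <= r by exact: normr_ge0.
  have er : 0 <= e / C * r by rewrite mulr_ge0// ltW.
  have t1 : nrm (fun x => (u s x - u t x - (s - t) * u' t x) * v s x) <= 10 * (e / C * r) * (B + 1).
    apply: le_trans N1 _; rewrite ler_pM ?mulr_ge0 ?nrm_ge0// ler_wpM2l//.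
  have t2 : nrm (fun x => u t x * (v s x - v t x - (s - t) * v' t x)) <= 10 * A * (e / C * r).
    by apply: le_trans N2 _; rewrite ler_wpM2l// mulr_ge0.
  have t3 : r * nrm (fun x => u' t x * (v s x - v t x)) <= r * (10 * A' * (e / C)).
    rewrite ler_wpM2l//; apply: le_trans N3 _; rewrite ler_wpM2l// mulr_ge0//.
  have eE : e = C * (e / C) by rewrite mulrC divfK ?gt_eqF.
  apply: le_trans (lerD (lerD t1 t2) t3) _; rewrite [in leRHS]eE.
  move: (e / C) er; rewrite /C => q qr.
  have -> : (10 * (B + 1) + 10 * A + 10 * A' + 1) * q * r =
    10 * (q * r) * (B + 1) + 10 * A * (q * r) + r * (10 * A' * q) + q * r by ring.
  by rewrite lerDl.
- move=> t e Dt e0; have [a1 a2] := U1 t Dt; have [b1 b2] := V1 t Dt.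
  set A := nrm (u t); set A' := nrm (u' t); set B := nrm (v t); set B' := nrm (v' t).
  have A0 : 0 <= A by exact: nrm_ge0. have A'0 : 0 <= A' by exact: nrm_ge0.
  have B0 : 0 <= B by exact: nrm_ge0. have B'0 : 0 <= B' by exact: nrm_ge0.
  pose C := 10 * (B + 1) + 10 * A' + 10 * (B' + 1) + 10 * A + 1.
  have C0 : 0 < C by rewrite /C; lra.
  have eC : 0 < e / C by rewrite divr_gt0.
  have [d1 [d10 H1]] := U3 t _ Dt eC; have [d2 [d20 H2]] := V3 t _ Dt eC.
  have [d3 [d30 H3]] := curve_continuous cv Dt eC.
  have [d4 [d40 H4]] := curve_continuous cv Dt ltr01.
  have [d5 [d50 H5]] := curve_continuous cu Dt eC.
  have [d6 [d60 H6]] := V3 t _ Dt ltr01.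
  exists (Num.min (Num.min (Num.min d1 d2) (Num.min d3 d4)) (Num.min d5 d6)); split.
    by rewrite !lt_min d10 d20 d30 d40 d50.
  move=> s Ds; rewrite !lt_min => /andP[/andP[/andP[s1 s2] /andP[s3 s4]] /andP[s5 s6]].
  have [c1 c2] := U1 s Ds; have [e1 e2] := V1 s Ds.
  have {}H1 := H1 s Ds s1; have {}H2 := H2 s Ds s2; have {}H3 := H3 s Ds s3; have {}H4 := H4 s Ds s4.
  have {}H5 := H5 s Ds s5; have {}H6 := H6 s Ds s6.
  have [P1 _] := H1_sub c1 a1; have [P2 _] := H1_sub c2 a2.
  have [Q1 _] := H1_sub e1 b1; have [Q2 _] := H1_sub e2 b2.
  have nv : nrm (v s) <= B + 1.
    have [_] := H1_add Q1 b1; have -> : (fun x => v s x - v t x + v t x) = v s by apply/funext => x; rewrite subrK.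
    by move=> h; apply: le_trans h _; rewrite addrC lerD2l.
  have nv' : nrm (v' s) <= B' + 1.
    have [_] := H1_add Q2 b2; have -> : (fun x => v' s x - v' t x + v' t x) = v' s by apply/funext => x; rewrite subrK.
    by move=> h; apply: le_trans h _; rewrite addrC lerD2l.
  have [M1 N1] := H1_mul P2 e1; have [M2 N2] := H1_mul a2 Q1; have [M3 N3] := H1_mul P1 e2.
  have [M4 N4] := H1_mul a1 Q2.
  have [M5 N5] := nrm_add3 M1 M2 M3; have [_ nN] := H1_add M5 M4.
  have -> : (fun x => u' s x * v s x + u s x * v' s x - (u' t x * v t x + u t x * v' t x)) =
    (fun x => (u' s x - u' t x) * v s x + u' t x * (v s x - v t x) + (u s x - u t x) * v' s x +
       u t x * (v' s x - v' t x)).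
    by apply/funext => x; ring.
  have eC0 := ltW eC.
  have t1 : nrm (fun x => (u' s x - u' t x) * v s x) <= 10 * (e / C) * (B + 1).
    apply: le_trans N1 _; rewrite ler_pM ?mulr_ge0 ?nrm_ge0// ler_wpM2l//.
  have t2 : nrm (fun x => u' t x * (v s x - v t x)) <= 10 * A' * (e / C).
    by apply: le_trans N2 _; rewrite ler_wpM2l// mulr_ge0.
  have t3 : nrm (fun x => (u s x - u t x) * v' s x) <= 10 * (e / C) * (B' + 1).
    apply: le_trans N3 _; rewrite ler_pM ?mulr_ge0 ?nrm_ge0// ler_wpM2l//.
  have t4 : nrm (fun x => u t x * (v' s x - v' t x)) <= 10 * A * (e / C).
    by apply: le_trans N4 _; rewrite ler_wpM2l// mulr_ge0.
  apply: le_trans nN _; apply: le_trans (lerD N5 (lexx _)) _.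
  apply: le_trans (lerD (lerD (lerD t1 t2) t3) t4) _.
  have eE : e = C * (e / C) by rewrite mulrC divfK ?gt_eqF.
  rewrite [leRHS]eE; move: (e / C) eC0; rewrite /C => q q0.
  have -> : (10 * (B + 1) + 10 * A' + 10 * (B' + 1) + 10 * A + 1) * q =
    10 * q * (B + 1) + 10 * A' * q + 10 * q * (B' + 1) + 10 * A * q + q by ring.
  by rewrite lerDl.
Qed.

(** Near each time the curve may be represented by another one on another set. This serves for
    restriction and for gluing two solutions. *)
Lemma curve_local D w w' : (forall t, D t -> exists d D1 w1 w1', [/\ 0 < d, curve D1 w1 w1', D1 t &
    forall s, D s -> `|s - t| < d -> [/\ D1 s, w s = w1 s & w' s = w1' s]]) -> curve D w w'.
Proof.
move=> H; split.
- move=> t Dt; have [d [D1 [w1 [w1' [d0 [H1 _ _] D1t Hs]]]]] := H t Dt.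
  have [|_ -> ->] := Hs t Dt; first by rewrite subrr normr0.
  exact: H1.
- move=> t e Dt e0; have [d [D1 [w1 [w1' [d0 [_ H2 _] D1t Hs]]]]] := H t Dt.
  have [|_ E1 E2] := Hs t Dt; first by rewrite subrr normr0.
  have [d' [d'0 Hd]] := H2 t e D1t e0.
  exists (Num.min d d'); split; first by rewrite lt_min d0.
  move=> s Ds; rewrite lt_min => /andP[s1 s2]; have [D1s E3 _] := Hs s Ds s1.
  by rewrite E1 E2 E3; exact: Hd.
- move=> t e Dt e0; have [d [D1 [w1 [w1' [d0 [_ _ H2] D1t Hs]]]]] := H t Dt.
  have [|_ E1 E2] := Hs t Dt; first by rewrite subrr normr0.
  have [d' [d'0 Hd]] := H2 t e D1t e0.
  exists (Num.min d d'); split; first by rewrite lt_min d0.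
  move=> s Ds; rewrite lt_min => /andP[s1 s2]; have [D1s _ E3] := Hs s Ds s1.
  by rewrite E2 E3; exact: Hd.
Qed.

Lemma curve_sub D D' w w' : D' `<=` D -> curve D w w' -> curve D' w w'.
Proof.
move=> sD cw; apply: curve_local => t Dt; exists 1, D, w, w'; split => //; first exact: sD.
by move=> s Ds _; split => //; exact: sD.
Qed.

Lemma curve_B D u u' v v' : curve D u u' -> curve D v v' ->
  curve D (fun t x => u t x - v t x) (fun t x => u' t x - v' t x).
Proof.
move=> [U1 U2 U3] [V1 V2 V3]; split.
- move=> t Dt; have [a1 a2] := U1 t Dt; have [b1 b2] := V1 t Dt.
  by split; [have [] := H1_sub a1 b1|have [] := H1_sub a2 b2].
- move=> t e Dt e0; have e2 : 0 < e / 2 by rewrite divr_gt0.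
  have [d1 [d10 H1]] := U2 t _ Dt e2; have [d2 [d20 H2]] := V2 t _ Dt e2.
  exists (Num.min d1 d2); split; first by rewrite lt_min d10.
  move=> s Ds; rewrite lt_min => /andP[s1 s2].
  have {}H1 := H1 s Ds s1; have {}H2 := H2 s Ds s2.
  have [a1 a2] := U1 t Dt; have [b1 b2] := V1 t Dt.
  have [c1 _] := U1 s Ds; have [g1 _] := V1 s Ds.
  have [P1 _] := H1_sub c1 a1; have [P2 _] := H1_scale (s - t) a2; have [P _] := H1_sub P1 P2.
  have [Q1 _] := H1_sub g1 b1; have [Q2 _] := H1_scale (s - t) b2; have [Q _] := H1_sub Q1 Q2.
  have [_] := H1_sub P Q.
  have -> : (fun x => u s x - u t x - (s - t) * u' t x - (v s x - v t x - (s - t) * v' t x)) =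
    (fun x => u s x - v s x - (u t x - v t x) - (s - t) * (u' t x - v' t x)).
    by apply/funext => x; ring.
  move=> h; apply: le_trans h (le_trans (lerD H1 H2) _).
  by rewrite -mulrDl -splitr.
- move=> t e Dt e0; have e2 : 0 < e / 2 by rewrite divr_gt0.
  have [d1 [d10 H1]] := U3 t _ Dt e2; have [d2 [d20 H2]] := V3 t _ Dt e2.
  exists (Num.min d1 d2); split; first by rewrite lt_min d10.
  move=> s Ds; rewrite lt_min => /andP[s1 s2].
  have {}H1 := H1 s Ds s1; have {}H2 := H2 s Ds s2.
  have [_ a2] := U1 t Dt; have [_ b2] := V1 t Dt.
  have [_ c1] := U1 s Ds; have [_ g1] := V1 s Ds.
  have [P _] := H1_sub c1 a2; have [Q _] := H1_sub g1 b2.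
  have [_] := H1_sub P Q.
  have -> : (fun x => u' s x - u' t x - (v' s x - v' t x)) =
    (fun x => u' s x - v' s x - (u' t x - v' t x)) by apply/funext => x; ring.
  move=> h; apply: le_trans h (le_trans (lerD H1 H2) _).
  by rewrite -splitr.
Qed.

(** Bounded linear functionals on H^1. Composed with them, curves become real functions subject to
    ordinary calculus. *)
Definition bfun (l : (R -> R) -> R) (K : R) : Prop :=
  [/\ 0 <= K, forall f g, H1per f -> H1per g -> l (fun x => f x - g x) = l f - l g,
      forall k f, H1per f -> l (fun x => k * f x) = k * l f
    & forall f, H1per f -> `|l f| <= K * nrm f].

Lemma bfun_small K (e : R) : 0 <= K -> 0 < e -> exists e', 0 < e' /\ K * e' <= e.
Proof.
move=> K0 e0; have K1 : 0 < K + 1 by rewrite ltr_wpDl.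
exists (e / (K + 1)); split; first by rewrite divr_gt0.
by rewrite mulrA ler_pdivrMr// mulrC ler_pM2l// lerDl.
Qed.

Lemma bfun_eps D w w' l K t e : curve D w w' -> bfun l K -> D t -> 0 < e ->
  exists d, 0 < d /\ forall s, D s -> `|s - t| < d ->
    `|l (w s) - l (w t) - (s - t) * l (w' t)| <= e * `|s - t|.
Proof.
move=> [H1 H2 _] [K0 lB lZ lK] Dt e0; have [e' [e'0 Ke]] := bfun_small K0 e0.
have [d [d0 Hd]] := H2 t e' Dt e'0; exists d; split => // s Ds st.
have [a1 a2] := H1 t Dt; have [b1 _] := H1 s Ds.
have [P1 _] := H1_sub b1 a1; have [P2 _] := H1_scale (s - t) a2; have [P _] := H1_sub P1 P2.
rewrite -lB// -lZ// -lB//; apply: le_trans (lK _ P) _.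
apply: le_trans (ler_wpM2l K0 (Hd s Ds st)) _.
by rewrite mulrA ler_wpM2r.
Qed.

Lemma bfun_derive D w w' l K t r : curve D w w' -> bfun l K -> 0 < r ->
  (forall s, `|s - t| < r -> D s) -> is_derive t 1 (fun s => l (w s)) (l (w' t)).
Proof.
move=> cw bl r0 Hr; apply: is_derive_eps => e e0.
have Dt : D t by apply: Hr; rewrite subrr normr0.
have [d [d0 Hd]] := bfun_eps cw bl Dt e0.
exists (Num.min r d); split; first by rewrite lt_min r0.
by move=> s; rewrite lt_min => /andP[s1 s2]; apply: Hd => //; exact: Hr.
Qed.

Lemma within_eps (f : R -> R) (a b : R) :
  (forall t e, a <= t -> t <= b -> 0 < e -> exists d, 0 < d /\
     forall s, a <= s -> s <= b -> `|s - t| < d -> `|f s - f t| <= e) ->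
  {within `[a, b], continuous f}.
Proof.
move=> H; apply/subspace_continuousP => t /=; rewrite in_itv /= => /andP[at_ tb].
apply/cvgrPdist_le => e e0; have [d [d0 Hd]] := H t e at_ tb e0.
exists d => //= s; rewrite /ball_ /= distrC => st; rewrite in_itv /= => /andP[as_ sb].
by rewrite distrC; exact: Hd.
Qed.

Lemma bfun_within D w w' l K a b : curve D w w' -> bfun l K ->
  (forall s, a <= s -> s <= b -> D s) -> {within `[a, b], continuous (fun s => l (w s))}.
Proof.
move=> cw [K0 lB lZ lK] HD; apply: within_eps => t e at_ tb e0.
have Dt := HD t at_ tb; have [e' [e'0 Ke]] := bfun_small K0 e0.
have [d [d0 Hd]] := curve_continuous cw Dt e'0; exists d; split => // s as_ sb st.
have Ds := HD s as_ sb; have [H1 _ _] := cw.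
have [a1 _] := H1 t Dt; have [b1 _] := H1 s Ds; have [P1 _] := H1_sub b1 a1.
by rewrite -lB//; apply: le_trans (lK _ P1) _; apply: le_trans (ler_wpM2l K0 (Hd s Ds st)) _.
Qed.

Lemma bfun_MVT D w w' l K a b : curve D w w' -> bfun l K -> a < b ->
  (forall s, a <= s -> s <= b -> D s) ->
  exists c, [/\ a < c, c < b & l (w b) - l (w a) = l (w' c) * (b - a)].
Proof.
move=> cw bl ab HD; have [||c] := @MVT R (fun s => l (w s)) (fun s => l (w' s)) a b ab.
- move=> t; rewrite in_itv /= => /andP[at_ tb].
  apply: (@bfun_derive _ _ _ _ _ _ (Num.min (t - a) (b - t)) cw bl).
    by rewrite lt_min !subr_gt0 at_.
  move=> s; rewrite lt_min => /andP[]; rewrite !ltr_norml => /andP[s1 s2] /andP[s3 s4].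
  by apply: HD; lra.
- exact: bfun_within cw bl HD.
- by rewrite in_itv /= => /andP[? ?] ?; exists c.
Qed.

Lemma bfun_b1 N f : H1per f -> bfun (fun g => b1 N g f) (nrm f).
Proof.
move=> Hf; split.
- exact: nrm_ge0.
- move=> g h Hg Hh; have Lg := H1per_L2 Hg; have Lh := H1per_L2 Hh.
  have -> : (fun x => g x - h x) = (fun x => g x + (-1) * h x).
    by apply/funext => x; rewrite mulN1r.
  by rewrite b1Dl ?b1Zl//; [rewrite mulN1r|exact: L2Z].
- by move=> k g Hg; rewrite b1Zl//; exact: H1per_L2.
- by move=> g Hg; rewrite [leRHS]mulrC; exact: b1_bound.
Qed.

(** Pair the curve with its own increment psi in the form [b1 N]. The scalar mean value theorem
    gives b1 N psi psi = (b - a) b1 N (w' c) psi, and Cauchy-Schwarz cancels one factor. The point c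
    depends on N, the bound does not. *)
Lemma mean_value_H1 D w w' a b K : curve D w w' -> a <= b -> 0 <= K ->
  (forall s, a <= s -> s <= b -> D s) ->
  (forall s, a < s -> s < b -> nrm (w' s) <= K) ->
  nrm (fun x => w b x - w a x) <= K * (b - a).
Proof.
move=> cw; rewrite le_eqVlt => /orP[/eqP <-|ab] K0 HD HK.
  by rewrite subrr mulr0; under eq_fun do rewrite subrr; rewrite nrm0.
have [H1 _ _] := cw; have [wa _] := H1 a (HD a (lexx _) (ltW ab)).
have [wb _] := H1 b (HD b (ltW ab) (lexx _)).
have [P _] := H1_sub wb wa; set psi := (X in nrm X).
have M0 : 0 <= K * (b - a) by rewrite mulr_ge0// subr_ge0 ltW.
apply: nrm_of_b1 => // N.
have Bpsi := bfun_b1 N P; have [c [ac cb]] := bfun_MVT cw Bpsi ab HD.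
have [_ lB _ _] := Bpsi; rewrite -lB// => E.
have [_ wc] := H1 c (HD c (ltW ac) (ltW cb)).
have CS := b1_CS N (H1per_L2 wc) (H1per_L2 P); rewrite -/psi in E CS *.
have n1 : b1 N (w' c) (w' c) <= K ^+ 2.
  by apply: le_trans (b1_le N wc) _; rewrite lerXn2r ?nnegrE ?nrm_ge0// HK.
have q0 := b1_ge0 N psi; move: E CS n1 q0.
move: (b1 N psi psi) (b1 N (w' c) psi) (b1 N (w' c) (w' c)) => q p r E CS n1 q0.
have [q0'|qn] := eqVneq q 0; first by rewrite q0' exprn_ge0.
have qp : 0 < q by rewrite lt_neqAle eq_sym qn.
have E2 : q * q = p ^+ 2 * (b - a) ^+ 2 by rewrite -expr2 E exprMn.
suff : q * q <= (K * (b - a)) ^+ 2 * q by rewrite ler_pM2r.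
rewrite exprMn E2 [leRHS]mulrAC ler_wpM2r ?sqr_ge0//.
by rewrite (le_trans CS)// ler_wpM2r.
Qed.

End SobolevCurves.

(** * Continuity in a parameter and exchange of integrals *)

Section ParametricIntegrals.
Context {R : realType}.
Implicit Types (f g h : R -> R) (x y z a b c d e k m : R).

Lemma continuous_bounded f a b : continuous f -> exists M, 0 <= M /\ forall x, a <= x <= b -> `|f x| <= M.
Proof.
move=> cf; have [ab|ba] := leP a b; last first.
  by exists 0; split=> // x /andP[h1 h2]; have := le_trans h1 h2; rewrite leNgt ba.
have [c _ H] := @EVT_max R (fun x => `|f x|) a b ab ltac:(by apply: continuous_subspaceT; cts).
by exists `|f c|; split => // x xab; apply: H; rewrite in_itv.
Qed.

Lemma param_cont g h k m c d : c <= d -> continuous g -> continuous h ->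
  continuous (fun x => \int[leb]_(y in `[c, d]) (h y * g (k * x + m * y))).
Proof.
move=> cd cg ch x0; apply/cvgrPdist_le => e e0.
have [M [M0 HM]] := @continuous_bounded h c d ch.
have W0 : 0 < M * (d - c) + 1 by rewrite ltr_wpDl// mulr_ge0// subr_ge0.
have e1 : 0 < e / (M * (d - c) + 1) by rewrite divr_gt0.
pose B := `|c| + `|d|.
have [dl [dl0 Hd]] := @continuous_modulus R g (k * x0 - `|m| * B) (k * x0 + `|m| * B) _ cg e1.
have k1 : 0 < `|k| + 1 by rewrite ltr_wpDl.
exists (dl / (`|k| + 1)); first by rewrite /= divr_gt0.
move=> x; rewrite /ball_ /= => xx0.
have c1 : continuous (fun y => h y * g (k * x0 + m * y)) by cts.
have c2 : continuous (fun y => h y * g (k * x + m * y)) by cts.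
rewrite -intB//; apply: le_trans (@int_abs_le _ _ c d (M * (e / (M * (d - c) + 1))) cd _ _) _.
- cts.
- move=> y ycd; rewrite -mulrBr normrM distrC ler_pM// ?HM//; apply: Hd.
    have yB : `|y| <= B.
      move: ycd => /andP[y1 y2]; rewrite /B; have := ler_norm (- c); have := ler_norm d.
      rewrite normrN => p1 p2; have q1 := normr_ge0 c; have q2 := normr_ge0 d.
      by rewrite ler_norml; apply/andP; split; lra.
    have : `|m * y| <= `|m| * B by rewrite normrM ler_wpM2l.
    by rewrite ler_norml => /andP[h1 h2]; apply/andP; split; lra.
  rewrite opprD addrACA subrr addr0 -mulrBr normrM.
  apply: le_lt_trans (_ : (`|k| + 1) * `|x0 - x| < _); first by rewrite mulrDl mul1r lerDl.
  by rewrite mulrC -ltr_pdivlMr.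
- rewrite mulrAC mulrA ler_pdivrMr// [M * (d - c) * _]mulrC ler_pM2l//; lra.
Qed.

Lemma Rintegral_swap (F : R -> R -> R) a b c d (M : R) :
  measurable_fun setT (fun z : measurableTypeR R * measurableTypeR R => F z.1 z.2 : measurableTypeR R) ->
  (forall x, continuous (F x)) -> (forall y, continuous (fun x => F x y)) ->
  (forall x y, a <= x <= b -> c <= y <= d -> `|F x y| <= M) ->
  \int[leb]_(x in `[a, b]) \int[leb]_(y in `[c, d]) F x y =
  \int[leb]_(y in `[c, d]) \int[leb]_(x in `[a, b]) F x y.
Proof.
move=> mF cF1 cF2 FM.
pose I1 : set (measurableTypeR R) := `[a, b]%classic.
pose I2 : set (measurableTypeR R) := `[c, d]%classic.
pose D : set (measurableTypeR R * measurableTypeR R) := I1 `*` I2.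
pose G (z : measurableTypeR R * measurableTypeR R) : R := F z.1 z.2.
have mD : measurable D by apply: measurableX; exact: measurable_itv.
have iF : (leb \x leb)%E.-integrable D (EFin \o G).
  apply: measurable_bounded_integrable => //.
  - rewrite [ltLHS](_ : _ = (leb I1 * leb I2)%E); last first.
      by apply: product_measure1E; exact: measurable_itv.
    by rewrite lte_mul_pinfty// ?ge0_fin_numE//= lebesgue_measure_itv/= lte_fin;
      case: ifPn => // _; rewrite -EFinB ltry.
  - exact: measurable_funS mF.
  - exists M; split; first exact: num_real.
    move=> r rM [x y]; rewrite /D /I1 /I2 /= !in_itv /= => -[xab ycd].
    by rewrite (le_trans _ (ltW rM))// FM.
(* Fubini is applied on the whole plane, so the integrand is extended by 0 outside the rectangle. *)
pose Fe : measurableTypeR R * measurableTypeR R -> \bar R :=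
  (EFin \o G : measurableTypeR R * measurableTypeR R -> \bar R) \_ D.
have FeE x y : Fe (x, y) = if (x \in I1) && (y \in I2) then (F x y)%:E else 0%E.
  by rewrite /Fe patchE /D in_setX.
have iFe : (leb \x leb)%E.-integrable setT Fe by rewrite /Fe -integrable_mkcond.
have H := Fubini iFe.
have fin1 x : (\int[leb]_(y in `[c, d]) (F x y)%:E)%E \is a fin_num.
  by apply: integrable_fin_num => //; exact: cint (cF1 x).
have fin2 y : (\int[leb]_(x in `[a, b]) (F x y)%:E)%E \is a fin_num.
  by apply: integrable_fin_num => //; exact: cint (cF2 y).
have E1 x : (\int[leb]_y Fe (x, y) =
   ((fun x => (\int[leb]_(y in `[c, d]) F x y)%R%:E) \_ I1) x)%E.
  rewrite patchE; case: (boolP (x \in I1)) => xI.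
    rewrite /Rintegral fineK; last exact: fin1.
    rewrite [RHS]integral_mkcond; apply: eq_integral => y _.
    by rewrite FeE xI patchE.
  by apply: integral0_eq => y _; rewrite FeE (negbTE xI).
have E2 y : (\int[leb]_x Fe (x, y) =
   ((fun y => (\int[leb]_(x in `[a, b]) F x y)%R%:E) \_ I2) y)%E.
  rewrite patchE; case: (boolP (y \in I2)) => yI.
    rewrite /Rintegral fineK; last exact: fin2.
    rewrite [RHS]integral_mkcond; apply: eq_integral => x _.
    by rewrite FeE yI andbT patchE.
  by apply: integral0_eq => x _; rewrite FeE (negbTE yI) andbF.
rewrite {1}/Rintegral [RHS]/Rintegral; congr fine.
rewrite integral_mkcond [RHS]integral_mkcond.
under eq_integral do rewrite -E1.
by under [RHS]eq_integral do rewrite -E2.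
Qed.

(** The affine argument k x + m y covers every translation and reflection met below, so
    measurability and boundedness are checked once. *)
Lemma param_fubini f g h k m a b c d : continuous f -> continuous g -> continuous h ->
  \int[leb]_(x in `[a, b]) (f x * \int[leb]_(y in `[c, d]) (h y * g (k * x + m * y))) =
  \int[leb]_(y in `[c, d]) (h y * \int[leb]_(x in `[a, b]) (f x * g (k * x + m * y))).
Proof.
move=> cf cg ch.
pose F x y := f x * (h y * g (k * x + m * y)).
have mF : measurable_fun setT (fun z : measurableTypeR R * measurableTypeR R => F z.1 z.2 : measurableTypeR R).
  apply: measurable_funM.
    by apply: (measurableT_comp (continuous_measurable_fun cf)); exact: measurable_fst.
  apply: measurable_funM.
    by apply: (measurableT_comp (continuous_measurable_fun ch)); exact: measurable_snd.
  apply: (measurableT_comp (continuous_measurable_fun cg)).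
  by apply: measurable_funD; apply: measurable_funM.
have [Mf [Mf0 HMf]] := @continuous_bounded f a b cf.
have [Mh [Mh0 HMh]] := @continuous_bounded h c d ch.
pose B := `|k| * (`|a| + `|b|) + `|m| * (`|c| + `|d|).
have [Mg [Mg0 HMg]] := @continuous_bounded g (- B) B cg.
have mB (p q y : R) : p <= y <= q -> `|y| <= `|p| + `|q|.
  move=> /andP[y1 y2]; have := ler_norm (- p); have := ler_norm q.
  rewrite normrN => p1 p2; have q1 := normr_ge0 p; have q2 := normr_ge0 q.
  by rewrite ler_norml; apply/andP; split; lra.
have cF1 x : continuous (fun y => h y * g (k * x + m * y)) by cts.
have cF2 y : continuous (fun x => f x * g (k * x + m * y)) by cts.
have := @Rintegral_swap F a b c d (Mf * (Mh * Mg)) mF.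
have -> : \int[leb]_(x in `[a, b]) \int[leb]_(y in `[c, d]) F x y =
    \int[leb]_(x in `[a, b]) (f x * \int[leb]_(y in `[c, d]) (h y * g (k * x + m * y))).
  by apply: eq_Rintegral => x _; rewrite -(intZ _ _ _ (cF1 x)).
have -> : \int[leb]_(y in `[c, d]) \int[leb]_(x in `[a, b]) F x y =
    \int[leb]_(y in `[c, d]) (h y * \int[leb]_(x in `[a, b]) (f x * g (k * x + m * y))).
  apply: eq_Rintegral => y _; rewrite -(intZ _ _ _ (cF2 y)).
  by apply: eq_Rintegral => x _; rewrite /F mulrCA.
apply.
- by move=> x; rewrite /F; cts.
- by move=> y; rewrite /F; cts.
move=> x y xab ycd; rewrite /F !normrM; apply: ler_pM; rewrite ?mulr_ge0 ?HMf//.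
apply: ler_pM; rewrite ?HMh// HMg//; rewrite -ler_norml.
by rewrite (le_trans (ler_normD _ _))// !normrM lerD// ler_wpM2l//; exact: mB.
Qed.

End ParametricIntegrals.

(** * The virial inequality *)

Section Virial.
Context {R : realType}.
Implicit Types (f g h w phi : R -> R) (x y z a b c d e : R).

(* The unsimplified coefficients 1 and -1 match [param_cont] and [param_fubini]. *)
Definition acorr f g y : R := \int[leb]_(x in `[0, 2 * pi]) (f x * g (1 * x + (-1) * y)).

Lemma acorr_cont f g : continuous f -> continuous g -> continuous (acorr f g).
Proof.
move=> cf cg; have H := @param_cont R g f (-1) 1 0 (2 * pi) (twopi_ge0) cg cf.
rewrite (_ : acorr f g = fun y => \int[leb]_(x in `[0, 2 * pi]) (f x * g (-1 * y + 1 * x)))//.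
by apply/funext => y; apply: eq_Rintegral => x _; rewrite [1 * x + _]addrC.
Qed.

Lemma int_period_shift f y : continuous f -> periodic f (2 * pi) ->
  \int[leb]_(x in `[0, 2 * pi]) f (x + y) = \int[leb]_(x in `[0, 2 * pi]) f x.
Proof.
move=> cf pf; rewrite int_shift ?twopi_ge0// add0r addrC.
exact: int_periodic.
Qed.

Lemma acorr_swap f g y : continuous f -> continuous g -> periodic f (2 * pi) -> periodic g (2 * pi) ->
  \int[leb]_(x in `[0, 2 * pi]) (f x * g (1 * x + 1 * y)) = \int[leb]_(x in `[0, 2 * pi]) (f (x - y) * g x).
Proof.
move=> cf cg pf pg; pose F z := f (z - y) * g z.
have cF : continuous F by rewrite /F; cts.
have pF : periodic F (2 * pi).
  by move=> z; rewrite /F pg addrAC pf.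
rewrite -[RHS](int_period_shift y cF pF).
by apply: eq_Rintegral => x _; rewrite /F addrK !mul1r.
Qed.

Lemma acorr_sym w y : continuous w -> periodic w (2 * pi) -> acorr w w (- y) = acorr w w y.
Proof.
move=> cw pw; rewrite /acorr.
transitivity (\int[leb]_(x in `[0, 2 * pi]) (w x * w (1 * x + 1 * y))).
  by apply: eq_Rintegral => x _; rewrite mulrN mulN1r opprK mul1r mul1r.
by rewrite acorr_swap//; apply: eq_Rintegral => x _; rewrite mulrC mulN1r mul1r.
Qed.

Lemma acorr_periodic f w : periodic w (2 * pi) -> periodic (acorr f w) (2 * pi).
Proof.
move=> pw y; apply: eq_Rintegral => x _; congr (_ * _); rewrite -[LHS]pw; congr w; ring.
Qed.

Lemma int_reflect w x : continuous w -> periodic w (2 * pi) ->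
  \int[leb]_(y in `[0, 2 * pi]) w (x - y) = \int[leb]_(y in `[0, 2 * pi]) w y.
Proof.
move=> cw pw; pose F z := w (x + z).
have cF : continuous F by rewrite /F; cts.
have pF : periodic F (2 * pi) by move=> z; rewrite /F addrA pw.
transitivity (\int[leb]_(y in `[0, 2 * pi]) F (- y)) => //.
rewrite int_opp ?twopi_ge0// oppr0.
have := int_periodic (- (2 * pi)) cF pF; rewrite addNr => ->.
rewrite -(int_period_shift x cw pw).
by apply: eq_Rintegral => y _; rewrite /F addrC.
Qed.

Lemma int_reflect_itv f a b s : a <= b -> continuous f ->
  \int[leb]_(y in `[a, b]) f (s - y) = \int[leb]_(y in `[s - b, s - a]) f y.
Proof.
move=> ab cf; have cF : continuous (fun z => f (z + s)) by cts.
transitivity (\int[leb]_(y in `[a, b]) (fun z => f (z + s)) (- y)).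
  by apply: eq_Rintegral => y _; rewrite addrC.
rewrite (@int_opp R (fun z => f (z + s)) a b ab cF) int_shift ?lerN2//.
by rewrite ![- _ + s]addrC.
Qed.

Lemma int_half_even f : continuous f -> periodic f (2 * pi) -> (forall y, f (- y) = f y) ->
  \int[leb]_(y in `[0, 2 * pi]) f y = 2 * \int[leb]_(y in `[0, pi]) f y.
Proof.
move=> cf pf ef; have p0 := @pi_ge0 R.
rewrite (@int_split R f 0 (2 * pi) pi cf p0) ?ler_peMl ?ler1n// [RHS]mulr_natl [RHS]mulr2n; congr (_ + _).
have E : \int[leb]_(y in `[0, pi]) f y = \int[leb]_(y in `[0, pi]) f (2 * pi - y).
  by apply: eq_Rintegral => y _; rewrite addrC pf ef.
by rewrite E int_reflect_itv// subr0; have -> : 2 * pi - pi = pi :> R by ring.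
Qed.

(** Over a full period the autocorrelation integrates to the square of the integral of w; it is
    even, so [0, pi] carries half. *)
Lemma int_acorr w : continuous w -> periodic w (2 * pi) ->
  2 * \int[leb]_(y in `[0, pi]) acorr w w y = (\int[leb]_(x in `[0, 2 * pi]) w x) ^+ 2.
Proof.
move=> cw pw; have cG := acorr_cont cw cw.
have p0 := @pi_ge0 R; have tp0 := @twopi_ge0 R.
have <- : \int[leb]_(y in `[0, 2 * pi]) acorr w w y = (\int[leb]_(x in `[0, 2 * pi]) w x) ^+ 2.
  have := @param_fubini R w w (fun _ => 1) 1 (-1) 0 (2 * pi) 0 (2 * pi) cw cw ltac:(by cts).
  have -> : \int[leb]_(y in `[0, 2 * pi]) (1 * \int[leb]_(x in `[0, 2 * pi]) (w x * w (1 * x + -1 * y))) =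
    \int[leb]_(y in `[0, 2 * pi]) acorr w w y by apply: eq_Rintegral => y _; rewrite mul1r.
  move=> <-; rewrite expr2 -intZ//; apply: eq_Rintegral => x _; rewrite mulrC; congr (_ * _).
  by rewrite -(int_reflect x cw pw); apply: eq_Rintegral => y _; rewrite !mul1r mulN1r.
rewrite int_half_even//; first exact: acorr_periodic.
by move=> y; exact: acorr_sym.
Qed.

(* For x, x - y in the support of w with 0 < y <= pi, no wrap-around occurs and phi x - phi (x - y) = y. *)
Lemma virial_pointwise w phi a b e x y : 0 <= a -> b <= 2 * pi -> b - a < pi ->
  periodic w (2 * pi) -> (forall x, 0 <= w x) ->
  (forall x, a <= x <= b -> phi x = x - a) ->
  (forall x, 0 <= x <= 2 * pi -> w x != 0 -> a < x < b) ->
  0 < e -> e <= y -> y <= pi -> 0 <= x <= 2 * pi ->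
  2 * cos ((b - a) / 2) * (w x * w (x - y)) <= hke e y * ((phi x - phi (x - y)) * (w x * w (x - y))).
Proof.
move=> a0 b2 ba pw w0 Hphi Hw e0 ey yp x2.
have [->|wx] := eqVneq (w x) 0; first by rewrite !mul0r !mulr0.
have [->|wxy] := eqVneq (w (x - y)) 0; first by rewrite !mulr0.
have /andP[ax xb] := Hw x x2 wx.
have y0 : 0 < y by exact: lt_le_trans ey.
have xy0 : 0 <= x - y.
  (* If x - y were negative, its translate x - y + 2 pi would lie in the support and exceed a + pi >
     b. *)
  rewrite leNgt; apply/negP => xy; have xyp : w (x - y + 2 * pi) != 0 by rewrite pw.
  have p0 := @pi_ge0 R.
  have h1 : 0 <= x - y + 2 * pi <= 2 * pi by apply/andP; split; lra.
  have /andP[_ h2] := Hw _ h1 xyp; lra.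
have xy2 : 0 <= x - y <= 2 * pi by rewrite xy0 /=; move: x2 => /andP[_]; lra.
have /andP[axy xyb] := Hw _ xy2 wxy.
have e0' := ltW e0.
rewrite Hphi ?(ltW ax) ?(ltW xb)// Hphi ?(ltW axy) ?(ltW xyb)// hkeE_itv//.
have hh : 2 * cos ((b - a) / 2) <= y * hk y by apply: hk_ge; lra.
have -> : x - a - (x - y - a) = y by ring.
have P0 : 0 <= w x * w (x - y) by rewrite mulr_ge0.
have -> : hk y * (y * (w x * w (x - y))) = y * hk y * (w x * w (x - y)).
  by rewrite mulrCA mulrA.
exact: ler_wpM2r.
Qed.

Lemma HI_param e f x : 0 < e -> e <= pi -> continuous f -> HI e f x =
  \int[leb]_(y in `[e, pi]) (hke e y * f (1 * x + (-1) * y)) -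
  \int[leb]_(y in `[e, pi]) (hke e y * f (1 * x + 1 * y)).
Proof.
move=> e0 ep cf; have ch := hke_cont e0 ep.
rewrite /HI -intB; [|by cts..].
by apply: eq_Rintegral => y _; rewrite !mul1r mulN1r mulrBl ![_ * hke e y]mulrC.
Qed.

Lemma HI_cont e f : 0 < e -> e <= pi -> continuous f -> continuous (HI e f).
Proof.
move=> e0 ep cf; have ch := hke_cont e0 ep.
rewrite (_ : HI e f = fun x =>
  \int[leb]_(y in `[e, pi]) (hke e y * f (1 * x + (-1) * y)) -
  \int[leb]_(y in `[e, pi]) (hke e y * f (1 * x + 1 * y))); last first.
  by apply/funext => x; exact: HI_param.
have c1 := @param_cont R f (hke e) 1 (-1) e pi ep cf ch.
have c2 := @param_cont R f (hke e) 1 1 e pi ep cf ch.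
by apply: cfD c1 _; apply: cfN c2.
Qed.

(** Fubini, then translation by y in the term with g(x + y). With f = phi w and g = w the bracket
    becomes (phi(x) - phi(x - y)) w(x) w(x - y), in which the singularity is compensated. *)
Lemma int_HI e f g : 0 < e -> e <= pi -> continuous f -> continuous g ->
  periodic f (2 * pi) -> periodic g (2 * pi) ->
  \int[leb]_(x in `[0, 2 * pi]) (f x * HI e g x) =
  \int[leb]_(y in `[e, pi]) (hke e y *
     \int[leb]_(x in `[0, 2 * pi]) (f x * g (x - y) - f (x - y) * g x)).
Proof.
move=> e0 ep cf cg pf pg; have ch := hke_cont e0 ep; have tp0 := @twopi_ge0 R.
have c1 := @param_cont R g (hke e) 1 (-1) e pi ep cg ch.
have c2 := @param_cont R g (hke e) 1 1 e pi ep cg ch.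
transitivity (\int[leb]_(x in `[0, 2 * pi])
    (f x * \int[leb]_(y in `[e, pi]) (hke e y * g (1 * x + (-1) * y))) -
  \int[leb]_(x in `[0, 2 * pi])
    (f x * \int[leb]_(y in `[e, pi]) (hke e y * g (1 * x + 1 * y)))).
  rewrite -intB; [|exact: cfM|exact: cfM].
  by apply: eq_Rintegral => x _; rewrite HI_param// mulrBr.
rewrite !param_fubini// -intB; first last.
- have H := @param_cont R g f 1 1 0 (2 * pi) tp0 cg cf.
  apply: cfM ch _; rewrite (_ : (fun y => _) = fun y => \int[leb]_(x in `[0, 2 * pi]) (f x * g (1 * y + 1 * x)))//.
  by apply/funext => y; apply: eq_Rintegral => x _; rewrite [1 * x + _]addrC.
- exact: cfM ch (acorr_cont cf cg).
apply: eq_Rintegral => y _; rewrite -mulrBr; congr (_ * _).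
rewrite acorr_swap// -intB; [|by cts..].
by apply: eq_Rintegral => x _; rewrite mul1r mulN1r.
Qed.

Lemma virial_HI w phi a b e : 0 <= a -> b <= 2 * pi -> b - a < pi ->
  continuous w -> periodic w (2 * pi) -> (forall x, 0 <= w x) ->
  continuous phi -> periodic phi (2 * pi) ->
  (forall x, a <= x <= b -> phi x = x - a) ->
  (forall x, 0 <= x <= 2 * pi -> w x != 0 -> a < x < b) ->
  0 < e -> e <= pi ->
  2 * cos ((b - a) / 2) * \int[leb]_(y in `[e, pi]) acorr w w y <=
  \int[leb]_(x in `[0, 2 * pi]) (phi x * w x * HI e w x).
Proof.
move=> a0 b2 ba cw pw w0 cp pp Hphi Hw e0 ep; have ch := hke_cont e0 ep; have tp0 := @twopi_ge0 R.
have cf : continuous (fun x => phi x * w x) by cts.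
have pf : periodic (fun x => phi x * w x) (2 * pi) by move=> x; rewrite pw pp.
rewrite (@int_HI e (fun x => phi x * w x) w)// -intZ; last exact: acorr_cont.
pose P y := \int[leb]_(x in `[0, 2 * pi]) (phi x * w x * w (x - y) - phi (x - y) * w (x - y) * w x).
have cA := acorr_cont cw cw.
apply: (@int_le R (fun y => 2 * cos ((b - a) / 2) * acorr w w y) (fun y => hke e y * P y)); first by cts.
  apply: cfM ch _.
  have -> : P = fun y => acorr (fun x => phi x * w x) w y - acorr w (fun x => phi x * w x) y.
    apply/funext => y; rewrite /acorr -intB; [|by cts..].
    by apply: eq_Rintegral => x _; rewrite mul1r mulN1r [w x * _]mulrC.
  by apply: cfD (acorr_cont cf cw) _; apply: cfN; exact: acorr_cont.
move=> y /andP[ey yp]; rewrite /acorr /P -!intZ; [|by cts..].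
apply: (@int_le R (fun x => 2 * cos ((b - a) / 2) * (w x * w (1 * x + -1 * y)))
  (fun x => hke e y * (phi x * w x * w (x - y) - phi (x - y) * w (x - y) * w x))); [by cts|by cts|].
move=> x x2; rewrite mul1r mulN1r.
have -> : phi x * w x * w (x - y) - phi (x - y) * w (x - y) * w x =
  (phi x - phi (x - y)) * (w x * w (x - y)) by ring.
exact: (@virial_pointwise w phi a b e x y).
Qed.

(** Let e tend to 0 in [virial_HI]. The constant is (2 pi)^-1 times 2 cos ((b - a) / 2) times the
    half from [int_acorr]. *)
Lemma virial_hil w phi a b : 0 <= a -> a < b -> b <= 2 * pi -> b - a < pi ->
  H1per w -> (forall x, 0 <= w x) ->
  continuous phi -> periodic phi (2 * pi) ->
  (forall x, a <= x <= b -> phi x = x - a) ->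
  (forall x, 0 <= x <= 2 * pi -> w x != 0 -> a < x < b) ->
  cos ((b - a) / 2) / (2 * pi) * (\int[leb]_(x in `[0, 2 * pi]) w x) ^+ 2 <=
  \int[leb]_(x in `[0, 2 * pi]) (phi x * w x * hil w x).
Proof.
move=> a0 ab b2 ba Hw w0 cp pp Hphi Hsupp; have tp0 := @twopi_ge0 R.
have cw := H1per_cont Hw; have pw := H1per_periodic Hw.
have [Hh _] := hil_H1 Hw; have chl := H1per_cont Hh; have cA := acorr_cont cw cw.
have cf : continuous (fun x => phi x * w x) by cts.
have pf : periodic (fun x => phi x * w x) (2 * pi) by move=> x; rewrite pw pp.
have [M [M0 HM]] := periodic_bounded cf pf.
have [G [G0 HG]] := @continuous_bounded R _ 0 pi cA.
set c := cos ((b - a) / 2).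
have c0 : 0 <= c by apply: cos_ge0_pihalf; have := @pi_gt0 R => pp0; apply/andP; split; lra.
have i0 : 0 <= (2 * pi)^-1 :> R by rewrite invr_ge0.
(* The first term comes from [hil_rate] integrated against phi w, the second from the part of the
   autocorrelation over [0, e], where e <= 2 sqrt e. *)
pose K := M * (2 * nrm w) * (2 * pi) + (2 * pi)^-1 * (2 * c * (G * 2)).
have K0 : 0 <= K.
  by apply: addr_ge0; (apply: mulr_ge0 => //); rewrite !mulr_ge0 ?nrm_ge0.
apply/ler_addgt0Pr => d d0; have [e [e0 ep He]] := sqrt_small K0 d0.
have {He} := He e e0 (lexx _).
have e0' := ltW e0.
have se : e <= 2 * Num.sqrt e.
  have s2 : Num.sqrt e <= 2.
    rewrite -(@ler_pXn2r _ 2) ?nnegrE ?sqrtr_ge0// sqr_sqrtr// (le_trans ep)//.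
    by rewrite (le_trans pi_le4)// expr2; lra.
  by rewrite -[leLHS]sqr_sqrtr// expr2 ler_wpM2r ?sqrtr_ge0.
have H1 := @virial_HI w phi a b e a0 b2 ba cw pw w0 cp pp Hphi Hsupp e0 ep.
have H2 : \int[leb]_(y in `[0, e]) acorr w w y <= G * e.
  have := @int_abs_le R (acorr w w) 0 e G (ltW e0) cA; rewrite subr0 => H.
  apply: le_trans (ler_norm _) (H _) => x /andP[x0 xe]; apply: HG; rewrite x0/=; exact: le_trans xe ep.
have H3 := int_acorr cw pw.
rewrite (@int_split R (acorr w w) 0 pi e cA (ltW e0) ep) in H3.
have cHI := HI_cont e0 ep cw.
have H4 : `|\int[leb]_(x in `[0, 2 * pi]) (phi x * w x * hil w x - (2 * pi)^-1 * (phi x * w x * HI e w x))|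
    <= M * (2 * nrm w * Num.sqrt e) * (2 * pi - 0).
  apply: int_abs_le => //; first by cts.
  move=> x _; rewrite mulrCA -mulrBr normrM ler_pM// ?hil_rate//.
rewrite intB in H4; [|by cts..].
rewrite intZ in H4; last by cts.
rewrite subr0 in H4; move: H4; rewrite ler_norml => /andP[H4 _].
have H5 : (2 * pi)^-1 * (2 * c * (\int[leb]_(y in `[e, pi]) acorr w w y)) <=
   (2 * pi)^-1 * \int[leb]_(x in `[0, 2 * pi]) (phi x * w x * HI e w x) by exact: ler_wpM2l.
have H6 : (2 * pi)^-1 * (2 * c * (\int[leb]_(y in `[0, e]) acorr w w y)) <=
   (2 * pi)^-1 * (2 * c * (G * (2 * Num.sqrt e))).
  apply: ler_wpM2l => //; apply: ler_wpM2l; first by rewrite mulr_ge0.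
  by apply: le_trans H2 _; rewrite ler_wpM2l.
rewrite -H3 /K.
move: H4 H5 H6; move: (\int[leb]_(y in `[e, pi]) acorr w w y) (\int[leb]_(y in `[0, e]) acorr w w y).
move: (\int[leb]_(x in `[0, 2 * pi]) (phi x * w x * HI e w x)) (\int[leb]_(x in `[0, 2 * pi]) (phi x * w x * hil w x)).
move=> q1 q2 q3 q4; rewrite [c / _]mulrC; move: (2 * pi : R) (nrm w) (Num.sqrt e) => t n s; move: (t^-1) => p h4 h5 h6 h7.
have -> : p * c * (2 * (q4 + q3)) = p * (2 * c * q4) + p * (2 * c * q3) by ring.
have E : (M * (2 * n) * t + p * (2 * c * (G * 2))) * s = M * (2 * n * s) * t + p * (2 * c * (G * (2 * s))) by ring.
by rewrite E in h7; lra.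
Qed.

End Virial.

(** * Convergence of the integral [I_infty] *)

Section LifespanIntegral.
Context {R : realType}.
Implicit Types (x y z t : R).

(* The absolute value makes the integrand of I_infty continuous on the whole line. *)
Definition lsp y : R := (Num.sqrt (`|y| ^+ 3 + 1))^-1.

Lemma lsp_arg y : 0 < Num.sqrt (`|y| ^+ 3 + 1).
Proof. by rewrite sqrtr_gt0 ltr_wpDl// exprn_ge0. Qed.

Lemma lsp_cont : continuous lsp.
Proof.
apply: cfV => [y|]; first by rewrite gt_eqF// lsp_arg.
apply: (@cfcomp _ (fun y => `|y| ^+ 3 + 1) Num.sqrt); last exact: sqrt_continuous.
by cts.
Qed.

Lemma lsp_ge0 y : 0 <= lsp y. Proof. by rewrite invr_ge0 sqrtr_ge0. Qed.

(** From 4 (q^3 + 1) - (q + 1)^3 = 3 (q + 1) (q - 1)^2 >= 0: the integrand is at most 2 (q +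
    1)^(-3/2), which has an explicit primitive. *)
Lemma lsp_bound y : lsp y <= 2 * (Num.sqrt (`|y| + 1) * (`|y| + 1))^-1.
Proof.
have y0 := normr_ge0 y; set q := `|y| in y0 *.
have q1 : 0 < q + 1 by rewrite ltr_wpDl.
have s0 : 0 < Num.sqrt (q + 1) by rewrite sqrtr_gt0.
rewrite /lsp -/q -ler_pdivrMl// -invfM lef_pV2 ?posrE ?mulr_gt0 ?lsp_arg//.
rewrite -(@ler_pXn2r _ 2) ?nnegrE ?mulr_ge0 ?sqrtr_ge0// ?(ltW q1)//.
rewrite !exprMn !sqr_sqrtr ?(ltW q1)// ?addr_ge0 ?exprn_ge0//.
have : 0 <= (q + 1) * (q - 1) ^+ 2 by rewrite mulr_ge0 ?sqr_ge0// ltW.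
rewrite -subr_ge0 => h.
have -> : 2 ^+ 2 * (q ^+ 3 + 1) - (q + 1) * (q + 1) ^+ 2 = 3 * ((q + 1) * (q - 1) ^+ 2) by ring.
by rewrite mulr_ge0.
Qed.

Lemma lsp_integrable : (\int[leb]_(y in `[0%R, +oo[) (lsp y)%:E < +oo)%E.
Proof.
pose f y := 2 * (Num.sqrt (`|y| + 1) * (`|y| + 1))^-1.
have f0 y : 0 <= f y by rewrite mulr_ge0// invr_ge0 mulr_ge0 ?sqrtr_ge0// addr_ge0.
have cf : continuous f.
  apply: (@cfM _ (fun _ => 2)); first by cts.
  apply: cfV => [y|]; first by rewrite mulf_neq0 ?gt_eqF ?sqrtr_gt0 ?ltr_wpDl.
  apply: cfM; last by cts.
  by apply: (@cfcomp _ (fun y => `|y| + 1) Num.sqrt); [cts|exact: sqrt_continuous].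
have mf (g : R -> R) : continuous g -> measurable_fun (`[0, +oo[%classic : set (measurableTypeR R)) (EFin \o g).
  by move=> cg; apply/measurable_EFinP; apply: measurable_funS (continuous_measurable_fun cg).
apply: (@le_lt_trans _ _ (\int[leb]_(y in `[0%R, +oo[) (f y)%:E)%E).
  apply: ge0_le_integral => //; try exact: mf.
  - by move=> y _; rewrite lee_fin lsp_ge0.
  - exact: mf lsp_cont.
  - by move=> y _; rewrite lee_fin lsp_bound.
pose F y : R := - 4 * (Num.sqrt (y + 1))^-1.
have dF y : 0 <= y -> is_derive y 1 F (f y).
  move=> y0; have y1 : 0 < y + 1 by rewrite ltr_wpDl.
  have s0 : Num.sqrt (y + 1) != 0 by rewrite gt_eqF ?sqrtr_gt0.
  have ds : is_derive y 1 (fun y => Num.sqrt (y + 1)) ((2 * Num.sqrt (y + 1))^-1 * (1 + 0)).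
    apply: (@dcomp _ (fun y => y + 1) Num.sqrt y); first exact: is_derive1_sqrt.
  have dV : is_derive y 1 (fun y => (Num.sqrt (y + 1))^-1)
      (- (Num.sqrt (y + 1)) ^- 2 *: ((2 * Num.sqrt (y + 1))^-1 * (1 + 0))).
    exact: (@is_deriveV _ (fun y => Num.sqrt (y + 1)) y _ 1 s0 ds).
  apply: dEq (@dM _ (fun _ => - 4) (fun y => (Num.sqrt (y + 1))^-1) y _ _ (dcst _ _) dV) _.
  rewrite /f ger0_norm// mulr0 /GRing.scale /= !addr0.
  have E : Num.sqrt (y + 1) ^+ 2 = y + 1 by rewrite sqr_sqrtr// ltW.
  by move: (Num.sqrt (y + 1)) s0 E => s s0 <-; field.
rewrite (@ge0_continuous_FTC2y _ f F 0 0).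
- by rewrite -EFinB ltry.
- by move=> y _; exact: f0.
- exact: continuous_subspaceT.
- apply/cvgrPdist_le => e e0; near=> y.
  have y0 : 0 <= y by near: y; exact: nbhs_pinfty_ge.
  have y1 : 0 < y + 1 by rewrite ltr_wpDl.
  rewrite sub0r normrN /F normrM normrN normfV !ger0_norm ?sqrtr_ge0//.
  rewrite ler_pdivrMr ?sqrtr_gt0// -ler_pdivrMl//.
  rewrite -(@ler_pXn2r _ 2) ?nnegrE ?sqrtr_ge0// ?mulr_ge0 ?invr_ge0 ?(ltW e0)//.
  rewrite sqr_sqrtr ?(ltW y1)//; apply: le_trans (_ : y <= _); last by rewrite lerDl.
  by near: y; apply: nbhs_pinfty_ge; exact: num_real.
- by move=> y y0; have [] := dF y (ltW y0).
- by apply: cvg_at_right_filter; apply: is_derive_cont (dF 0 (lexx _)).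
- move=> y; rewrite in_itv /= andbT => y0; rewrite derive1E.
  by have [_ ->] := dF y (ltW y0).
Unshelve. all: by end_near. Qed.

(** Finiteness is essential: as a real number, an infinite integral would be 0. *)
Lemma lsp_le z : 0 <= z -> \int[leb]_(y in `[0, z]) lsp y <= I_infty.
Proof.
move=> z0; rewrite /I_infty.
have -> : \int[leb]_(y in `[0, +oo[) (Num.sqrt (y ^+ 3 + 1))^-1 =
   \int[leb]_(y in `[0, +oo[) lsp y.
  by apply: eq_Rintegral => y; rewrite inE /= in_itv /= andbT /lsp => y0; rewrite ger0_norm.
have mf (D : set (measurableTypeR R)) : measurable D -> measurable_fun D (EFin \o lsp).
  by move=> mD; apply/measurable_EFinP; apply: measurable_funS (continuous_measurable_fun lsp_cont).
have l0 y : (0 <= (lsp y)%:E)%E by rewrite lee_fin lsp_ge0.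
rewrite /Rintegral fine_le//.
- by apply: integrable_fin_num => //; apply: cint; exact: lsp_cont.
- by rewrite ge0_fin_numE ?lsp_integrable//; apply: integral_ge0.
- apply: ge0_subset_integral => //; first by apply: mf.
  by move=> y /=; rewrite !in_itv /= => /andP[-> _].
Qed.

End LifespanIntegral.

(** * The second-order Riccati comparison *)

Section Riccati.
Context {R : realType}.
Implicit Types (f g h : R -> R) (A : set R) (x y z s t a b : R).

Lemma within_comp A f g : {within A, continuous f} -> (forall x, A x -> {for f x, continuous g}) ->
  {within A, continuous (fun x => g (f x))}.
Proof.
move=> /subspace_continuousP cf cg; apply/subspace_continuousP => x Ax.
by apply: (@cvg_comp _ _ _ f g _ _ _ (cf x Ax)); exact: cg.
Qed.

Lemma withinB A f g : {within A, continuous f} -> {within A, continuous g} ->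
  {within A, continuous (fun x => f x - g x)}.
Proof.
move=> /subspace_continuousP cf /subspace_continuousP cg; apply/subspace_continuousP => x Ax.
exact: cvgB (cf x Ax) (cg x Ax).
Qed.

Lemma within_subitv f a b c d : a <= c -> d <= b -> {within `[a, b], continuous f} ->
  {within `[c, d], continuous f}.
Proof.
move=> ac db; apply: continuous_subspaceW => x; rewrite /= !in_itv /= => /andP[h1 h2].
by rewrite (le_trans ac)//= (le_trans h2).
Qed.

(* J'' >= k J^2 gives J'^2 >= C^2 + (2k/3) (J - J(0))^3; with z = (J - J(0)) / l this reads
   z' >= (C / l) sqrt (1 + z^3), and separating variables leads to I_infty. *)
Lemma riccati_lifespan (J J1 J2 : R -> R) (t1 k C l : R) : 0 < t1 -> 0 < k -> 0 < C -> 0 < l ->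
  2 / 3 * k * l ^+ 3 = C ^+ 2 ->
  (forall t, 0 < t < t1 -> is_derive t 1 J (J1 t)) ->
  (forall t, 0 < t < t1 -> is_derive t 1 J1 (J2 t)) ->
  {within `[0, t1], continuous J} -> {within `[0, t1], continuous J1} ->
  (forall t, 0 <= t <= t1 -> 0 <= J t) ->
  (forall t, 0 < t < t1 -> k * J t ^+ 2 <= J2 t) ->
  J1 0 = C -> C / l * t1 <= I_infty.
Proof.
move=> t10 k0 C0 l0 lE dJ dJ1 cJ cJ1 J0 HJ2 J10.
have w t : t <= t1 -> forall x, 0 < x < t -> 0 < x < t1.
  by move=> tt x /andP[-> /= h]; exact: lt_le_trans tt.
have HJ1 t : 0 <= t -> t <= t1 -> C <= J1 t.
  move=> t0 tt; rewrite -J10; apply: (@mono_of_derive _ _ J2 _ _ t0).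
  - by move=> x /(w t tt); exact: dJ1.
  - exact: within_subitv cJ1.
  - move=> x /(w t tt) xt; apply: le_trans (HJ2 x xt); by rewrite mulr_ge0 ?sqr_ge0// ltW.
have HJ t : 0 <= t -> t <= t1 -> J 0 <= J t.
  move=> t0 tt; apply: (@mono_of_derive _ _ J1 _ _ t0).
  - by move=> x /(w t tt); exact: dJ.
  - exact: within_subitv cJ.
  - move=> x /(w t tt) /andP[x0 xt]; apply: le_trans (HJ1 x (ltW x0) (ltW xt)); exact: ltW.
(* The energy J'^2 - (2/3) k J^3 has derivative 2 J' (J'' - k J^2), nonnegative because J' >= C >
   0. *)
have HE t : 0 <= t -> t <= t1 -> C ^+ 2 + 2 / 3 * k * (J t ^+ 3 - J 0 ^+ 3) <= J1 t ^+ 2.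
  move=> t0 tt; pose E x := J1 x ^+ 2 - 2 / 3 * k * J x ^+ 3.
  have : E 0 <= E t.
    apply: (@mono_of_derive _ _ (fun x => 2 * J1 x * (J2 x - k * J x ^+ 2)) _ _ t0).
    - move=> x /(w t tt) xt; have d1 := dJ x xt; have d2 := dJ1 x xt.
      rewrite /E; drv; by rewrite /=; field.
    - apply: withinB; apply: within_subitv (lexx _) tt _.
        apply: (@within_comp _ J1 (fun y => y ^+ 2)) => // x _.
        have c : continuous (fun y : R => y ^+ 2) by cts.
        exact: c.
      apply: (@within_comp _ J (fun y => 2 / 3 * k * y ^+ 3)) => // x _.
      have c : continuous (fun y : R => 2 / 3 * k * y ^+ 3) by cts.
        exact: c.
    - move=> x /(w t tt) xt; have := HJ2 x xt; rewrite -subr_ge0 => h.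
      case/andP: xt => x0 xt; have := HJ1 x (ltW x0) (ltW xt) => h1.
      by apply: mulr_ge0 => //; rewrite mulr_ge0// (le_trans _ h1)// ltW.
  by rewrite /E J10; lra.
pose z t := (J t - J 0) / l.
have z0 t : 0 <= t -> t <= t1 -> 0 <= z t.
  by move=> t0 tt; rewrite divr_ge0 ?(ltW l0)// subr_ge0 HJ.
have HJz t : 0 <= t -> t <= t1 -> C <= J1 t * lsp (z t).
  move=> t0 tt; rewrite /lsp ler_pdivlMr ?lsp_arg// ger0_norm ?z0//.
  have J1p : 0 <= J1 t by rewrite (le_trans _ (HJ1 t t0 tt))// ltW.
  rewrite -(@ler_pXn2r _ 2) ?nnegrE ?mulr_ge0 ?sqrtr_ge0 ?(ltW C0)//.
  rewrite exprMn sqr_sqrtr ?addr_ge0 ?exprn_ge0 ?z0//.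
  apply: le_trans (HE t t0 tt); rewrite mulrDr mulr1 addrC lerD2l -lE.
  have -> : 2 / 3 * k * l ^+ 3 * z t ^+ 3 = 2 / 3 * k * (J t - J 0) ^+ 3.
    by rewrite -[LHS]mulrA -exprMn /z [l * _]mulrC divfK ?gt_eqF.
  rewrite ler_wpM2l ?mulr_ge0 ?(ltW k0)//.
  have := HJ t t0 tt; have J00 : 0 <= J 0 by rewrite J0// lexx ltW.
  move: (J t) (J 0) J00 => p q q0 qp; rewrite -subr_ge0.
  (* For p >= q >= 0 the difference of cubes dominates the cube of the difference, so z can start
     from 0 whatever J(0) is. *)
  have -> : p ^+ 3 - q ^+ 3 - (p - q) ^+ 3 = 3 * (q * (p * (p - q))) by ring.
  by rewrite !mulr_ge0 ?subr_ge0// (le_trans q0).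
have [F [dF FE]] := @prim R lsp (-1) lsp_cont.
have m1 x : 0 <= x -> -1 < x by move=> x0; apply: lt_le_trans x0; rewrite ltrN10.
pose G t := F (z t) - C / l * t.
have G01 : G 0 <= G t1.
  apply: (@mono_of_derive _ _ (fun t => lsp (z t) * (J1 t / l) - C / l) _ _ (ltW t10)).
  - move=> x xt; have d1 := dJ x xt; case/andP: xt => x0 xt.
    have dz : is_derive x 1 z (J1 x / l) by rewrite /z; drv; rewrite /=; ring.
    have d2 : is_derive x 1 (fun y => F (z y)) (lsp (z x) * (J1 x / l)).
      by apply: (@dcomp _ z F) => //; apply: dF; apply: m1; apply: z0; exact: ltW.
    rewrite /G; drv; rewrite /=; ring.
  - have cl : continuous (fun t : R => C / l * t) by cts.
    apply: withinB; last exact: continuous_subspaceT.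
    apply: (@within_comp _ z F).
      apply: (@within_comp _ J (fun y => (y - J 0) / l)) => // x _.
      have c : continuous (fun y : R => (y - J 0) / l) by cts.
        exact: c.
    move=> x; rewrite /= in_itv /= => /andP[x0 xt].
    by apply: is_derive_cont; apply: dF; apply: m1; exact: z0.
  - move=> x /andP[x0 xt]; have := HJz x (ltW x0) (ltW xt) => h.
    by rewrite mulrA -mulrBl divr_ge0 ?(ltW l0)// subr_ge0 mulrC.
have z00 : z 0 = 0 by rewrite /z subrr mul0r.
have zt1 := z0 t1 (ltW t10) (lexx _).
apply: le_trans (lsp_le zt1); rewrite FE ?m1//.
by move: G01; rewrite /G z00 mulr0 subr0; lra.
Qed.
End Riccati.

(** * Support of the solution and the evolution of J *)

Section SolutionCurves.
Context {R : realType}.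
Implicit Types (f g h phi : R -> R) (x y z s t a b d e : R) (D : set R).

Definition solves D (u v : R -> R -> R) : Prop := exists u' v' : R -> R -> R,
  [/\ curve D u u', curve D v v'
    & forall t, D t -> u' t = (fun x => 2 * u t x * v t x) /\ v' t = hil (fun x => u t x ^+ 2)].

Lemma bfun_eval x : bfun (fun f : R -> R => f x) 5.
Proof. by split=> // f Hf; exact: sup_nrm. Qed.

Lemma bfun_int phi : continuous phi -> periodic phi (2 * pi) ->
  exists K, bfun (fun f => \int[leb]_(x in `[0, 2 * pi]) (phi x * f x)) K.
Proof.
move=> cp pp; have [M [M0 HM]] := periodic_bounded cp pp; have tp0 := @twopi_ge0 R.
exists (M * 5 * (2 * pi)); split.
- by rewrite !mulr_ge0 ?pi_ge0.
- move=> f g Hf Hg; have cf := H1per_cont Hf; have cg := H1per_cont Hg.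
  rewrite -intB; [|by cts..].
  by apply: eq_Rintegral => x _; rewrite mulrBr.
- move=> k f Hf; have cf := H1per_cont Hf; rewrite -intZ; last by cts.
  by apply: eq_Rintegral => x _; rewrite mulrCA.
- move=> f Hf; have cf := H1per_cont Hf.
  have := @int_abs_le R (fun x => phi x * f x) 0 (2 * pi) (M * (5 * nrm f)) tp0.
  rewrite subr0; have -> : M * 5 * (2 * pi) * nrm f = M * (5 * nrm f) * (2 * pi) by ring.
  apply; first by cts.
  by move=> x _; rewrite normrM ler_pM// sup_nrm.
Qed.

(** At fixed x, u^2 has derivative 4 u^2 v, so u^2 exp (- 4 V s) does not increase when V bounds
    |v(., x)| on [0, t]; starting from 0 it stays 0. *)
Lemma solves_zero D u v x t : solves D u v -> 0 <= t -> (forall s, 0 <= s -> s <= t -> D s) ->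
  u 0 x = 0 -> u t x = 0.
Proof.
move=> [u' [v' [cu cv E]]]; rewrite le_eqVlt => /orP[/eqP <- //|t0] HD u0.
have be := bfun_eval x.
have wu := bfun_within cu be HD; have wv := bfun_within cv be HD.
have [c _ HV] := @EVT_max R (fun s => `|v s x|) 0 t (ltW t0)
  ltac:(apply: (@within_comp R _ (fun s => v s x) (fun y => `|y|) wv) => y _; exact: norm_continuous).
set V := `|v c x| in HV.
pose e s := expR ((- 4 * V) * s).
have de s : is_derive s 1 e (e s * (- 4 * V)).
  have d1 : is_derive s 1 (fun s : R => - 4 * V * s) (- 4 * V) by drv; rewrite /=; ring.
  by apply: (@dcomp _ (fun s => - 4 * V * s) expR).
have ce : continuous e by move=> s; exact: is_derive_cont (de s).
pose h s := - (u s x ^+ 2 * e s).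
have h01 : h 0 <= h t.
  apply: (@mono_of_derive _ h (fun s => 4 * (u s x ^+ 2) * (V - v s x) * e s) _ _ (ltW t0)).
  - move=> s /andP[s0 st].
    have du : is_derive s 1 (fun s => u s x) (u' s x).
      apply: (@bfun_derive _ _ _ _ _ _ _ (Num.min s (t - s)) cu be).
        by rewrite lt_min s0 subr_gt0.
      move=> r; rewrite lt_min !ltr_norml => /andP[/andP[r1 r2] /andP[r3 r4]]; apply: HD; lra.
    have [Eu _] := E s (HD s (ltW s0) (ltW st)); rewrite Eu in du.
    have d2 := de s; rewrite /h; drv; rewrite /=; ring.
  - have w1 : {within `[0, t], continuous (fun s => u s x * u s x)}.
      have cs : continuous (fun y : R => y * y) by cts.
      by apply: (@within_comp R _ (fun s => u s x) (fun y => y * y) wu) => y _; exact: cs.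
    apply/subspace_continuousP => s sA; apply: cvgN; apply: cvgM.
      have cs : continuous (fun y : R => y ^+ 2) by cts.
      move/subspace_continuousP : wu => /(_ s sA) wus.
      by apply: (@cvg_comp _ _ _ (fun s => u s x) (fun y => y ^+ 2) _ _ _ wus); exact: cs.
    have /continuous_subspaceT H : continuous e by exact: ce.
    by move/subspace_continuousP : (H `[0, t]%classic) => /(_ s sA).
  - move=> s /andP[s0 st]; apply: mulr_ge0; last exact: expR_ge0.
    apply: mulr_ge0; first by rewrite mulr_ge0 ?sqr_ge0.
    by rewrite subr_ge0; apply: le_trans (ler_norm _) (HV s _); rewrite in_itv /= !ltW.
have ut : u t x ^+ 2 * e t <= 0 by move: h01; rewrite /h u0 expr0n /= mul0r oppr0 oppr_ge0.
have : u t x ^+ 2 <= 0 by rewrite -(pmulr_lle0 _ (expR_gt0 (- 4 * V * t))).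
by rewrite exprn_even_le0//= => /eqP.
Qed.

Lemma int_support f a b : 0 <= a -> a < b -> b <= 2 * pi -> continuous f ->
  (forall x, 0 <= x <= 2 * pi -> f x != 0 -> a < x < b) ->
  \int[leb]_(x in `[0, 2 * pi]) f x = \int[leb]_(x in `[a, b]) f x.
Proof.
move=> a0 ab b2 cf Hf.
have z c d : c <= d -> (forall x, c <= x <= d -> f x = 0) -> \int[leb]_(x in `[c, d]) f x = 0.
  move=> cd H; rewrite -[RHS](mul0r (d - c)) -(@int_cst R 0 c d cd).
  by apply: eq_Rintegral => x; rewrite inE /= in_itv /=; exact: H.
rewrite (@int_split R f 0 (2 * pi) a cf a0); last by rewrite (le_trans (ltW ab)).
rewrite (@int_split R f a (2 * pi) b cf (ltW ab) b2) z// ?add0r; last first.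
  move=> x /andP[x0 xa]; apply/eqP/negPn/negP => fx.
  by have := Hf x; rewrite x0 (le_trans xa (le_trans (ltW ab) b2)) fx ltNge xa => /(_ isT isT).
rewrite (z b (2 * pi))// ?addr0// => x /andP[x0 xa]; apply/eqP/negPn/negP => fx.
by have := Hf x; rewrite xa (le_trans a0 (le_trans (ltW ab) x0)) fx (ltNge x) x0 andbF => /(_ isT isT).
Qed.

(** With w = u^2 and q = w v, the functions of [riccati_lifespan] are the phi-weighted integral of w
    and 4 times those of q and of its time derivative q'. *)
Lemma solves_lifespan D u v phi a b t1 l : solves D u v -> 0 < t1 ->
  (forall s, 0 <= s -> s <= t1 -> D s) ->
  0 <= a -> a < b -> b <= 2 * pi -> b - a < pi ->
  (forall x, 0 <= x <= 2 * pi -> u 0 x != 0 -> a < x < b) ->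
  continuous phi -> periodic phi (2 * pi) -> (forall x, a <= x <= b -> phi x = x - a) ->
  let C := 4 * \int[leb]_(x in `[a, b]) (phi x * u 0 x ^+ 2 * v 0 x) in
  let k := 2 * cos ((b - a) / 2) / (pi * (b - a) ^+ 2) in
  0 < C -> 0 < l -> 2 / 3 * k * l ^+ 3 = C ^+ 2 -> C / l * t1 <= I_infty.
Proof.
move=> su t10 HD a0 ab b2 ba Hsupp cp pp Hphi C k C0 l0 lE.
have [u' [v' [cu cv E]]] := su.
have [K bl] := bfun_int cp pp; set lf := (fun f => _) in bl.
have cw := curve_mul cu cu; have cq := curve_mul cw cv.
set w := (fun t x => u t x * u t x) in cw cq; set q := (fun t x => w t x * v t x) in cq.
set w' := (fun t x => _ + _) in cw; set q' := (fun t x => _ + _) in cq.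
have [_ lB lZ _] := bl.
have d0 : 0 < b - a by rewrite subr_gt0.
have p0 := @pi_gt0 R; have tp0 := @twopi_ge0 R.
have cos0 : 0 < cos ((b - a) / 2) by apply: cos_gt0_pihalf; apply/andP; split; lra.
have k0 : 0 < k by rewrite divr_gt0 ?mulr_gt0 ?exprn_gt0.
have supp t : 0 <= t -> t <= t1 -> forall x, 0 <= x <= 2 * pi -> u t x != 0 -> a < x < b.
  move=> t0 tt x x2 ut; apply: Hsupp => //; apply: contra ut => /eqP u0.
  apply/eqP; apply: (solves_zero su t0) => // s s0 st; apply: HD => //; exact: le_trans st tt.
have phi0 t : 0 <= t -> t <= t1 -> forall x, 0 <= x <= 2 * pi -> 0 <= phi x * w t x /\ phi x * w t x <= (b - a) * w t x.
  move=> t0 tt x x2; have [u0|un] := eqVneq (u t x) 0; first by rewrite /w u0 !mul0r !mulr0.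
  have /andP[ax xb] := supp t t0 tt x x2 un; have w0 : 0 <= w t x by rewrite /w -expr2 sqr_ge0.
  rewrite Hphi ?(ltW ax) ?(ltW xb)//; split; first by rewrite mulr_ge0// subr_ge0 ltW.
  by rewrite ler_wpM2r// lerD2r ltW.
have op t : 0 < t < t1 -> 0 < Num.min t (t1 - t) /\ (forall s, `|s - t| < Num.min t (t1 - t) -> D s).
  move=> /andP[t0 tt]; split; first by rewrite lt_min t0 subr_gt0.
  by move=> r; rewrite lt_min !ltr_norml => /andP[/andP[r1 r2] /andP[r3 r4]]; apply: HD; lra.
have [H1 _ _] := cw; have [H2 _ _] := cq; have [Hu _ _] := cu; have [Hv _ _] := cv.
have w'E t : D t -> w' t = (fun x => 4 * q t x).
  by move=> Dt; apply/funext => x; have [Eu _] := E t Dt; rewrite /w' Eu /q /w; ring.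
have D0 : D 0 by apply: HD => //; exact: ltW.
apply: (@riccati_lifespan R (fun t => lf (w t)) (fun t => 4 * lf (q t)) (fun t => 4 * lf (q' t)) t1 k C l) => //.
- move=> t tt; have [r0 Hr] := op t tt; have Dt : D t by apply: Hr; rewrite subrr normr0.
  apply: dEq; first exact: bfun_derive cw bl r0 Hr.
  by rewrite w'E// lZ//; have [] := H2 t Dt.
- move=> t tt; have [r0 Hr] := op t tt; have d1 := bfun_derive cq bl r0 Hr.
  drv; rewrite /=; ring.
- exact: bfun_within cw bl HD.
- have cs : continuous (fun y : R => 4 * y) by cts.
  by apply: (@within_comp R _ (fun t => lf (q t)) (fun y => 4 * y) (bfun_within cq bl HD)) => y _; exact: cs.
- move=> t /andP[t0 tt]; apply: Rintegral_ge0 => //= x; rewrite in_itv /= => x2.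
  by have [] := phi0 t t0 tt x x2.
- move=> t /andP[/ltW t0 /ltW tt]; have Dt := HD t t0 tt.
  have [Hut _] := Hu t Dt; have [Hvt _] := Hv t Dt; have [Hwt _] := H1 t Dt.
  have [_ Ev] := E t Dt; have cut := H1per_cont Hut; have cvt := H1per_cont Hvt.
  have cwt := H1per_cont Hwt; have [Hh _] := hil_H1 Hwt; have ch := H1per_cont Hh.
  have w0 x : 0 <= w t x by rewrite /w -expr2 sqr_ge0.
  have suppw x : 0 <= x <= 2 * pi -> w t x != 0 -> a < x < b.
    by move=> x2 wx; apply: (supp t t0 tt x x2); apply: contra wx => /eqP u0; rewrite /w u0 mul0r.
  have V := virial_hil a0 ab b2 ba Hwt w0 cp pp Hphi suppw.
  have Eh : v' t = hil (w t) by rewrite Ev; congr hil; apply/funext => x; rewrite expr2.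
  have h1 : \int[leb]_(x in `[0, 2 * pi]) (phi x * w t x * hil (w t) x) <= lf (q' t).
    apply: (@int_le R (fun x => phi x * w t x * hil (w t) x) (fun x => phi x * q' t x)).
    - by cts.
    - have [_ Hq'] := H2 t Dt; have cq' := H1per_cont Hq'; by cts.
    - move=> x x2; have Ew : w' t x = 4 * q t x by rewrite w'E.
      have -> : q' t x = w' t x * v t x + w t x * v' t x by [].
      rewrite Ew Eh /q.
      have [h _] := phi0 t t0 tt x x2.
      (* The term with v^2 is nonnegative, so only the Hilbert transform term is kept. *)
      have -> : phi x * (4 * (w t x * v t x) * v t x + w t x * hil (w t) x) =
        4 * (phi x * w t x) * v t x ^+ 2 + phi x * w t x * hil (w t) x by ring.
      by rewrite lerDr; apply: mulr_ge0; [exact: mulr_ge0|exact: sqr_ge0].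
  have h2 : lf (w t) <= (b - a) * \int[leb]_(x in `[0, 2 * pi]) w t x.
    rewrite -intZ//; apply: (@int_le R (fun x => phi x * w t x) (fun x => (b - a) * w t x)); [by cts|by cts|].
    by move=> x x2; have [] := phi0 t t0 tt x x2.
  have h3 : 0 <= lf (w t).
    apply: Rintegral_ge0 => //= x; rewrite in_itv /= => x2.
    by have [] := phi0 t t0 tt x x2.
  move: V h1 h2 h3; move: (lf (w t)) (lf (q' t)) (\int[leb]_(x in `[0, 2 * pi]) w t x) => J J2 W V h1 h2 h3.
  (* On the support phi is at most b - a, so J <= (b - a) W; this trades the W^2 of the virial bound
     for J^2 and puts (b - a)^2 into the denominator of k. *)
  have h4 : J ^+ 2 <= ((b - a) * W) ^+ 2 by rewrite lerXn2r ?nnegrE// (le_trans h3).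
  have h5 := le_trans V h1; rewrite /k.
  have -> : 2 * cos ((b - a) / 2) / (pi * (b - a) ^+ 2) * J ^+ 2 =
     4 * (cos ((b - a) / 2) / (2 * pi) / (b - a) ^+ 2 * J ^+ 2).
    have dn : b - a != 0 by rewrite gt_eqF.
    have pn : pi != 0 :> R by rewrite gt_eqF.
    move: (cos ((b - a) / 2)) => c; move: (b - a) dn (pi : R) pn => d dn p pn.
    by field; rewrite dn pn.
  rewrite ler_pM2l//; apply: le_trans h5.
  rewrite -mulrA; apply: ler_wpM2l.
    by apply: divr_ge0; [exact: ltW|exact: tp0].
  by rewrite mulrC ler_pdivrMr ?exprn_gt0// (le_trans h4)// exprMn mulrC.
- rewrite /C; congr (4 * _); rewrite /lf.
  have [Hut _] := Hu 0 D0; have [Hvt _] := Hv 0 D0.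
  have cut := H1per_cont Hut; have cvt := H1per_cont Hvt.
  have -> : \int[leb]_(x in `[0, 2 * pi]) (phi x * q 0 x) =
    \int[leb]_(x in `[0, 2 * pi]) (phi x * u 0 x ^+ 2 * v 0 x).
    by apply: eq_Rintegral => x _; rewrite /q /w; ring.
  apply: int_support => //; first by cts.
  by move=> x x2 h; apply: Hsupp => //; apply: contra h => /eqP ->; rewrite expr0n /= mulr0 mul0r.
Qed.

End SolutionCurves.

(** * Geometrically convergent real series and Cauchy products *)

Section GeometricSeries.
Context {R : realType}.
Implicit Types (a b : nat -> R) (A B L q : R) (n m k N M : nat).

Definition psum a N : R := \sum_(i < N) a i.

Lemma psumS a N : psum a N.+1 = psum a N + a N.
Proof. by rewrite /psum big_ord_recr. Qed.

Lemma psum0 a : psum a 0 = 0. Proof. by rewrite /psum big_ord0. Qed.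

(** For q <= 1/2 each term A q^M is at most 2 A (q^M - q^(M+1)), so the bound telescopes. *)
Lemma psum_tail a A q N M : 0 <= q -> q <= 2^-1 -> (forall n, `|a n| <= A * q ^+ n) -> (N <= M)%N ->
  `|psum a M - psum a N| <= 2 * A * (q ^+ N - q ^+ M).
Proof.
move=> q0 q2 aA; have A0 : 0 <= A by have := aA 0%N; rewrite expr0 mulr1; apply: le_trans.
elim: M => [|M IH]; first by rewrite leqn0 => /eqP ->; rewrite !subrr normr0 mulr0.
rewrite leq_eqVlt => /orP[/eqP ->|]; first by rewrite !subrr normr0 mulr0.
rewrite ltnS => NM; rewrite psumS addrAC; apply: le_trans (ler_normD _ _) _.
apply: le_trans (lerD (IH NM) (aA M)) _.
have : 0 <= A * (q ^+ M * (1 - 2 * q)).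
  by rewrite mulr_ge0// mulr_ge0 ?exprn_ge0// subr_ge0 mulrC -ler_pdivlMr// mul1r.
by rewrite exprS; move: (q ^+ M) (q ^+ N) => x y; lra.
Qed.

(* The sum of a series whose partial sums converge geometrically (ratio 1/2); 0 otherwise. *)
Definition ser a : R := xget 0 [set L | exists A, forall N, `|L - psum a N| <= A * (2^-1) ^+ N].

Lemma serP a L A : (forall N, `|L - psum a N| <= A * (2^-1) ^+ N) -> ser a = L.
Proof.
move=> H; have [A' H'] : exists A, forall N, `|ser a - psum a N| <= A * (2^-1) ^+ N.
  by apply: (@xgetPex R 0 [set L | exists A, forall N, `|L - psum a N| <= A * (2^-1) ^+ N]); exists L, A.
apply/eqP; rewrite -subr_eq0 -normr_le0; apply: (@half_pow_le0 R _ (A' + A) 0) => m _.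
have := H m; have := H' m; rewrite mulrDl !ler_norml => /andP[? ?] /andP[? ?]; apply/andP; split; lra.
Qed.

Lemma ser_ex a A : (forall n, `|a n| <= A * (2^-1) ^+ n) ->
  exists L, forall N, `|L - psum a N| <= 2 * A * (2^-1) ^+ N.
Proof.
move=> aA; have A0 : 0 <= A by have := aA 0%N; rewrite expr0 mulr1; apply: le_trans.
have h0 : 0 <= 2^-1 :> R by rewrite invr_ge0.
have T N M : (N <= M)%N -> `|psum a M - psum a N| <= 2 * A * ((2^-1) ^+ N - (2^-1) ^+ M).
  exact: psum_tail.
pose S := [set y : R | exists N, y = psum a N + 2 * A * (2^-1) ^+ N].
have lb N : lbound S (psum a N - 2 * A * (2^-1) ^+ N).
  move=> _ [M ->]; have pN : 0 <= A * (2^-1) ^+ N by rewrite mulr_ge0 ?exprn_ge0.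
  have pM : 0 <= A * (2^-1) ^+ M by rewrite mulr_ge0 ?exprn_ge0.
  by have [NM|/ltnW NM] := leqP N M; have := T _ _ NM; rewrite ler_norml => /andP[? ?]; lra.
exists (inf S) => N.
have hl : has_lbound S by exists (psum a 0 - 2 * A * (2^-1) ^+ 0); exact: lb.
have h1 : inf S <= psum a N + 2 * A * (2^-1) ^+ N by apply: ge_inf => //; exists N.
have h2 : psum a N - 2 * A * (2^-1) ^+ N <= inf S.
  by apply: lb_le_inf; [exists (psum a 0 + 2 * A * (2^-1) ^+ 0); exists 0%N|exact: lb].
by rewrite ler_norml; apply/andP; split; lra.
Qed.

Lemma pow_le_half q n : 0 <= q -> q <= 2^-1 -> q ^+ n <= (2^-1) ^+ n.
Proof. by move=> q0 q2; rewrite lerXn2r ?nnegrE ?invr_ge0. Qed.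

Lemma geo_half a A q : 0 <= q -> q <= 2^-1 -> (forall n, `|a n| <= A * q ^+ n) ->
  forall n, `|a n| <= A * (2^-1) ^+ n.
Proof.
move=> q0 q2 aA n; have A0 : 0 <= A by have := aA 0%N; rewrite expr0 mulr1; apply: le_trans.
by apply: le_trans (aA n) _; rewrite ler_wpM2l// pow_le_half.
Qed.

Lemma ser_tail a A q N : 0 <= q -> q <= 2^-1 -> (forall n, `|a n| <= A * q ^+ n) ->
  `|ser a - psum a N| <= 2 * A * q ^+ N.
Proof.
move=> q0 q2 aA; have A0 : 0 <= A by have := aA 0%N; rewrite expr0 mulr1; apply: le_trans.
have [L HL] := ser_ex (geo_half q0 q2 aA); rewrite (serP HL) -subr_le0.
apply: (@half_pow_le0 R _ (2 * A) N) => m Nm.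
have := HL m; have := psum_tail q0 q2 aA Nm.
have : 0 <= A * q ^+ m by rewrite mulr_ge0 ?exprn_ge0.
have := ler_normD (L - psum a m) (psum a m - psum a N); rewrite subrKA.
move: (q ^+ N) (q ^+ m) => x y; lra.
Qed.

Lemma ser_lin a b A B : (forall n, `|a n| <= A * (2^-1) ^+ n) -> (forall n, `|b n| <= B * (2^-1) ^+ n) ->
  forall c : R, ser (fun n => a n + c * b n) = ser a + c * ser b.
Proof.
move=> aA bB c; have h0 : 0 <= 2^-1 :> R by rewrite invr_ge0.
apply: (@serP _ _ (2 * A + `|c| * (2 * B))) => N.
have -> : psum (fun n => a n + c * b n) N = psum a N + c * psum b N.
  by rewrite /psum big_split /= mulr_sumr.
have -> : ser a + c * ser b - (psum a N + c * psum b N) = (ser a - psum a N) + c * (ser b - psum b N) by ring.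
apply: le_trans (ler_normD _ _) _; rewrite mulrDl normrM -(mulrA `|c|); apply: lerD.
  exact: ser_tail.
by apply: ler_wpM2l => //; exact: ser_tail.
Qed.

Lemma ser_shift a A : (forall n, `|a n| <= A * (2^-1) ^+ n) -> ser a = a 0%N + ser (fun n => a n.+1).
Proof.
move=> aA; have h0 : 0 <= 2^-1 :> R by rewrite invr_ge0.
suff -> : ser (fun n => a n.+1) = ser a - a 0%N by rewrite addrC subrK.
apply: (@serP _ _ (2 * A * 2^-1)) => N; have := @ser_tail a A _ N.+1 h0 (lexx _) aA.
by rewrite /psum big_ord_recl /= opprD addrA exprS mulrA.
Qed.

Definition conv a b n : R := \sum_(k < n.+1) a k * b (n - k)%N.

Lemma psum_conv a b N : psum (conv a b) N = \sum_(k < N) a k * psum b (N - k).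
Proof.
elim: N => [|N IH]; first by rewrite psum0 big_ord0.
rewrite psumS IH /conv [RHS]big_ord_recr /= [X in _ + X = _]big_ord_recr /= addrA -big_split /=.
congr (_ + _); last by rewrite subnn subSnn /psum big_ord1.
by apply: eq_bigr => k _; rewrite subSn ?psumS ?mulrDr// ltnW.
Qed.

Lemma nat_le_exp2 n : n%:R <= 2 ^+ n :> R.
Proof. by rewrite -natrX ler_nat ltnW// ltn_expl. Qed.

(** The ratio is 1/4 because the N remainders in the Cauchy product are each of order 4^-N; N 4^-N
    <= 2^-N restores the rate required by [serP]. *)
Lemma ser_conv a b A B : (forall n, `|a n| <= A * (4^-1) ^+ n) -> (forall n, `|b n| <= B * (4^-1) ^+ n) ->
  ser (conv a b) = ser a * ser b.
Proof.
move=> aA bB; have h0 : 0 <= 4^-1 :> R by rewrite invr_ge0.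
have h2 : 4^-1 <= 2^-1 :> R by rewrite lef_pV2 ?posrE// ler_nat.
have A0 : 0 <= A by have := aA 0%N; rewrite expr0 mulr1; apply: le_trans.
have B0 : 0 <= B by have := bB 0%N; rewrite expr0 mulr1; apply: le_trans.
apply: (@serP _ _ (A * (2 * B) + 2 * A * `|ser b|)) => N.
have -> : ser a * ser b - psum (conv a b) N =
   \sum_(k < N) a k * (ser b - psum b (N - k)) + (ser a - psum a N) * ser b.
  under eq_bigr do rewrite mulrBr.
  rewrite sumrB -psum_conv -mulr_suml -/(psum a N); ring.
apply: le_trans (ler_normD _ _) _; rewrite [leRHS]mulrDl; apply: lerD.
  apply: (@le_trans _ _ (\sum_(k < N) (A * (2 * B) * (4^-1) ^+ N))).
    apply: le_trans (ler_norm_sum _ _ _) _; apply: ler_sum => k _.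
    have -> : A * (2 * B) * 4^-1 ^+ N = (A * 4^-1 ^+ k) * (2 * B * 4^-1 ^+ (N - k)).
      by rewrite -{1}(subnKC (ltnW (ltn_ord k))) exprD; ring.
    by rewrite normrM ler_pM// ser_tail.
  rewrite sumr_const card_ord -[leLHS]mulr_natr -[leLHS]mulrA; apply: ler_wpM2l; first by rewrite !mulr_ge0.
  have -> : 4^-1 = 2^-1 * 2^-1 :> R by field.
  rewrite exprMn -mulrA ler_piMr ?exprn_ge0// ?invr_ge0//.
  by rewrite exprVn mulrC ler_pdivrMr ?exprn_gt0// mul1r nat_le_exp2.
rewrite normrM [leRHS]mulrAC ler_wpM2r//.
apply: le_trans (ser_tail N h0 h2 aA) _; rewrite ler_wpM2l ?mulr_ge0// pow_le_half//.
Qed.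

End GeometricSeries.

(** * Power series in time with coefficients in H^1 *)

Section SobolevSeries.
Context {R : realType}.
Implicit Types (f g h : R -> R) (x s t r A B K : R) (c d : nat -> R -> R) (n N M : nat).

Lemma H1per0 : H1per (fun _ : R => 0 : R).
Proof.
have [] // := @H1per_C1 R (fun _ => 0) (fun _ => 0) (fun x => dcst 0 x).
by cts.
Qed.

Lemma nrm_sum N c : (forall n, (n < N)%N -> H1per (c n)) ->
  H1per (fun x => \sum_(n < N) c n x) /\ nrm (fun x => \sum_(n < N) c n x) <= \sum_(n < N) nrm (c n).
Proof.
elim: N => [|N IH] Hc.
  rewrite (_ : (fun x => _) = fun _ => 0); last by apply/funext => x; rewrite big_ord0.
  by rewrite big_ord0 nrm0; split => //; exact: H1per0.
have [|IH1 IH2] := IH; first by move=> n nN; apply: Hc; exact: ltnW.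
rewrite (_ : (fun x => _) = fun x => \sum_(n < N) c n x + c N x); last first.
  by apply/funext => x; rewrite big_ord_recr.
have [H1 H2] := H1_add IH1 (Hc N (ltnSn N)); split => //.
by apply: le_trans H2 _; rewrite big_ord_recr lerD2r.
Qed.

Definition HS c x : R := ser (fun n => c n x).

Definition hgeo A c : Prop := forall n, H1per (c n) /\ nrm (c n) <= A * (2^-1) ^+ n.

Lemma hgeo_ge0 A c : hgeo A c -> 0 <= A.
Proof. by move=> /(_ 0%N) [_]; rewrite expr0 mulr1; apply: le_trans; exact: nrm_ge0. Qed.

Lemma hgeo_pointwise A c x : hgeo A c -> forall n, `|c n x| <= 5 * A * (2^-1) ^+ n.
Proof.
move=> Hc n; have [H1 H2] := Hc n; apply: le_trans (sup_nrm x H1) _.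
by rewrite -mulrA ler_wpM2l.
Qed.

(** The sum is defined pointwise. Its sections from N on are bounded in H^1 and converge uniformly,
    so [H1_closed] puts the tail in H^1 with the same bound. *)
Lemma HS_tail A c N : hgeo A c ->
  H1per (fun x => HS c x - \sum_(n < N) c n x) /\
  nrm (fun x => HS c x - \sum_(n < N) c n x) <= 2 * A * (2^-1) ^+ N.
Proof.
move=> Hc; have A0 := hgeo_ge0 Hc; have h0 : 0 <= 2^-1 :> R by rewrite invr_ge0.
have hN n : 0 <= (2^-1 : R) ^+ n by rewrite exprn_ge0.
apply: H1_closed; first by rewrite !mulr_ge0.
move=> e e0; have [m0 Hm0] := half_pow_small (2 * (5 * A)) e0.
pose M := (N + m0)%N; pose c' n := c (N + n)%N.
have Hc' n : H1per (c' n) by have [] := Hc (N + n)%N.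
exists (fun x => \sum_(n < m0) c' n x).
have [H1 H2] := @nrm_sum m0 c' (fun n _ => Hc' n); split => //.
  apply: le_trans H2 _.
  apply: (@le_trans _ _ (\sum_(n < m0) A * (2^-1) ^+ N * (2^-1) ^+ n)).
    by apply: ler_sum => n _; have [_] := Hc (N + n)%N; rewrite exprD mulrA.
  have g0 n : `|A * (2^-1) ^+ N * (2^-1) ^+ n| <= A * (2^-1) ^+ N * (2^-1) ^+ n :> R.
    by rewrite ger0_norm// !mulr_ge0.
  have := @psum_tail R (fun n => A * (2^-1) ^+ N * (2^-1) ^+ n) _ _ 0 m0 h0 (lexx _) g0 (leq0n _).
  rewrite psum0 subr0 expr0 => H; apply: le_trans (ler_norm _) (le_trans H _).
  rewrite -[X in _ <= X]mulr1 -(mulrA 2 A); apply: ler_wpM2l; first by rewrite !mulr_ge0.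
  by rewrite gerBl.
move=> x; have -> : HS c x - \sum_(n < N) c n x - \sum_(n < m0) c' n x = ser (fun n => c n x) - psum (fun n => c n x) (N + m0).
  by rewrite /HS /psum big_split_ord /= opprD addrA.
apply: le_trans (ser_tail _ h0 (lexx _) (hgeo_pointwise x Hc)) _.
by apply: Hm0; rewrite leq_addl.
Qed.

Lemma HS_H1 A c : hgeo A c -> H1per (HS c) /\ nrm (HS c) <= 2 * A.
Proof.
move=> Hc; have := HS_tail 0 Hc; rewrite expr0 mulr1.
by rewrite (_ : (fun x => _) = HS c)//; apply/funext => x; rewrite big_ord0 subr0.
Qed.

Lemma hil_HS A c : hgeo A c -> hil (HS c) = HS (fun n => hil (c n)).
Proof.
move=> Hc; have [HH _] := HS_H1 Hc; have h0 : 0 <= 2^-1 :> R by rewrite invr_ge0.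
apply/funext => x; apply/esym; apply: (@serP R _ _ (5 * (2 * A))) => N.
have Hc1 n : H1per (c n) by have [] := Hc n.
have -> : psum (fun n => hil (c n) x) N = hil (fun x => \sum_(n < N) c n x) x.
  elim: N => [|N IH].
    rewrite psum0 (_ : (fun x => _) = fun x => 0 * c 0%N x); first by rewrite hil_Z// mul0r.
    by apply/funext => y; rewrite big_ord0 mul0r.
  rewrite psumS IH -hil_D//; last by have [] := @nrm_sum N c (fun n _ => Hc1 n).
  by congr (hil _ x); apply/funext => y; rewrite big_ord_recr.
have [HN _] := @nrm_sum N c (fun n _ => Hc1 n).
rewrite -hil_B//; have [H1 H2] := HS_tail N Hc; have [H3 H4] := hil_H1 H1.
by apply: le_trans (sup_nrm x H3) _; rewrite -mulrA ler_wpM2l// (le_trans H4).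
Qed.

(** Second-order Taylor remainder of the n-th power, by induction on n; the factor r^2 on the left
    avoids the exponent n - 2. *)
Lemma pow_diff2 s t r n : `|s| <= r -> `|t| <= r ->
  r ^+ 2 * `|s ^+ n - t ^+ n - (s - t) * (n%:R * t ^+ n.-1)| <= n%:R ^+ 2 * r ^+ n * `|s - t| ^+ 2.
Proof.
move=> sr tr; have r0 : 0 <= r by apply: le_trans sr.
elim: n => [|n IH].
  by rewrite !expr0 subrr mul0r mulr0 subr0 normr0 mulr0 expr0n /= mul0r mul0r.
have -> : s ^+ n.+1 - t ^+ n.+1 - (s - t) * (n.+1%:R * t ^+ n.+1.-1) =
  s * (s ^+ n - t ^+ n - (s - t) * (n%:R * t ^+ n.-1)) + n%:R * t ^+ n.-1 * (s - t) ^+ 2.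
  case: n {IH} => [|n]; first by rewrite /= !expr0 !expr1; ring.
  by rewrite /= !exprS -[n.+2%:R]natr1 -[n.+1%:R]natr1; ring.
set X := (X in s * X) in IH *.
have h1 : r ^+ 2 * `|s * X| <= r * (n%:R ^+ 2 * r ^+ n * `|s - t| ^+ 2).
  rewrite normrM mulrCA; apply: ler_pM => //; by rewrite mulr_ge0 ?exprn_ge0.
have h2 : r ^+ 2 * `|n%:R * t ^+ n.-1 * (s - t) ^+ 2| <= n%:R * (r * r ^+ n) * `|s - t| ^+ 2.
  rewrite normrM normrX normrM normr_nat normrX [leLHS]mulrA; apply: ler_wpM2r; first exact: sqr_ge0.
  case: n {IH X h1} => [|n]; first by rewrite !mul0r mulr0.
  rewrite mulrCA; apply: ler_wpM2l => //=.
  have -> : r * r ^+ n.+1 = r ^+ 2 * r ^+ n by rewrite exprS; ring.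
  by apply: ler_wpM2l; [exact: exprn_ge0|rewrite lerXn2r ?nnegrE].
apply: le_trans (ler_wpM2l (exprn_ge0 2 r0) (ler_normD _ _)) _; rewrite mulrDr.
apply: le_trans (lerD h1 h2) _; rewrite -[n.+1%:R]natr1 [r ^+ n.+1]exprS.
have : 0 <= (n%:R + 1) * (r * r ^+ n) * `|s - t| ^+ 2.
  by rewrite !mulr_ge0 ?exprn_ge0 ?addr_ge0.
move: (n%:R : R) (r ^+ n) (`|s - t| ^+ 2) => p q y; lra.
Qed.

Definition cbd A K c : Prop := forall n, H1per (c n) /\ nrm (c n) <= A * K ^+ n.

Lemma cbd_ge0 A K c : cbd A K c -> 0 <= A.
Proof. by move=> /(_ 0%N) [_]; rewrite expr0 mulr1; apply: le_trans; exact: nrm_ge0. Qed.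

Definition ps c t x : R := HS (fun n x => t ^+ n * c n x) x.

Lemma cbd_pow A K c t q : cbd A K c -> 0 <= K -> `|t| * K <= q ->
  forall n, H1per (fun x => t ^+ n * c n x) /\ nrm (fun x => t ^+ n * c n x) <= A * q ^+ n.
Proof.
move=> Hc K0 tK n; have A0 := cbd_ge0 Hc; have [H1 H2] := Hc n; have [H3 _] := H1_scale (t ^+ n) H1; split => //.
rewrite nrm_Zeq// normrX; apply: le_trans (ler_wpM2l (exprn_ge0 n (normr_ge0 t)) H2) _.
rewrite mulrCA ler_wpM2l// -exprMn lerXn2r ?nnegrE ?mulr_ge0//.
by apply: le_trans tK; rewrite mulr_ge0.
Qed.

Lemma ps_H1 A K c t : cbd A K c -> 0 <= K -> `|t| * K <= 2^-1 -> H1per (ps c t) /\ nrm (ps c t) <= 2 * A.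
Proof. by move=> Hc K0 tK; apply: HS_H1; exact: cbd_pow Hc K0 tK. Qed.

Definition dcoef c n x : R := n.+1%:R * c n.+1 x.

Lemma nat_le_exp2S n : n.+1%:R <= 2 ^+ n :> R.
Proof. by rewrite -natrX ler_nat ltn_expl. Qed.

Lemma cbd_dcoef A K c : cbd A K c -> 0 <= K -> cbd (A * K) (2 * K) (dcoef c).
Proof.
move=> Hc K0 n; have A0 := cbd_ge0 Hc; have [H1 H2] := Hc n.+1; have [H3 _] := H1_scale n.+1%:R H1; split => //.
rewrite nrm_Zeq// normr_nat; apply: le_trans (ler_wpM2l (ler0n _ _) H2) _.
rewrite exprMn exprS; have -> : A * K * (2 ^+ n * K ^+ n) = 2 ^+ n * (A * (K * K ^+ n)) by ring.
by rewrite ler_wpM2r ?nat_le_exp2S// !mulr_ge0 ?exprn_ge0.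
Qed.

(** The remainder is itself a series, termwise bounded through [pow_diff2]; n^2 <= 4^n turns the
    polynomial factor into a ratio 4 r K, below 1/2. *)
Lemma ps_quadratic A K c s t r : cbd A K c -> 0 <= K -> 0 < r -> 16 * (r * K) <= 1 ->
  `|s| <= r -> `|t| <= r ->
  nrm (fun x => ps c s x - ps c t x - (s - t) * ps (dcoef c) t x) <= 2 * (A / r ^+ 2) * `|s - t| ^+ 2.
Proof.
move=> Hc K0 r0 rK sr tr; have A0 := cbd_ge0 Hc; have h0 : 0 <= 2^-1 :> R by rewrite invr_ge0.
have r2 : 0 < r ^+ 2 by rewrite exprn_gt0.
have rK0 : 0 <= r * K by rewrite mulr_ge0// ltW.
have small q z : `|z| <= r -> 16^-1 <= q -> `|z| * K <= q.
  by move=> zr hq; apply: le_trans (ler_wpM2r K0 zr) (le_trans _ hq); lra.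
pose D n x := (s ^+ n - t ^+ n - (s - t) * (n%:R * t ^+ n.-1)) * c n x.
have HD : hgeo (A / r ^+ 2 * `|s - t| ^+ 2) D.
  move=> n; have [H1 H2] := Hc n; split; first by have [] := H1_scale (s ^+ n - t ^+ n - (s - t) * (n%:R * t ^+ n.-1)) H1.
  rewrite nrm_Zeq// -(ler_pM2l r2) [leLHS]mulrA.
  apply: le_trans (ler_pM _ _ (pow_diff2 n sr tr) H2) _; [by rewrite mulr_ge0 ?sqr_ge0|exact: nrm_ge0|].
  have -> : r ^+ 2 * (A / r ^+ 2 * `|s - t| ^+ 2 * 2^-1 ^+ n) = A * 2^-1 ^+ n * `|s - t| ^+ 2.
    by move: (r ^+ 2) r2 => p p0; field; rewrite gt_eqF.
  have -> : n%:R ^+ 2 * r ^+ n * `|s - t| ^+ 2 * (A * K ^+ n) = A * (n%:R ^+ 2 * (r * K) ^+ n) * `|s - t| ^+ 2.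
    by rewrite exprMn; ring.
  apply: ler_wpM2r; first exact: sqr_ge0.
  apply: ler_wpM2l => //.
  apply: (@le_trans _ _ (4 ^+ n * (r * K) ^+ n)).
    apply: ler_wpM2r; first exact: exprn_ge0.
    have -> : 4 = 2 * 2 :> R by ring.
    by rewrite exprMn expr2 ler_pM ?nat_le_exp2.
  by rewrite -exprMn lerXn2r ?nnegrE ?mulr_ge0//; lra.
have -> : (fun x => ps c s x - ps c t x - (s - t) * ps (dcoef c) t x) = HS D.
  apply/funext => x.
  have tb z : `|z| <= r -> hgeo A (fun n x => z ^+ n * c n x).
    move=> zr; apply: cbd_pow Hc K0 _; apply: small => //; by rewrite lef_pV2 ?posrE// ler_nat.
  have g1 := hgeo_pointwise x (tb s sr); have g2 := hgeo_pointwise x (tb t tr).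
  have g3 := hgeo_pointwise x HD.
  have g4 : forall n, `|n%:R * t ^+ n.-1 * c n x| <= 5 * (A * K) * 2 * (2^-1) ^+ n.
    case=> [|n]; first by rewrite mul0r mul0r normr0 !mulr_ge0.
    have dt : `|t| * (2 * K) <= 2^-1 by have := ler_wpM2r K0 tr; lra.
    have := hgeo_pointwise x (cbd_pow (cbd_dcoef Hc K0) (mulr_ge0 (ler0n _ 2) K0) dt) n.
    rewrite /dcoef exprS; have -> : t ^+ n * (n.+1%:R * c n.+1 x) = n.+1%:R * t ^+ n * c n.+1 x by ring.
    by have -> : 5 * (A * K) * 2 * (2^-1 * 2^-1 ^+ n) = 5 * (A * K) * 2^-1 ^+ n by move: (2^-1 ^+ n) => y; field.
  have E1 := ser_lin g1 g2 (-1).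
  have g5 : forall n, `|s ^+ n * c n x + -1 * (t ^+ n * c n x)| <= (5 * A + 5 * A) * (2^-1) ^+ n.
    move=> n; apply: le_trans (ler_normD _ _) _; rewrite mulrDl lerD// normrM normrN1 mul1r//.
  have E2 := ser_lin g5 g4 (- (s - t)).
  have E3 := ser_shift g4; rewrite mul0r mul0r add0r in E3.
  rewrite /ps /HS.
  have -> : ser (fun n => D n x) = ser (fun n => s ^+ n * c n x + -1 * (t ^+ n * c n x) + - (s - t) * (n%:R * t ^+ n.-1 * c n x)).
    by congr ser; apply/funext => n; rewrite /D; ring.
  rewrite E2 E1 E3; have -> : ser (fun n => n.+1%:R * t ^+ n.+1.-1 * c n.+1 x) = ser (fun n => t ^+ n * dcoef c n x).
    by congr ser; apply/funext => n; rewrite /dcoef /=; ring.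
  ring.
by have [_] := HS_H1 HD; rewrite mulrA.
Qed.

(** Formal differentiation doubles K, since n + 1 <= 2^n. The 32 lets [ps_quadratic] be applied to
    the derived series as well, which gives continuity of the derivative. *)
Lemma ps_curve A K c r : cbd A K c -> 0 <= K -> 0 < r -> 32 * (r * K) <= 1 ->
  curve [set t | `|t| <= r] (ps c) (ps (dcoef c)).
Proof.
move=> Hc K0 r0 rK; have A0 := cbd_ge0 Hc.
have K20 : 0 <= 2 * K by rewrite mulr_ge0.
have rK0 : 0 <= r * K by rewrite mulr_ge0// ltW.
have r2 : 0 < r ^+ 2 by rewrite exprn_gt0.
have Hd := cbd_dcoef Hc K0.
have hs t : `|t| <= r -> `|t| * K <= 2^-1 by move=> tr; have := ler_wpM2r K0 tr; lra.
have hs2 t : `|t| <= r -> `|t| * (2 * K) <= 2^-1 by move=> tr; have := ler_wpM2r K0 tr; lra.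
have hs4 t : `|t| <= r -> `|t| * (2 * (2 * K)) <= 2^-1 by move=> tr; have := ler_wpM2r K0 tr; lra.
have H16 : 16 * (r * K) <= 1 by lra.
have H16' : 16 * (r * (2 * K)) <= 1 by lra.
split.
- move=> t tr; have [h1 _] := ps_H1 Hc K0 (hs t tr); have [h2 _] := ps_H1 Hd K20 (hs2 t tr); by [].
- move=> t e tr e0; set B := 2 * (A / r ^+ 2).
  have B0 : 0 <= B by rewrite mulr_ge0// divr_ge0// ltW.
  have [d [d0 Bd]] := bfun_small B0 e0; exists d; split => // s sr st.
  apply: le_trans (ps_quadratic Hc K0 r0 H16 sr tr) _.
  rewrite -/B expr2 mulrA ler_wpM2r//.
  by apply: le_trans Bd; rewrite ler_wpM2l// ltW.
- move=> t e tr e0; set B := 2 * (A * K / r ^+ 2); set N := nrm (ps (dcoef (dcoef c)) t).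
  have B0 : 0 <= B by apply: mulr_ge0 => //; apply: divr_ge0; [exact: mulr_ge0|exact: ltW].
  have BN : 0 <= B + N by rewrite addr_ge0// nrm_ge0.
  have [d [d0 Bd]] := bfun_small BN e0; exists (Num.min 1 d); split; first by rewrite lt_min ltr01.
  move=> s sr; rewrite lt_min => /andP[s1 sd].
  have Hdd := cbd_dcoef Hd K20.
  have [h1 _] := ps_H1 Hd K20 (hs2 s sr); have [h2 _] := ps_H1 Hd K20 (hs2 t tr).
  have [h3 _] := ps_H1 Hdd (mulr_ge0 (ler0n _ 2) K20) (hs4 t tr).
  have [P1 _] := H1_sub h1 h2; have [P2 _] := H1_scale (s - t) h3; have [P3 _] := H1_sub P1 P2.
  have [_] := H1_add P3 P2.
  have -> : (fun x => ps (dcoef c) s x - ps (dcoef c) t x - (s - t) * ps (dcoef (dcoef c)) t x +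
     (s - t) * ps (dcoef (dcoef c)) t x) = (fun x => ps (dcoef c) s x - ps (dcoef c) t x).
    by apply/funext => x; rewrite subrK.
  move=> h; apply: le_trans h _; rewrite nrm_Zeq// -/N.
  have q := ps_quadratic Hd K20 r0 H16' sr tr; rewrite -/B in q.
  apply: le_trans (lerD q (lexx _)) (le_trans _ Bd).
  apply: (@le_trans _ _ ((B + N) * `|s - t|)); last by rewrite ler_wpM2l// ltW.
  by rewrite mulrDl [N * _]mulrC lerD2r ler_wpM2l// expr2 ler_piMr// (ltW s1).
Qed.

Definition hconv c d n x : R := conv (fun n => c n x) (fun n => d n x) n.

(** The factor n + 1 is kept explicit because the recursion for the Taylor coefficients divides by
    it, so no growth beyond K^n accumulates. *)
Lemma hconv_bound A K c d n : 0 <= A -> 0 <= K ->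
  (forall k, (k <= n)%N -> H1per (c k) /\ nrm (c k) <= A * K ^+ k) ->
  (forall k, (k <= n)%N -> H1per (d k) /\ nrm (d k) <= A * K ^+ k) ->
  H1per (hconv c d n) /\ nrm (hconv c d n) <= n.+1%:R * (10 * A ^+ 2 * K ^+ n).
Proof.
move=> A0 K0 Hc Hd; pose g k x := c k x * d (n - k)%N x.
have Hg k : (k < n.+1)%N -> H1per (g k) /\ nrm (g k) <= 10 * A ^+ 2 * K ^+ n.
  rewrite ltnS => kn; have [a1 a2] := Hc k kn; have [b1 b2] := Hd _ (leq_subr k n).
  have [m1 m2] := H1_mul a1 b1; split => //; apply: le_trans m2 _.
  have -> : 10 * A ^+ 2 * K ^+ n = 10 * (A * K ^+ k) * (A * K ^+ (n - k)).
    by rewrite -{1}(subnKC kn) exprD; ring.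
  by rewrite ler_pM ?mulr_ge0 ?nrm_ge0// ler_wpM2l.
have [h1 h2] := @nrm_sum n.+1 g (fun k kn => (Hg k kn).1); split => //.
apply: le_trans h2 _; apply: (@le_trans _ _ (\sum_(k < n.+1) 10 * A ^+ 2 * K ^+ n)).
  by apply: ler_sum => k _; have [] := Hg k (ltn_ord k).
by rewrite sumr_const card_ord [leRHS]mulrC [leRHS]mulr_natr.
Qed.

Lemma ps_conv A K c d t x : cbd A K c -> cbd A K d -> 0 <= K -> `|t| * K <= 4^-1 ->
  ps (hconv c d) t x = ps c t x * ps d t x.
Proof.
move=> Hc Hd K0 tK; have b c' : cbd A K c' -> forall n, `|t ^+ n * c' n x| <= 5 * A * (4^-1) ^+ n.
  move=> Hc' n; have [h1 h2] := cbd_pow Hc' K0 tK n.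
  by apply: le_trans (sup_nrm x h1) _; rewrite -mulrA ler_wpM2l.
rewrite /ps /HS -(ser_conv (b _ Hc) (b _ Hd)); congr ser; apply/funext => n.
rewrite /hconv /conv mulr_sumr; apply: eq_bigr => k _.
by rewrite -{1}(subnKC (leq_ord k)) exprD; ring.
Qed.

Lemma hil_ps A K c t : cbd A K c -> 0 <= K -> `|t| * K <= 2^-1 ->
  hil (ps c t) = ps (fun n => hil (c n)) t.
Proof.
move=> Hc K0 tK; rewrite /ps (hil_HS (cbd_pow Hc K0 tK)).
apply/funext => x; rewrite /HS; congr ser; apply/funext => n.
by rewrite hil_Z//; have [] := Hc n.
Qed.

End SobolevSeries.

(** * Local existence by power series in time *)

Section LocalExistence.
Context {R : realType}.
Implicit Types (f g h : R -> R) (x s t r A K : R) (c d : nat -> R -> R) (n k : nat).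

(* The recursion for the Taylor coefficients in time of the solution with data (f, g) uses all
   previous ones, so [taylor f g n] tabulates the coefficients of order at most n. *)
Fixpoint taylor f g n : nat -> (R -> R) * (R -> R) :=
  if n is n'.+1 then fun k => if (k <= n')%N then taylor f g n' k else
    let U k := (taylor f g n' k).1 in let V k := (taylor f g n' k).2 in
    (fun x => n'.+1%:R^-1 * (2 * hconv U V n' x), fun x => n'.+1%:R^-1 * hil (hconv U U n') x)
  else fun _ => (f, g).

Definition tU f g n : R -> R := (taylor f g n n).1.
Definition tV f g n : R -> R := (taylor f g n n).2.

Lemma taylor_stable f g n k : (k <= n)%N -> taylor f g n k = taylor f g k k.
Proof.
elim: n => [|n IH]; first by rewrite leqn0 => /eqP ->.
rewrite leq_eqVlt => /orP[/eqP -> //|]; rewrite ltnS => kn.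
by rewrite /= kn IH.
Qed.

Lemma hconv_ext c c' d d' n : (forall k, (k <= n)%N -> c k = c' k) -> (forall k, (k <= n)%N -> d k = d' k) ->
  hconv c d n = hconv c' d' n.
Proof.
move=> E1 E2; apply/funext => x; rewrite /hconv /conv; apply: eq_bigr => k _.
by rewrite E1 ?leq_ord// E2// leq_subr.
Qed.

Lemma tUS f g n : tU f g n.+1 = fun x => n.+1%:R^-1 * (2 * hconv (tU f g) (tV f g) n x).
Proof.
rewrite {1}/tU /= ltnn /=; apply/funext => x; congr (_ * (2 * _)).
by apply: (congr1 (fun F => F x)); apply: hconv_ext => k kn; rewrite taylor_stable.
Qed.

Lemma tVS f g n : tV f g n.+1 = fun x => n.+1%:R^-1 * hil (hconv (tU f g) (tU f g) n) x.
Proof.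
rewrite {1}/tV /= ltnn /=; apply/funext => x; congr (_ * hil _ x).
by apply: hconv_ext => k kn; rewrite taylor_stable.
Qed.

(** The ratio 20 A is 2 from the equation times 10 from the algebra constant times A: then 2 * 10
    A^2 K^n = A K^(n+1), and the induction closes. *)
Lemma taylor_bound f g A : H1per f -> H1per g -> nrm f <= A -> nrm g <= A ->
  cbd A (20 * A) (tU f g) /\ cbd A (20 * A) (tV f g).
Proof.
move=> Hf Hg fA gA; have A0 : 0 <= A by apply: le_trans fA; exact: nrm_ge0.
have K0 : 0 <= 20 * A by rewrite mulr_ge0.
suff H n : forall k, (k <= n)%N -> (H1per (tU f g k) /\ nrm (tU f g k) <= A * (20 * A) ^+ k) /\
    (H1per (tV f g k) /\ nrm (tV f g k) <= A * (20 * A) ^+ k).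
  by split => n; have [] := H n n (leqnn n).
elim: n => [|n IH] k.
  by rewrite leqn0 => /eqP ->; rewrite expr0 mulr1.
rewrite leq_eqVlt => /orP[/eqP ->|]; last by rewrite ltnS; exact: IH.
have bU k' : (k' <= n)%N -> H1per (tU f g k') /\ nrm (tU f g k') <= A * (20 * A) ^+ k'.
  by move=> /IH [].
have bV k' : (k' <= n)%N -> H1per (tV f g k') /\ nrm (tV f g k') <= A * (20 * A) ^+ k'.
  by move=> /IH [].
have [h1 h2] := hconv_bound A0 K0 bU bV; have [h3 h4] := hconv_bound A0 K0 bU bU.
have n0 : 0 < n.+1%:R :> R by rewrite ltr0n.
have p0 : 0 <= (20 * A) ^+ n by rewrite exprn_ge0.
rewrite tUS tVS; split.
  have [m1 _] := H1_scale 2 h1; have [m2 _] := H1_scale n.+1%:R^-1 m1; split => //.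
  rewrite !nrm_Zeq// normfV !normr_nat ler_pdivrMl// exprS.
  apply: le_trans (ler_wpM2l (ler0n _ 2) h2) _.
  by rewrite le_eqVlt; apply/orP; left; apply/eqP; move: (n.+1%:R : R) (_ ^+ n) => p q; ring.
have [m1 m2] := hil_H1 h3; have [m3 _] := H1_scale n.+1%:R^-1 m1; split => //.
rewrite nrm_Zeq// normfV normr_nat ler_pdivrMl// exprS.
apply: le_trans m2 (le_trans h4 _); rewrite ler_wpM2l ?ler0n//.
rewrite [leRHS]mulrA; apply: ler_wpM2r => //; have := sqr_ge0 A; rewrite expr2; lra.
Qed.

Lemma ps0 c x : ps c 0 x = c 0%N x.
Proof.
apply: (@serP R _ _ `|c 0%N x|) => -[|N]; first by rewrite psum0 subr0 expr0 mulr1.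
rewrite /psum big_ord_recl /= expr0 mul1r big1 => [|i _]; last by rewrite expr0n mul0r.
by rewrite addr0 subrr normr0 mulr_ge0 ?exprn_ge0 ?invr_ge0.
Qed.

Lemma curve_ext D (w w' : R -> R -> R) w1' : (forall t, D t -> w' t = w1' t) -> curve D w w' -> curve D w w1'.
Proof.
move=> E cw; apply: curve_local => t Dt; exists 1, D, w, w'; split => //.
by move=> s Ds _; rewrite E.
Qed.

Lemma solvesE D (u v : R -> R -> R) : solves D u v <->
  curve D u (fun t x => 2 * u t x * v t x) /\ curve D v (fun t => hil (fun x => u t x ^+ 2)).
Proof.
split=> [[u' [v' [cu cv E]]]|[cu cv]]; last by exists (fun t x => 2 * u t x * v t x), (fun t => hil (fun x => u t x ^+ 2)).
by split; [apply: curve_ext cu|apply: curve_ext cv] => t Dt; have [] := E t Dt.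
Qed.

Lemma cbd_hconv A K c d : cbd A K c -> cbd A K d -> 0 <= K -> cbd (10 * A ^+ 2) (2 * K) (hconv c d).
Proof.
move=> Hc Hd K0 n; have A0 := cbd_ge0 Hc.
have [h1 h2] := hconv_bound (n := n) A0 K0 (fun k _ => Hc k) (fun k _ => Hd k); split => //.
apply: le_trans h2 _; rewrite [(2 * K) ^+ n]exprMn [leLHS]mulrCA [leRHS]mulrA mulrA.
apply: ler_wpM2r; first exact: exprn_ge0.
by apply: ler_wpM2l; [rewrite mulr_ge0 ?sqr_ge0|exact: nat_le_exp2S].
Qed.

Lemma local_existence f g A r : H1per f -> H1per g -> nrm f <= A -> nrm g <= A -> 0 < r ->
  1280 * (r * A) <= 1 ->
  exists z y : R -> R -> R, [/\ z 0 = f, y 0 = g, solves [set t | `|t| <= r] z y &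
    forall t, `|t| <= r -> nrm (z t) <= 2 * A /\ nrm (y t) <= 2 * A].
Proof.
move=> Hf Hg fA gA r0 rA; have A0 : 0 <= A by apply: le_trans fA; exact: nrm_ge0.
have K0 : 0 <= 20 * A by rewrite mulr_ge0.
have [bU bV] := taylor_bound Hf Hg fA gA.
have rA0 : 0 <= r * A by rewrite mulr_ge0// ltW.
have r32 : 32 * (r * (20 * A)) <= 1 by lra.
have tK t : `|t| <= r -> `|t| * (20 * A) <= 4^-1.
  by move=> tr; have := ler_wpM2r A0 tr; lra.
have tK2 t : `|t| <= r -> `|t| * (2 * (20 * A)) <= 2^-1.
  by move=> tr; have := ler_wpM2r A0 tr; lra.
have tK1 t : `|t| <= r -> `|t| * (20 * A) <= 2^-1.
  by move=> tr; have := ler_wpM2r A0 tr; lra.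
exists (ps (tU f g)), (ps (tV f g)); split.
- by apply/funext => x; rewrite ps0.
- by apply/funext => x; rewrite ps0.
- exists (ps (dcoef (tU f g))), (ps (dcoef (tV f g))); split; [exact: ps_curve bU K0 r0 r32|exact: ps_curve bV K0 r0 r32|].
  move=> t tr; split.
    apply/funext => x; rewrite -mulrA -(ps_conv x bU bV K0 (tK t tr)).
    have b n : `|t ^+ n * (hconv (tU f g) (tV f g)) n x| <= 5 * (10 * A ^+ 2) * (2^-1) ^+ n.
      have b' := cbd_hconv bU bV K0.
      have [q1 q2] := cbd_pow b' (mulr_ge0 (ler0n _ 2) K0) (tK2 t tr) n.
      by apply: le_trans (sup_nrm x q1) _; rewrite -mulrA ler_wpM2l.
    (* [ser_lin] with a zero first series pulls out the factor 2 of the equation. *)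
    have b0 n : `|0 : R| <= 0 * (2^-1) ^+ n by rewrite mul0r normr0.
    have := ser_lin b0 b 2; rewrite /ps /HS.
    have -> : ser (fun _ : nat => 0 : R) = 0.
      by apply: (@serP R _ _ 0) => N; rewrite /psum big1// subr0 normr0 mul0r.
    rewrite add0r => <-; congr ser; apply/funext => n; rewrite /dcoef tUS add0r mulrA.
    have p0 : n.+1%:R != 0 :> R by rewrite pnatr_eq0.
    by move: (n.+1%:R : R) p0 (t ^+ n) (hconv _ _ n x) => p p0 y z; field.
  have b' := cbd_hconv bU bU K0.
  have -> : (fun x => ps (tU f g) t x ^+ 2) = ps (hconv (tU f g) (tU f g)) t.
    by apply/funext => x; rewrite (ps_conv x bU bU K0 (tK t tr)) expr2.
  rewrite (hil_ps b' (mulr_ge0 (ler0n _ 2) K0) (tK2 t tr)).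
  apply/funext => x; rewrite /ps /HS; congr ser; apply/funext => n.
  by rewrite /dcoef tVS (mulrA n.+1%:R) mulfV ?pnatr_eq0// mul1r.
- by move=> t tr; have [_ ?] := ps_H1 bU K0 (tK1 t tr); have [_ ?] := ps_H1 bV K0 (tK1 t tr).
Qed.

End LocalExistence.

(** * Uniqueness on short intervals and continuation *)

Section Continuation.
Context {R : realType}.
Implicit Types (f g h : R -> R) (x s t r a b B M : R) (D : set R) (u v w z y : R -> R -> R).

Lemma curve_shift D u u' s : curve D u u' -> curve [set t | D (t - s)] (fun t => u (t - s)) (fun t => u' (t - s)).
Proof.
move=> [H1 H2 H3]; have E t r : r - s - (t - s) = r - t by rewrite opprB addrA subrK.
split => [t /= Dt|t e /= Dt e0|t e /= Dt e0]; first exact: H1.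
- have [d [d0 Hd]] := H2 _ e Dt e0; exists d; split => // r Dr rt.
  by have := Hd (r - s) Dr; rewrite E; apply.
- have [d [d0 Hd]] := H3 _ e Dt e0; exists d; split => // r Dr rt.
  by apply: Hd => //; rewrite E.
Qed.

Lemma nrm_eq0 f g : H1per f -> H1per g -> nrm (fun x => f x - g x) <= 0 -> f = g.
Proof.
move=> Hf Hg n0; have [P _] := H1_sub Hf Hg; apply/funext => x; apply/eqP.
by rewrite -subr_eq0 -normr_le0; apply: le_trans (sup_nrm x P) _; rewrite pmulr_rle0.
Qed.

(** If the distance is at most S on the interval, both derivatives differ by at most 20 B S, so the
    mean value inequality bounds the distance by 40 B S (b - a) <= S / 2. Iterating this from 4 B
    gives 0. *)
Lemma solves_unique D u v z y a b B : solves D u v -> solves D z y ->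
  (forall t, a <= t -> t < b -> D t) -> u a = z a -> v a = y a -> 0 <= B -> a < b ->
  (forall t, a <= t -> t < b -> [/\ nrm (u t) <= B, nrm (v t) <= B, nrm (z t) <= B & nrm (y t) <= B]) ->
  80 * (B * (b - a)) <= 1 ->
  forall t, a <= t -> t < b -> u t = z t /\ v t = y t.
Proof.
move=> /solvesE [cu cv] /solvesE [cz cy] HD ua va B0 ab HB small.
have cd := curve_B cu cz; have ce := curve_B cv cy.
have [Hu _ _] := cu; have [Hv _ _] := cv; have [Hz _ _] := cz; have [Hy _ _] := cy.
have key n : forall t, a <= t -> t < b ->
    nrm (fun x => u t x - z t x) + nrm (fun x => v t x - y t x) <= 4 * B * (2^-1) ^+ n.
  elim: n => [|n IH] t at_ tb.
    have Dt := HD t at_ tb; have [b1 b2 b3 b4] := HB t at_ tb.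
    have [_ n1] := H1_sub (Hu t Dt).1 (Hz t Dt).1; have [_ n2] := H1_sub (Hv t Dt).1 (Hy t Dt).1.
    rewrite expr0; lra.
  set S := 4 * B * (2^-1) ^+ n in IH; have S0 : 0 <= S by rewrite !mulr_ge0 ?exprn_ge0 ?invr_ge0.
  have HD' s : a <= s -> s <= t -> D s by move=> as_ st; apply: HD => //; exact: le_lt_trans tb.
  have K0 : 0 <= 20 * B * S by rewrite !mulr_ge0.
  have d0 s : a < s -> s < t -> [/\ nrm (fun x => 2 * u s x * v s x - 2 * z s x * y s x) <= 20 * B * S &
      nrm (fun x => hil (fun x => u s x ^+ 2) x - hil (fun x => z s x ^+ 2) x) <= 20 * B * S].
    move=> /ltW as_ st; have sb := lt_trans st tb; have Ds := HD s as_ sb; have [b1 b2 b3 b4] := HB s as_ sb.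
    have hu := (Hu s Ds).1; have hv := (Hv s Ds).1; have hz := (Hz s Ds).1; have hy := (Hy s Ds).1.
    have [P1 _] := H1_sub hu hz; have [P2 _] := H1_sub hv hy; have IHs := IH s as_ sb.
    have nd := nrm_ge0 (fun x => u s x - z s x); have ne := nrm_ge0 (fun x => v s x - y s x).
    have [Q1 m1] := H1_mul P1 hv; have [Q2 m2] := H1_mul hz P2.
    have [Q3 _] := H1_scale 2 Q1; have [Q4 _] := H1_scale 2 Q2.
    have [Q5 m5] := H1_add Q3 Q4; rewrite !nrm_Zeq// normr_nat in m5.
    split.
      have -> : (fun x => 2 * u s x * v s x - 2 * z s x * y s x) =
        (fun x => 2 * ((u s x - z s x) * v s x) + 2 * (z s x * (v s x - y s x))) by apply/funext => x; ring.
      apply: le_trans m5 _.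
      have k1 : 10 * nrm (fun x => u s x - z s x) * nrm (v s) <= 10 * nrm (fun x => u s x - z s x) * B.
        by rewrite ler_wpM2l// mulr_ge0.
      have k2 : 10 * nrm (z s) * nrm (fun x => v s x - y s x) <= 10 * B * nrm (fun x => v s x - y s x).
        by rewrite ler_wpM2r// ler_wpM2l.
      have k3 := ler_wpM2l B0 IHs; lra.
    have [hu2 _] := H1_mul hu hu; have [hz2 _] := H1_mul hz hz.
    have Eu : (fun x => u s x ^+ 2) = (fun x => u s x * u s x) by [].
    have Ez : (fun x => z s x ^+ 2) = (fun x => z s x * z s x) by [].
    rewrite Eu Ez; have [R1 _] := H1_sub hu2 hz2.
    have -> : (fun x => hil (fun x => u s x * u s x) x - hil (fun x => z s x * z s x) x) =
      hil (fun x => u s x * u s x - z s x * z s x) by apply/funext => x; rewrite hil_B.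
    have [_ m6] := hil_H1 R1; apply: le_trans m6 _.
    have [R2 m7] := H1_add hu hz; have [_ m8] := H1_mul P1 R2.
    have -> : (fun x => u s x * u s x - z s x * z s x) = (fun x => (u s x - z s x) * (u s x + z s x)).
      by apply/funext => x; ring.
    apply: le_trans m8 _.
    have m9 : nrm (fun x => u s x + z s x) <= 2 * B by lra.
    have k1 : 10 * nrm (fun x => u s x - z s x) * nrm (fun x => u s x + z s x) <= 10 * nrm (fun x => u s x - z s x) * (2 * B).
      by rewrite ler_wpM2l// mulr_ge0.
    have k4 : nrm (fun x => u s x - z s x) <= S by lra.
    have k3 := ler_wpM2l B0 k4; lra.
  have MV1 : nrm (fun x => u t x - z t x - (u a x - z a x)) <= 20 * B * S * (t - a).
    by apply: (mean_value_H1 cd at_ K0 HD') => s s1 s2; have [] := d0 s s1 s2.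
  have MV2 : nrm (fun x => v t x - y t x - (v a x - y a x)) <= 20 * B * S * (t - a).
    by apply: (mean_value_H1 ce at_ K0 HD') => s s1 s2; have [] := d0 s s1 s2.
  have E1 : (fun x => u t x - z t x - (u a x - z a x)) = (fun x => u t x - z t x).
    by apply/funext => x; rewrite ua subrr subr0.
  have E2 : (fun x => v t x - y t x - (v a x - y a x)) = (fun x => v t x - y t x).
    by apply/funext => x; rewrite va subrr subr0.
  rewrite E1 in MV1; rewrite E2 in MV2.
  have tab : B * (t - a) <= B * (b - a) by rewrite ler_wpM2l// lerD2r ltW.
  have := ler_wpM2r S0 (le_trans (ler_wpM2l (ler0n _ 80) tab) small).
  rewrite exprS; have -> : 4 * B * (2^-1 * 2^-1 ^+ n) = S / 2 by rewrite /S; ring.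
  move=> h; lra.
move=> t at_ tb; have Dt := HD t at_ tb.
have := half_pow_le0 (k := 0) (fun m _ => key m t at_ tb).
have nd := nrm_ge0 (fun x => u t x - z t x); have ne := nrm_ge0 (fun x => v t x - y t x) => h.
have n1 : nrm (fun x => u t x - z t x) <= 0 by lra.
have n2 : nrm (fun x => v t x - y t x) <= 0 by lra.
by split; [exact: nrm_eq0 (Hu t Dt).1 (Hz t Dt).1 n1|exact: nrm_eq0 (Hv t Dt).1 (Hy t Dt).1 n2].
Qed.

Lemma solves_sub D D' u v : D' `<=` D -> solves D u v -> solves D' u v.
Proof. by move=> sD /solvesE [cu cv]; apply/solvesE; split; exact: curve_sub sD _. Qed.

(** The existence radius depends only on the bound B, so a restart less than a radius before T
    reaches beyond T; uniqueness on the overlap allows gluing. *)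
Lemma continuation T u v B : 0 < T -> solves (Ico0 T%:E) u v ->
  (forall t, Ico0 T%:E t -> nrm (u t) <= B /\ nrm (v t) <= B) ->
  exists T' w q, [/\ T < T', solves (Ico0 T'%:E) w q & forall t, t < T -> w t = u t /\ q t = v t].
Proof.
move=> T0 su HB; have IcoE S t : Ico0 S%:E t <-> 0 <= t /\ t < S by rewrite /Ico0 /= lte_fin.
have D0 : Ico0 T%:E 0 by apply/IcoE.
have B0 : 0 <= B by have [h _] := HB 0 D0; apply: le_trans h; exact: nrm_ge0.
have B1 : 0 < B + 1 by rewrite ltr_wpDl.
(* The numeral is hidden behind an opaque [N] while its reciprocal is manipulated. *)
have [N [N0 NE]] : exists N : R, 0 < N /\ N = 1280 by exists 1280; rewrite ltr0n.
pose r := (N * (B + 1))^-1; have r0 : 0 < r by rewrite invr_gt0 mulr_gt0.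
have rB : N * (r * (B + 1)) = 1 by rewrite mulrCA mulVf// gt_eqF// mulr_gt0.
rewrite NE in rB.
(* At most half a radius before T, but not before 0, so that t0 + r > T in either case. *)
pose t0 := Num.max 0 (T - r / 2).
have t00 : 0 <= t0 by rewrite /t0 le_max lexx.
have t0T : t0 < T by rewrite /t0 gt_max T0 /=; lra.
have Tt0 : T - r / 2 <= t0 by rewrite /t0 le_max lexx orbT.
have Dt0 : Ico0 T%:E t0 by apply/IcoE.
have /solvesE [cu cv] := su; have [Hu _ _] := cu; have [Hv _ _] := cv.
have [hu hv] := HB t0 Dt0.
have [z [y [z0 y0 sz Hzy]]] : exists z y, [/\ z 0 = u t0, y 0 = v t0, solves [set t | `|t| <= r] z y &
    forall t, `|t| <= r -> nrm (z t) <= 2 * (B + 1) /\ nrm (y t) <= 2 * (B + 1)].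
  have rB' : 1280 * (r * (B + 1)) <= 1 by rewrite rB; exact: lexx.
  have BB : B <= B + 1 by rewrite lerDl.
  exact: (local_existence (Hu _ Dt0).1 (Hv _ Dt0).1 (le_trans hu BB) (le_trans hv BB) r0 rB').
pose D1 := [set t | `|t - t0| <= r].
have sz' : solves D1 (fun t => z (t - t0)) (fun t => y (t - t0)).
  by have /solvesE [cz cy] := sz; apply/solvesE; split; [exact: curve_shift cz|exact: curve_shift cy].
have inD1 s : t0 <= s -> s < t0 + r -> D1 s.
  by move=> s1 s2; rewrite /D1 /= ger0_norm ?subr_ge0// lerBlDl ltW.
have agree t : t0 <= t -> t < T -> u t = z (t - t0) /\ v t = y (t - t0).
  apply: (@solves_unique [set t | t0 <= t /\ t < T] u v (fun t => z (t - t0)) (fun t => y (t - t0)) t0 T (2 * (B + 1))).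
  - by apply: solves_sub su => s /= [s1 s2]; apply/IcoE; split => //; exact: le_trans s1.
  - by apply: solves_sub sz' => s /= [s1 s2]; apply: inD1 => //; lra.
  - by move=> s s1 s2.
  - by rewrite subrr z0.
  - by rewrite subrr y0.
  - lra.
  - exact: t0T.
  - move=> s s1 s2; have [] := HB s ltac:(by apply/IcoE; split => //; exact: le_trans s1) => b1 b2.
    have [] := Hzy (s - t0) ltac:(by apply: (inD1 s) => //; lra) => b3 b4.
    by split => //; lra.
  - have : (B + 1) * (T - t0) <= (B + 1) * (r / 2) by apply: ler_wpM2l; [exact: ltW|lra].
    by move: rB; rewrite [r * _]mulrC; lra.
pose w t := if t < T then u t else z (t - t0).
pose q t := if t < T then v t else y (t - t0).
have wE s : t0 <= s -> w s = z (s - t0).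
  by move=> s1; rewrite /w; case: ifPn => // sT; have [] := agree s s1 sT.
have qE s : t0 <= s -> q s = y (s - t0).
  by move=> s1; rewrite /q; case: ifPn => // sT; have [] := agree s s1 sT.
have wE' s : s < T -> w s = u s by rewrite /w => ->.
have qE' s : s < T -> q s = v s by rewrite /q => ->.
have /solvesE [cz cy] := sz'.
exists (t0 + r), w, q; split; [lra| |by move=> t tT; rewrite wE' ?qE'].
(* Times before T use the old solution on radius T - t; times from T on use the restarted one on
   radius T - t0, within which both formulas for [w] and [q] agree with it. *)
apply/solvesE; split; apply: curve_local => t /IcoE [tpos tT']; have [tT|Tt] := ltP t T.
- exists (T - t), (Ico0 T%:E), u, (fun t x => 2 * u t x * v t x); split => //; first by rewrite subr_gt0.
  move=> s /IcoE [s0 _] st; have sT : s < T by move: st; rewrite ltr_norml => /andP[_]; lra.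
  by rewrite wE'// qE'//; split => //; apply/IcoE.
- exists (T - t0), D1, (fun t => z (t - t0)), (fun t x => 2 * z (t - t0) x * y (t - t0) x); split => //.
  + by rewrite subr_gt0.
  + by apply: inD1 => //; lra.
  + move=> s /IcoE [s0 sT'] st; have s1 : t0 <= s by move: st; rewrite ltr_norml => /andP[? _]; lra.
    by rewrite wE// qE//; split => //; exact: inD1.
- exists (T - t), (Ico0 T%:E), v, (fun t => hil (fun x => u t x ^+ 2)); split => //; first by rewrite subr_gt0.
  move=> s /IcoE [s0 _] st; have sT : s < T by move: st; rewrite ltr_norml => /andP[_]; lra.
  by rewrite wE'// qE'//; split => //; apply/IcoE.
- exists (T - t0), D1, (fun t => y (t - t0)), (fun t => hil (fun x => z (t - t0) x ^+ 2)); split => //.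
  + by rewrite subr_gt0.
  + by apply: inD1 => //; lra.
  + move=> s /IcoE [s0 sT'] st; have s1 : t0 <= s by move: st; rewrite ltr_norml => /andP[? _]; lra.
    by rewrite wE// qE//; split => //; exact: inD1.
Qed.

Lemma is_solutionE (u0 v0 : R -> R) (T : \bar R) u v : is_solution u0 v0 T u v <->
  [/\ (0 < T)%E, u 0 = u0, v 0 = v0 & solves (Ico0 T) u v].
Proof.
split=> -[T0 hu hv]; last first.
  move=> [u' [v' [cu cv E]]]; split => //; exists u', v'; split; [exact/curveP|exact/curveP|].
  by move=> t Dt; have := E t Dt; rewrite hilE.
move=> [u' [v' [cu cv E]]]; split => //; exists u', v'; split; [exact/curveP|exact/curveP|].
by move=> t Dt; have := E t Dt; rewrite -hilE.
Qed.

End Continuation.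

(** * The lifespan bound and the blow-up alternative *)

Lemma lipschitz_cont (R : realType) (f : R -> R) : [lipschitz f x | x in [set: R]] -> continuous f.
Proof.
move=> [M [_ HM]]; have k0 : 0 < Num.max M 0 + 1 by rewrite ltr_wpDl// le_max lexx orbT.
have Hk : M < Num.max M 0 + 1 by rewrite ltr_pwDr// le_max lexx.
have {HM} Hf x y : `|f x - f y| <= (Num.max M 0 + 1) * `|x - y| by apply: (HM _ Hk (x, y)).
move=> x; apply/cvgrPdist_le => e e0; exists (e / (Num.max M 0 + 1)); first by rewrite /= divr_gt0.
move=> y; rewrite /ball_ /= => xy; apply: le_trans (Hf x y) _.
by rewrite mulrC -ler_pdivlMr// ltW.
Qed.

(** Checks the scale condition of [riccati_lifespan] for l = C q^(-1/3), with l^3 already expanded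
    to C^3 / q; here c, d, p stand for the cosine, b - a and pi. *)
Lemma lifespan_constant (R : realType) (C c d p : R) : C != 0 -> c != 0 -> d != 0 -> p != 0 ->
  2 / 3 * (2 * c / (p * d ^+ 2)) * (C ^+ 3 * (4 * C * c / (3 * p * d ^+ 2))^-1) = C ^+ 2.
Proof. by move=> C0 c0 d0 p0; field; rewrite C0 c0 d0 p0. Qed.

Unset Implicit Arguments.
Theorem theorem4p2 (R : realType) (u0 v0 : R -> R) (a b : R) (phi : R -> R)
    (hu0 : H1per u0) (hv0 : H1per v0)
    (ha : 0 <= a) (hab : a < b) (hb : b <= 2 * pi) (hba : b - a < pi)
    (hsupp : closure [set x | period x /\ u0 x != 0] `<=` `]a, b[)
    (hphi_per : periodic phi (2 * pi))
    (hphi_lip : [lipschitz phi x | x in [set: R]])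
    (hphi : forall x, a <= x <= b -> phi x = x - a) :
  let C := 4 * \int[leb]_(x in `[a, b]) (phi x * u0 x ^+ 2 * v0 x) in
  let Tstar :=
    (4 * C * cos ((b - a) / 2) / (3 * pi * (b - a) ^+ 2)) `^ (- (1 / 3))
      * I_infty in
  0 < C ->
  forall (Tmax : \bar R) (u v : R -> R -> R),
    is_maximal_solution u0 v0 Tmax u v -> blows_up_by Tstar Tmax u v.
Proof.
move=> C Tstar C0 Tmax u v [/is_solutionE [T0 hu hv su] Hmax].
have p0 := @pi_gt0 R; have d0 : 0 < b - a by rewrite subr_gt0.
have cos0 : 0 < cos ((b - a) / 2) by apply: cos_gt0_pihalf; apply/andP; split; lra.
pose q := 4 * C * cos ((b - a) / 2) / (3 * pi * (b - a) ^+ 2).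
have TE : Tstar = q `^ (- (1 / 3)) * I_infty by [].
have q0 : 0 < q.
  apply: divr_gt0; first by apply: mulr_gt0 => //; exact: mulr_gt0.
  by rewrite !mulr_gt0 ?exprn_gt0.
have I0 : 0 <= I_infty :> R by apply: Rintegral_ge0 => x _; rewrite invr_ge0 sqrtr_ge0.
have Ts0 : 0 <= Tstar by rewrite mulr_ge0 ?powR_ge0.
have bound t1 : 0 < t1 -> (t1%:E < Tmax)%E -> t1 <= Tstar.
  move=> t10 t1T; pose l := C * q `^ (- (1 / 3)).
  have p3 : 0 < q `^ (- (1 / 3)) by exact: powR_gt0.
  have l0 : 0 < l by rewrite mulr_gt0.
  have HD s : 0 <= s -> s <= t1 -> Ico0 Tmax s.
    by move=> s0 st; split => //; apply: le_lt_trans t1T; rewrite lee_fin.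
  have supp x : 0 <= x <= 2 * pi -> u 0 x != 0 -> a < x < b.
    rewrite hu => x2 ux; have : `]a, b[%classic x.
      by apply: hsupp; apply: subset_closure; split => //; rewrite /period /= in_itv.
    by rewrite /= in_itv.
  have := @solves_lifespan R (Ico0 Tmax) u v phi a b t1 l su t10 HD ha hab hb hba supp
    (lipschitz_cont hphi_lip) hphi_per hphi.
  rewrite hu hv -/C => /(_ C0 l0) H.
  have : C / l * t1 <= I_infty.
    have q3 : (q `^ (- (1 / 3))) ^+ 3 = q^-1.
      rewrite -powR_mulrn ?powR_ge0// -powRrM.
      have -> : - (1 / 3) * 3 = -1 :> R by field.
      by rewrite powR_inv1// ltW.
    apply: H; rewrite /l exprMn q3 /q.
    by apply: lifespan_constant; rewrite gt_eqF.
  have -> : C / l = (q `^ (- (1 / 3)))^-1 by rewrite /l invfM mulrA mulfV ?mul1r// gt_eqF.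
  by rewrite ler_pdivrMl.
split.
  (* A lifespan beyond [Tstar] would contain a time larger than [Tstar]: a midpoint if it is finite,
     [Tstar + 1] if not. *)
  rewrite leNgt; apply/negP => TT; case: Tmax T0 su Hmax bound TT => [r| |] // T0 su Hmax bound.
    rewrite lte_fin => TT; have := bound ((Tstar + r) / 2); rewrite lte_fin.
    by move=> /(_ ltac:(lra) ltac:(lra)); lra.
  by move=> _; have := bound (Tstar + 1) ltac:(lra) (ltry _); lra.
move=> M; apply: contrapT => HM.
have HB t : Ico0 Tmax t -> nrm (u t) <= M /\ nrm (v t) <= M.
  move=> Dt; have h : nrm (u t) + nrm (v t) <= M.
    by rewrite leNgt; apply/negP => h; apply: HM; exists t; rewrite -?nrmE.
  by have := nrm_ge0 (u t); have := nrm_ge0 (v t); split; lra.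
(* An infinite lifespan is excluded by the bound again, so [continuation] applies at a finite time
   and its longer solution contradicts maximality. *)
case: Tmax T0 su Hmax bound HM HB => [T| |] // T0 su Hmax bound HM HB; last first.
  by have := bound (Tstar + 1) ltac:(lra) (ltry _); lra.
rewrite lte_fin in T0.
have [T' [w [z [TT sw E]]]] := continuation T0 su HB.
have : (T'%:E <= T%:E)%E.
  apply: (Hmax _ w z).
    apply/is_solutionE; have [E1 E2] := E 0 T0; rewrite E1 E2; split => //.
    by rewrite lte_fin; lra.
  by move=> t [_]; rewrite lte_fin => tT _; exact: E.
by rewrite lee_fin leNgt TT.
Qed.
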